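(* Let $\Gamma=\bigcup_{r=1}^RC_r\subseteq\mathbb{R}^p$ with each $C_r$ convex polyhedral, let $g:\mathbb{R}^d\to\mathbb{R}^n$ be locally Lipschitz continuous, and let $\widetilde{\mathcal F}$ be the solution set of the system $g(x)\le0$, $h(x)=0$, $\Phi_i(x)\in\Gamma$ ($i=1,\dots,l$). Suppose that $g$ is subdifferentially regular and that $h:\mathbb{R}^d\to\mathbb{R}^m$ and $\Phi_i:\mathbb{R}^d\to\mathbb{R}^p$ are smooth. Assume that MPDC-PRCPLD holds at $\bar x\in\widetilde{\mathcal F}$ for this system. Then $\bar x$ satisfies the error bound property, i.e. there exist $\alpha\ge0$ and $\varepsilon>0$ such that $$d_{\widetilde{\mathcal F}}(x)\le\alpha\Big(\|g^+(x)\|+\|h(x)\|+\sum_{i=1}^ld_\Gamma(\Phi_i(x))\Big)\qquad\forall x\in\mathbb{B}_\varepsilon(\bar x).$$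
   Context: Notation. $g^+(x)$ has components $\max\{0,g_i(x)\}$; $\|\cdot\|$ is any norm; $d_S$ is the distance to $S$. $\partial$ and $\widehat\partial$ are the limiting (Mordukhovich) and regular (Fréchet) subdifferentials. A Lipschitz function $\phi$ is subdifferentially regular at $x$ if $\partial\phi(x)=\widehat\partial\phi(x)$; $g$ is subdifferentially regular if each component $g_i$ is so (at every point). $\widehat{\mathcal N}_C$ and $\mathcal{N}_C$ are the regular (Fréchet) and limiting (Mordukhovich) normal cones. Smooth means continuously differentiable. General disjunctive system: $g(x)\le0$, $h(x)=0$, $\Phi_i(x)\in\Gamma_i$ ($i=1,\dots,l$), with $g:\mathbb{R}^d\to\mathbb{R}^n$ locally Lipschitz, $h:\mathbb{R}^d\to\mathbb{R}^m$ and $\Phi_i:\mathbb{R}^d\to\mathbb{R}^{p_i}$ smooth, each $\Gamma_i$ a disjunctive set (a union of finitely many convex polyhedral sets), and solution set $\mathcal F$. $\nabla h_i$ is the gradient (column vector), $\nabla\Phi_i(x)$ the Jacobian matrix, and $\bar I_g:=\{i:g_i(\bar x)=0\}$. Generators. For finite sets $A^I,A^E$ of vectors put $\mathcal{G}(A^I,A^E):=\mathrm{cone}(A^I)+\mathrm{span}(A^E)$ (cone = generated convex cone; both are $\{0\}$ for the empty set). A generator of a convex polyhedral cone $D$ is a pair $(A^I,A^E)$ of finite disjoint sets, with the vectors in $A^E$ linearly independent, such that $D=\mathcal{G}(A^I,A^E)$ and $A^I\cup A^E$ has the minimal possible number of vectors (for $D=\{0\}$ one takes $A^I\cup A^E=\{0\}$).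 If $\Gamma$ is a disjunctive set and $x\in\Gamma$, then $\widehat{\mathcal N}_\Gamma(x)$ is a convex polyhedral cone; fix a generator $(\widehat A^I_\Gamma(x),\widehat A^E_\Gamma(x))$ of it (the same generator for equal cones). For $\bar y\in\Gamma$ there is $\delta>0$ (taken sufficiently small) with $\mathcal{N}_\Gamma(\bar y)=\bigcup_{x\in\mathbb{B}_\delta(\bar y)\cap\Gamma}\widehat{\mathcal N}_\Gamma(x)$, and one sets $A^I_\Gamma(\bar y):=\bigcup_{x\in\mathbb{B}_\delta(\bar y)\cap\Gamma}\widehat A^I_\Gamma(x)$, $A^E_\Gamma(\bar y):=\bigcup_{x\in\mathbb{B}_\delta(\bar y)\cap\Gamma}\widehat A^E_\Gamma(x)$ (finite sets). MPDC-RCPLD. A point $\bar x\in\mathcal F$ satisfies MPDC-RCPLD for the general disjunctive system if: (i) $\{\nabla h_i(x)\}_{i=1}^m$ has constant rank for all $x$ in a neighborhood of $\bar x$. (ii) Let $J\subseteq\{1,\dots,m\}$ be such that $\{\nabla h_i(\bar x)\}_{i\in J}$ is a basis of $\mathrm{span}\{\nabla h_i(\bar x)\}_{i=1}^m$. Whenever there exist $I\subseteq\bar I_g$, a nonzero vector $(\lambda^h,\lambda^g,\bar\eta)\in\mathbb{R}^m\times\mathbb{R}^n\times\prod_{i=1}^l\mathbb{R}^{p_i}$ (with $\lambda^h_i=0$ for $i\notin J$, $\lambda^g_i=0$ for $i\notin I$) with $\lambda^g_i\ge0$, vectors $v_i\in\partial g_i(\bar x)$ $(i\in I)$ and $\bar\eta_i\in\mathcal{N}_{\Gamma_i}(\Phi_i(\bar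 x))$ $(i=1,\dots,l)$ such that $$0=\sum_{i\in I}\lambda_i^gv_i+\sum_{i\in J}\lambda_i^h\nabla h_i(\bar x)+\sum_{i=1}^l\nabla\Phi_i(\bar x)^T\bar\eta_i,$$ then for all sufficiently large $k$ the family $$\{v_i^k\}_{i\in I}\cup\{\nabla h_i(x^k)\}_{i\in J}\cup\bigcup_{i\in\{1,\dots,l\},\ \beta_i\in A_i^I\cup A_i^E}\{\nabla\Phi_i(x^k)^T\beta_i\}$$ is linearly dependent, for any sequences $x^k\to\bar x$, $x^k\ne\bar x$, $v_i^k\in\partial g_i(x^k)$, $v_i^k\to v_i$ $(i\in I)$, and any sets $A_i^I\subseteq A^I_{\Gamma_i}(\Phi_i(\bar x))$, $A_i^E\subseteq A^E_{\Gamma_i}(\Phi_i(\bar x))$ with $A_i^I\cup A_i^E$ linearly independent and $\bar\eta_i\in\mathcal{G}(A_i^I,A_i^E)\subseteq\mathcal{N}_{\Gamma_i}(\Phi_i(\bar x))$ if $\bar\eta_i\ne0$, and $A_i^I\cup A_i^E=\emptyset$ if $\bar\eta_i=0$. MPDC-PRCPLD (piecewise RCPLD). For the system $g(x)\le0$, $h(x)=0$, $\Phi_i(x)\in\Gamma=\bigcup_{r=1}^RC_r$ ($i=1,\dots,l$), it holds at $\bar x\in\widetilde{\mathcal F}$ if, for every partition of $\{1,\dots,l\}$ into sets $P_1,\dots,P_R$ (possibly empty) such that $\bar x$ solves the subsystem $g(x)\le0$, $h(x)=0$, $\Phi_i(x)\in C_r$ for $i\in P_r$, $r=1,\dots,R$,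 MPDC-RCPLD holds at $\bar x$ for that subsystem (viewed as a disjunctive system with $\Gamma_i=C_r$ for $i\in P_r$). *)

(* Defs.v *)
From HB Require Import structures.
From mathcomp Require Import all_boot all_order all_algebra.
From mathcomp Require Import finmap.
From mathcomp Require Import all_classical all_reals all_analysis.

Set Implicit Arguments.
Unset Strict Implicit.
Unset Printing Implicit Defensive.

Import Order.TTheory GRing.Theory Num.Theory.
Import numFieldNormedType.Exports.

Local Open Scope classical_set_scope.
Local Open Scope ring_scope.

(* Vectors of R^n are row vectors 'rV[R]_n.  The library's `|_| on 'rV[R]_n is
   the max norm; it (and its topology) is only used below in notions that do not
   depend on the choice of a norm.  The norms of the error bound are arbitrary. *)

Definition is_norm (R : realType) (V : lmodType R) (N : V -> R) : Prop :=
  [/\ forall x y, N (x + y) <= N x + N y,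
      forall a x, N (a *: x) = `|a| * N x
    & forall x, N x = 0 -> x = 0].

Definition dist (R : realType) (V : lmodType R) (N : V -> R) (S : set V) (x : V)
  : R := inf [set N (x - y) | y in S].

Definition dotv (R : realType) n (u v : 'rV[R]_n) : R := \sum_i u 0 i * v 0 i.

(* The library's 'J f x acts on row vectors from the right; its transpose is
   the usual m x d Jacobian matrix. *)
Definition nabla (R : realType) d m (f : 'rV[R]_d -> 'rV[R]_m) (x : 'rV[R]_d)
  : 'M[R]_(m, d) := ('J f x)^T.

Definition grad (R : realType) d m (f : 'rV[R]_d -> 'rV[R]_m) (i : 'I_m)
  (x : 'rV[R]_d) : 'rV[R]_d := row i (nabla f x).

Definition smooth (R : realType) d m (f : 'rV[R]_d -> 'rV[R]_m) : Prop :=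
  (forall x, differentiable f x) /\ continuous (nabla f).

Definition locally_lipschitz (R : realType) d m (f : 'rV[R]_d -> 'rV[R]_m)
  : Prop :=
  forall x : 'rV[R]_d, exists2 U, nbhs x U & [lipschitz f z | z in U].

Definition coordf (R : realType) d m (f : 'rV[R]_d -> 'rV[R]_m) (i : 'I_m)
  : 'rV[R]_d -> R := fun x => f x 0 i.

Definition posp (R : realType) n (y : 'rV[R]_n) : 'rV[R]_n :=
  \row_i Num.max 0 (y 0 i).

(* phi(y) >= phi(x) + <v, y - x> + o(||y - x||) *)
Definition regular_subdiff (R : realType) d (phi : 'rV[R]_d -> R) (x : 'rV[R]_d)
  : set 'rV[R]_d :=
  [set v | forall e : R, 0 < e ->
     \forall y \near x, phi x + dotv v (y - x) - e * `|y - x| <= phi y].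

Definition limiting_subdiff (R : realType) d (phi : 'rV[R]_d -> R)
  (x : 'rV[R]_d) : set 'rV[R]_d :=
  [set v | exists xs vs : nat -> 'rV[R]_d,
     [/\ xs @ \oo --> x, (phi \o xs) @ \oo --> phi x,
         forall k, regular_subdiff phi (xs k) (vs k)
       & vs @ \oo --> v]].

Definition subdiff_regular (R : realType) d n (g : 'rV[R]_d -> 'rV[R]_n)
  : Prop :=
  forall i x, limiting_subdiff (coordf g i) x = regular_subdiff (coordf g i) x.

(* <v, z - y> <= o(||z - y||) for z in Omega; empty if y is not in Omega *)
Definition regular_normal (R : realType) p (Omega : set 'rV[R]_p) (y : 'rV[R]_p)
  : set 'rV[R]_p :=
  [set v | Omega y /\ forall e : R, 0 < e ->
     \forall z \near y, Omega z -> dotv v (z - y) <= e * `|z - y|].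

Definition limiting_normal (R : realType) p (Omega : set 'rV[R]_p)
  (y : 'rV[R]_p) : set 'rV[R]_p :=
  [set v | exists ys vs : nat -> 'rV[R]_p,
     [/\ ys @ \oo --> y, forall k, regular_normal Omega (ys k) (vs k)
       & vs @ \oo --> v]].

Definition polyhedral (R : realType) p (S : set 'rV[R]_p) : Prop :=
  exists k (a : 'I_k -> 'rV[R]_p) (b : 'I_k -> R),
    S = [set y | forall i, dotv (a i) y <= b i].

Definition polyhedral_cone (R : realType) p (D : set 'rV[R]_p) : Prop :=
  [/\ polyhedral D, D 0 & forall (t : R) y, 0 <= t -> D y -> D (t *: y)].

Definition cone_of (R : realType) p (A : {fset 'rV[R]_p}) : set 'rV[R]_p :=
  [set y | exists2 c : 'rV[R]_p -> R,
     forall a, 0 <= c a & y = \sum_(a <- A) c a *: a].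

Definition gcone (R : realType) p (AI AE : {fset 'rV[R]_p}) : set 'rV[R]_p :=
  [set u + w | u in cone_of AI & w in [set w | w \in <<AE>>%VS]].

Definition generates (R : realType) p (D : set 'rV[R]_p)
  (A : {fset 'rV[R]_p} * {fset 'rV[R]_p}) : Prop :=
  [/\ [disjoint A.1 & A.2]%fset, free A.2 & D = gcone A.1 A.2].

(* For D = {0} the convention is the one-element set {0}, not the (smaller)
   empty set; since free A.2, the zero vector then lies in A.1. *)
Definition is_generator (R : realType) p (D : set 'rV[R]_p)
  (A : {fset 'rV[R]_p} * {fset 'rV[R]_p}) : Prop :=
  [/\ generates D A,
      D = [set 0] -> (A.1 `|` A.2 = [fset 0])%fset
    & D <> [set 0] -> forall B, generates D B ->
        (#|` (A.1 `|` A.2)%fset| <= #|` (B.1 `|` B.2)%fset|)%N].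

(* Generators are fixed as a function of the cone, so that equal cones get the
   same generator. *)
Definition generator_choice (R : realType)
  (gen : forall q, set 'rV[R]_q -> {fset 'rV[R]_q} * {fset 'rV[R]_q}) : Prop :=
  forall p (D : set 'rV[R]_p), polyhedral_cone D -> is_generator D (gen p D).

(* The unions over B_delta(y) decrease with delta and, for a disjunctive Gamma,
   are constant for small delta: "delta sufficiently small" is rendered by
   "for all small delta". *)
Definition genI (R : realType)
  (gen : forall q, set 'rV[R]_q -> {fset 'rV[R]_q} * {fset 'rV[R]_q})
  p (Gamma : set 'rV[R]_p) (y : 'rV[R]_p) : set 'rV[R]_p :=
  [set a | \forall delta \near 0^'+, exists2 x,
     (ball y delta `&` Gamma) x & a \in (gen p (regular_normal Gamma x)).1].

Definition genE (R : realType)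
  (gen : forall q, set 'rV[R]_q -> {fset 'rV[R]_q} * {fset 'rV[R]_q})
  p (Gamma : set 'rV[R]_p) (y : 'rV[R]_p) : set 'rV[R]_p :=
  [set a | \forall delta \near 0^'+, exists2 x,
     (ball y delta `&` Gamma) x & a \in (gen p (regular_normal Gamma x)).2].

Definition solution_set (R : realType) d n m l (p : 'I_l -> nat)
  (g : 'rV[R]_d -> 'rV[R]_n) (h : 'rV[R]_d -> 'rV[R]_m)
  (Phi : forall i, 'rV[R]_d -> 'rV[R]_(p i))
  (Gamma : forall i, set 'rV[R]_(p i)) : set 'rV[R]_d :=
  [set x | [/\ forall i, g x 0 i <= 0, h x = 0
             & forall i, Gamma i (Phi i x)]].

(* A family (repetitions count), so that its linear dependence is ~~ free.
   On row vectors (nabla Phi_i)^T beta is beta *m nabla (Phi i) x. *)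
Definition rcpld_family (R : realType) d n m l (p : 'I_l -> nat)
  (h : 'rV[R]_d -> 'rV[R]_m) (Phi : forall i, 'rV[R]_d -> 'rV[R]_(p i))
  (I : {set 'I_n}) (J : {set 'I_m}) (A : forall i, {fset 'rV[R]_(p i)})
  (x : 'rV[R]_d) (v : 'I_n -> 'rV[R]_d) : seq 'rV[R]_d :=
  [seq v i | i <- enum I] ++ [seq grad h i x | i <- enum J] ++
  flatten [seq [seq beta *m nabla (Phi i) x | beta <- enum_fset (A i)]
          | i <- enum 'I_l].

Definition mpdc_rcpld (R : realType) d n m l (p : 'I_l -> nat)
  (gen : forall q, set 'rV[R]_q -> {fset 'rV[R]_q} * {fset 'rV[R]_q})
  (g : 'rV[R]_d -> 'rV[R]_n) (h : 'rV[R]_d -> 'rV[R]_m)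
  (Phi : forall i, 'rV[R]_d -> 'rV[R]_(p i))
  (Gamma : forall i, set 'rV[R]_(p i)) (xbar : 'rV[R]_d) : Prop :=
  [/\ solution_set g h Phi Gamma xbar,
      \forall x \near xbar, \rank (nabla h x) = \rank (nabla h xbar)
    & forall J : {set 'I_m},
      basis_of <<[seq grad h i xbar | i <- enum 'I_m]>>%VS
               [seq grad h i xbar | i <- enum J] ->
      forall (I : {set 'I_n}) (lh : 'rV[R]_m) (lg : 'rV[R]_n)
        (eta : forall i, 'rV[R]_(p i)) (v : 'I_n -> 'rV[R]_d),
      (forall i, i \in I -> g xbar 0 i = 0) ->
      ~ [/\ lh = 0, lg = 0 & forall i, eta i = 0] ->
      (forall i, i \notin J -> lh 0 i = 0) ->
      (forall i, i \notin I -> lg 0 i = 0) ->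
      (forall i, 0 <= lg 0 i) ->
      (forall i, i \in I -> limiting_subdiff (coordf g i) xbar (v i)) ->
      (forall i, limiting_normal (Gamma i) (Phi i xbar) (eta i)) ->
      0 = \sum_(i in I) lg 0 i *: v i + \sum_(i in J) lh 0 i *: grad h i xbar
          + \sum_i eta i *m nabla (Phi i) xbar ->
      forall (xs : nat -> 'rV[R]_d) (vs : nat -> 'I_n -> 'rV[R]_d)
        (AI AE : forall i, {fset 'rV[R]_(p i)}),
      xs @ \oo --> xbar ->
      (forall k, xs k != xbar) ->
      (forall k i, i \in I -> limiting_subdiff (coordf g i) (xs k) (vs k i)) ->
      (forall i, i \in I -> (fun k => vs k i) @ \oo --> v i) ->
      (forall i, [set` AI i] `<=` genI gen (Gamma i) (Phi i xbar)) ->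
      (forall i, [set` AE i] `<=` genE gen (Gamma i) (Phi i xbar)) ->
      (forall i, eta i <> 0 ->
        [/\ free (AI i `|` AE i)%fset, gcone (AI i) (AE i) (eta i)
          & gcone (AI i) (AE i) `<=` limiting_normal (Gamma i) (Phi i xbar)]) ->
      (forall i, eta i = 0 -> (AI i `|` AE i = fset0)%fset) ->
      \forall k \near \oo,
        ~~ free (rcpld_family h Phi I J (fun i => (AI i `|` AE i)%fset)
                   (xs k) (vs k))].

(* A partition of {1..l} into labelled, possibly empty, classes P_1..P_K is the
   same as a map s : 'I_l -> 'I_K, with P_r the preimage of r. *)
Definition mpdc_prcpld (R : realType) d n m l p K
  (gen : forall q, set 'rV[R]_q -> {fset 'rV[R]_q} * {fset 'rV[R]_q})
  (g : 'rV[R]_d -> 'rV[R]_n) (h : 'rV[R]_d -> 'rV[R]_m)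
  (Phi : 'I_l -> 'rV[R]_d -> 'rV[R]_p) (C : 'I_K -> set 'rV[R]_p)
  (xbar : 'rV[R]_d) : Prop :=
  forall s : 'I_l -> 'I_K,
    solution_set (p := fun=> p) g h Phi (fun i => C (s i)) xbar ->
    mpdc_rcpld (p := fun=> p) gen g h Phi (fun i => C (s i)) xbar.

Definition error_bound (R : realType) d n m l p
  (Nd : 'rV[R]_d -> R) (Nn : 'rV[R]_n -> R) (Nm : 'rV[R]_m -> R)
  (Np : 'rV[R]_p -> R) (g : 'rV[R]_d -> 'rV[R]_n) (h : 'rV[R]_d -> 'rV[R]_m)
  (Phi : 'I_l -> 'rV[R]_d -> 'rV[R]_p) (Gamma : set 'rV[R]_p)
  (xbar : 'rV[R]_d) : Prop :=
  exists alpha eps : R, [/\ 0 <= alpha, 0 < eps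
    & forall x, Nd (x - xbar) <= eps ->
        dist Nd (solution_set (p := fun=> p) g h Phi (fun=> Gamma)) x <=
        alpha * (Nn (posp (g x)) + Nm (h x)
                 + \sum_i dist Np Gamma (Phi i x))].

(* Main.v *)
(* Near [Phi i xbar] the polyhedron [C (s i)] is cut out by the generators of
   its normal cone, so for a fixed choice [s] of pieces the system consists of
   finitely many inequalities phi_t <= 0 and of the equations h_j = 0 for j in
   a basis J. Put F = max_t phi_t + Lam * sum_(j in J) |h_j|.
   By compactness RCPLD gives a gap: near [xbar], a convex combination of
   subgradients that nearly vanishes modulo the gradients of h_J is supported
   on a dependent family, hence, by Caratheodory reduction, can be replaced by
   an exactly vanishing one. At a point with such a relation, F restricted to
   the support of a minimal relation has a local minimum. So every point near
   [xbar] with F > 0 is either a local minimiser of F or admits descent at a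
   uniform rate. As F xbar = 0, a mountain-pass argument excludes local
   minimisers with F > 0 close to [xbar], and uniform descent gives the error
   bound for the subsystem. For a given x, the pieces are those containing
   nearly closest points of Gamma to the Phi_i(x). *)

Require Import Defs.
From mathcomp Require Import all_boot all_order all_algebra.
From mathcomp Require Import finmap.
From mathcomp Require Import all_classical all_reals all_analysis.
From mathcomp Require Import lra ring zify.

Set Implicit Arguments.
Unset Strict Implicit.
Unset Printing Implicit Defensive.

Import Order.TTheory GRing.Theory Num.Theory.
Import numFieldNormedType.Exports.

Local Open Scope classical_set_scope.
Local Open Scope ring_scope.

(** * Row vectors and sequences *)

Section rowvectors.
Context {R : realType}.
Implicit Types d m n : nat.

(** RCPLD asserts linear dependence without sign information, so exact multiplier relations may
    persist arbitrarily close to [xbar], and the slope of F may vanish there: descent at a uniform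
    rate wherever F > 0 cannot be had directly. At a point with a minimal relation the subgradients
    involved span one subspace along which F grows sharply, while a decrease across it would yield a
    second, independent relation. First-order information thus only identifies a local minimiser;
    its exclusion has to be global. The constraints are listed redundantly: the zero function makes
    F nonnegative, and both signs of every h_j recover the equations outside J. These additions
    cannot survive in the limit of a sequence violating the gap, since their gradients vanish or
    lie, by constant rank, in the span of those of h_J. Only h_J is penalised, because independent
    gradients bound the multipliers; this bound drives the compactness arguments and fixes Lam.
    Limits are taken in the max norm, and the given norms enter by equivalence at the end. *)

Lemma normrV_coord d (v : 'rV[R]_d) i : `|v 0 i| <= `|v|.
Proof.
rewrite [leRHS]/Num.norm /= mx_normrE; apply/bigmax_geP; right => /=.
by exists (ord0, i).
Qed.

Lemma normrV_le d (v : 'rV[R]_d) M :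
  0 <= M -> (forall i, `|v 0 i| <= M) -> `|v| <= M.
Proof.
move=> M0 vM; rewrite [leLHS]/Num.norm /= mx_normrE; apply/bigmax_leP; split => //.
by move=> [i j] _ /=; rewrite ord1.
Qed.

Lemma dotvC d (u v : 'rV[R]_d) : dotv u v = dotv v u.
Proof. by apply: eq_bigr => i _; rewrite mulrC. Qed.

Lemma dotvE d (u v : 'rV[R]_d) : dotv u v = (u *m v^T) 0 0.
Proof. by rewrite mxE; apply: eq_bigr => i _; rewrite mxE. Qed.

Lemma dotvDl d (u v w : 'rV[R]_d) : dotv (u + v) w = dotv u w + dotv v w.
Proof. by rewrite !dotvE mulmxDl mxE. Qed.

Lemma dotvDr d (u v w : 'rV[R]_d) : dotv w (u + v) = dotv w u + dotv w v.
Proof. by rewrite !(dotvC w) dotvDl. Qed.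

Lemma dotvZl d (a : R) (u v : 'rV[R]_d) : dotv (a *: u) v = a * dotv u v.
Proof. by rewrite !dotvE -scalemxAl mxE. Qed.

Lemma dotvZr d (a : R) (u v : 'rV[R]_d) : dotv u (a *: v) = a * dotv u v.
Proof. by rewrite !(dotvC u) dotvZl. Qed.

Lemma dotvNl d (u v : 'rV[R]_d) : dotv (- u) v = - dotv u v.
Proof. by rewrite -scaleN1r dotvZl mulN1r. Qed.

Lemma dotvNr d (u v : 'rV[R]_d) : dotv u (- v) = - dotv u v.
Proof. by rewrite !(dotvC u) dotvNl. Qed.

Lemma dotvBl d (u v w : 'rV[R]_d) : dotv (u - v) w = dotv u w - dotv v w.
Proof. by rewrite dotvDl dotvNl. Qed.

Lemma dotvBr d (u v w : 'rV[R]_d) : dotv w (u - v) = dotv w u - dotv w v.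
Proof. by rewrite dotvDr dotvNr. Qed.

Lemma dotv0l d (u : 'rV[R]_d) : dotv 0 u = 0.
Proof. by rewrite -(scale0r 0) dotvZl mul0r. Qed.

Lemma dotv0r d (u : 'rV[R]_d) : dotv u 0 = 0.
Proof. by rewrite dotvC dotv0l. Qed.

Lemma dotv_suml d (I : Type) (s : seq I) (P : pred I) (F : I -> 'rV[R]_d) w :
  dotv (\sum_(i <- s | P i) F i) w = \sum_(i <- s | P i) dotv (F i) w.
Proof.
elim/big_rec2: _ => [|i y x _ <-]; first by rewrite dotv0l.
by rewrite dotvDl.
Qed.

Lemma dotv_mulmx d m (c : 'rV[R]_m) (B : 'M[R]_(m, d)) w :
  dotv (c *m B) w = dotv c (w *m B^T).
Proof. by rewrite !dotvE trmx_mul trmxK mulmxA. Qed.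

Lemma dotvv_ge0 d (u : 'rV[R]_d) : 0 <= dotv u u.
Proof. by apply: sumr_ge0 => i _; rewrite -expr2 sqr_ge0. Qed.

Lemma sqr_norm_dotvv d (u : 'rV[R]_d) : `|u| ^+ 2 <= dotv u u.
Proof.
rewrite -[leRHS]sqr_sqrtr ?dotvv_ge0// lerXn2r ?nnegrE ?normr_ge0 ?sqrtr_ge0//.
apply: normrV_le; first exact: sqrtr_ge0.
move=> i; rewrite -sqrtr_sqr ler_sqrt ?dotvv_ge0//.
rewrite /dotv (bigD1 i)//= -expr2 lerDl.
by apply: sumr_ge0 => j _; rewrite -expr2 sqr_ge0.
Qed.

Lemma dotvv_eq0 d (u : 'rV[R]_d) : dotv u u = 0 -> u = 0.
Proof.
move=> u0; have := sqr_norm_dotvv u; rewrite u0 => h.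
by apply/eqP; rewrite -normr_eq0 -sqrf_eq0 eq_le h sqr_ge0.
Qed.

Lemma dotv_le d (u v : 'rV[R]_d) : `|dotv u v| <= d%:R * (`|u| * `|v|).
Proof.
apply: le_trans (ler_norm_sum _ _ _) _.
apply: (@le_trans _ _ (\sum_(i < d) `|u| * `|v|)).
  by apply: ler_sum => i _; rewrite normrM ler_pM// normrV_coord.
by rewrite sumr_const card_ord mulr_natl.
Qed.

Lemma mx_norm_coord k n (B : 'M[R]_(k, n)) i j : `|B i j| <= `|B|.
Proof.
rewrite [leRHS]/Num.norm /= mx_normrE; apply/bigmax_geP; right => /=.
by exists (i, j).
Qed.

Lemma norm_mulmx_le k n (c : 'rV[R]_k) (B : 'M[R]_(k, n)) :
  `|c *m B| <= k%:R * (`|c| * `|B|).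
Proof.
apply: normrV_le => [|j]; first by rewrite !mulr_ge0.
rewrite mxE; apply: le_trans (ler_norm_sum _ _ _) _.
apply: (@le_trans _ _ (\sum_(i < k) `|c| * `|B|)); last first.
  by rewrite sumr_const card_ord mulr_natl.
apply: ler_sum => i _; rewrite normrM ler_pM// ?normrV_coord//.
exact: mx_norm_coord.
Qed.

Lemma mulmx_norm_le d m (B : 'M[R]_(m, d)) :
  exists2 K, 0 <= K & forall c : 'rV[R]_m, `|c *m B| <= K * `|c|.
Proof.
exists (m%:R * `|B|) => [|c]; first by rewrite mulr_ge0.
by rewrite -mulrA (mulrC `|B|) norm_mulmx_le.
Qed.

End rowvectors.

Lemma near_distP (R : realType) (V : normedModType R) (x : V) (P : V -> Prop) :
  (\forall y \near x, P y) <->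
  exists2 r : R, 0 < r & forall y, `|y - x| < r -> P y.
Proof.
split.
  by move=> /nbhs_ballP[r /= r0 H]; exists r => // y yx; apply: H; rewrite -ball_normE /= distrC.
by move=> [r r0 H]; apply/nbhs_ballP; exists r => // y; rewrite -ball_normE /= distrC; exact: H.
Qed.

Section sequences.
Context {R : realType}.

Lemma cvg_rVP n (u : nat -> 'rV[R]_n) (l : 'rV[R]_n) :
  (forall i, (fun k => u k 0 i) @ \oo --> l 0 i) -> u @ \oo --> l.
Proof.
move=> ul; apply/cvgrPdist_lt => e e0.
have : \forall k \near \oo, forall i, `|l 0 i - u k 0 i| < e / 2.
  apply: filter_forall => i.
  have /cvgrPdist_lt := ul i; apply; lra.
apply: filterS => k H; apply: le_lt_trans (_ : _ <= e / 2) _; last lra.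
by apply: normrV_le => [|i]; [lra|rewrite !mxE; exact/ltW].
Qed.

Lemma cvg_coord n (u : nat -> 'rV[R]_n) (l : 'rV[R]_n) i :
  u @ \oo --> l -> (fun k => u k 0 i) @ \oo --> l 0 i.
Proof.
move=> ul; apply/cvgrPdist_lt => e e0.
have /cvgrPdist_lt/(_ _ e0) := ul; apply: filterS => k.
by apply: le_lt_trans; have := normrV_coord (l - u k) i; rewrite !mxE.
Qed.

Lemma cvg_bigsum (V : normedModType R) (I : Type) (r : seq I) (P : pred I)
    (u : nat -> I -> V) (l : I -> V) :
  (forall i, P i -> (fun k => u k i) @ \oo --> l i) ->
  (fun k => \sum_(i <- r | P i) u k i) @ \oo --> \sum_(i <- r | P i) l i.
Proof.
move=> ul; elim: r => [|i r IH].
  by rewrite big_nil; under eq_fun do rewrite big_nil; exact: cvg_cst.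
rewrite big_cons; under eq_fun do rewrite big_cons.
by case: ifPn => // Pi; apply: cvgD => //; exact: ul.
Qed.

(** Subsequences are encoded by index maps with [k <= s k] instead of increasing ones: cluster
    points yield such maps directly, they compose, and they preserve limits. *)
Lemma cvg_subseq (V : topologicalType) (u : nat -> V) (l : V) (s : nat -> nat) :
  (forall k, (k <= s k)%N) -> u @ \oo --> l -> (u \o s) @ \oo --> l.
Proof.
move=> sk ul; apply: (cvg_comp s u); last exact: ul.
move=> A [N _ NA]; exists N => // k /= Nk; apply: NA => /=.
exact: leq_trans (sk k).
Qed.

Lemma invSn_lt (e : R) : 0 < e -> exists N, forall k, (N <= k)%N -> k.+1%:R^-1 < e.
Proof.
move=> e0; exists (Num.truncn e^-1) => k Nk.
rewrite -[ltRHS]invrK ltf_pV2 ?posrE ?invr_gt0//.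
have e1 : 0 <= e^-1 by rewrite invr_ge0 ltW.
have /andP[_ h] := truncn_itv e1.
by apply: lt_le_trans h _; rewrite ler_nat ltnS.
Qed.

Lemma bolzano_weierstrass_rV n (u : nat -> 'rV[R]_n) M : (forall k, `|u k| <= M) ->
  exists s l, (forall k, (k <= s k)%N) /\ (u \o s) @ \oo --> (l : 'rV[R]_n).
Proof.
move=> uM.
have cA : compact [set v : 'rV[R]_n | forall i, `[- M, M]%classic (v ord0 i)].
  by apply: (@rV_compact _ _ (fun=> `[- M, M]%classic)) => _; exact: segment_compact.
have [|l []] := cA (u @ \oo) _.
  exists 0%N => // k _ i /=; rewrite in_itv /= -ler_norml.
  exact: le_trans (normrV_coord _ _) (uM k).
move=> _ clu.
have /choice[s sP] : forall k, exists j, (k <= j)%N /\ `|l - u j| < k.+1%:R^-1.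
  move=> k.
  have [||v [[j /= jk <-] lv]] := clu (u @` [set j | (k <= j)%N]) (ball l k.+1%:R^-1).
  - by exists k => // j /= kj; exists j.
  - by apply: nbhsx_ballx; rewrite invr_gt0.
  by exists j; split => //; move: lv; rewrite -ball_normE.
exists s, l; split; first by move=> k; have [] := sP k.
apply/cvgrPdist_lt => e e0; have [N NP] := invSn_lt e0.
by exists N => // k /= Nk; exact: lt_trans (proj2 (sP k)) (NP _ Nk).
Qed.

Lemma bolzano_weierstrass_family (Q : finType) (u : nat -> Q -> R) M :
  (forall k q, `|u k q| <= M) ->
  exists s l, (forall k, (k <= s k)%N) /\
    forall q, (fun k => u (s k) q) @ \oo --> (l q : R).
Proof.
move=> uM; pose w k : 'rV[R]_#|Q| := \row_i u k (enum_val i).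
have [|s [l [sk wl]]] := @bolzano_weierstrass_rV _ w `|M|.
  move=> k; apply: normrV_le => // i; rewrite mxE.
  exact: le_trans (uM _ _) (ler_norm _).
exists s, (fun q => l 0 (enum_rank q)); split => // q.
have := cvg_coord (i := enum_rank q) wl.
by under eq_fun do rewrite /= mxE enum_rankK.
Qed.

Lemma bolzano_weierstrass_rV_family n (Q : finType) (u : nat -> Q -> 'rV[R]_n) M :
  (forall k q, `|u k q| <= M) ->
  exists s l, (forall k, (k <= s k)%N) /\
    forall q, (fun k => u (s k) q) @ \oo --> (l q : 'rV[R]_n).
Proof.
move=> uM.
have [|s [l [sk ul]]] := @bolzano_weierstrass_family (Q * 'I_n)%type (fun k q => u k q.1 0 q.2) M.
  by move=> k q; exact: le_trans (normrV_coord _ _) (uM _ _).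
exists s, (fun q => \row_i l (q, i)); split => // q.
by apply: cvg_rVP => i; rewrite mxE; exact: (ul (q, i)).
Qed.

(** Compactness is sequential and only the values of [f] have to converge, so [X] carries no
    topology. This suits minimisation over pairs of a point and a scalar parameter. *)
Lemma seq_compact_min (X : Type) (A : X -> Prop) (f : X -> R) :
  (forall u : nat -> X, (forall k, A (u k)) ->
    exists s l, [/\ forall k, (k <= s k)%N, A l & (f \o u \o s) @ \oo --> f l]) ->
  (exists x, A x) -> exists2 x, A x & forall y, A y -> f x <= f y.
Proof.
move=> cA [a Aa].
have lbA : has_inf [set f x | x in A].
  split; first by exists (f a), a.
  apply: contrapT => nlb.
  have /choice[u uP] : forall k : nat, exists x, A x /\ f x < - k%:R.
    move=> k; apply: contrapT => nk; apply: nlb; exists (- k%:R) => _ [x Ax <-].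
    by rewrite leNgt; apply/negP => fx; apply: nk; exists x.
  have [s [l [sk _ cv]]] := cA u (fun k => proj1 (uP k)).
  have /cvgrPdist_lt/(_ _ ltr01)[N _ H] := cv.
  (* At this index [f] is below [- |f l| - 1], whereas convergence puts it within 1 of [f l]. *)
  pose j := maxn N (Num.truncn `|f l|).+2.
  have := H j (leq_maxl _ _); rewrite /= => fj.
  have [_ fu] := uP (s j).
  have h1 : (Num.truncn `|f l|).+2%:R <= (s j)%:R :> R.
    by rewrite ler_nat (leq_trans (leq_maxr N _) (sk j)).
  have h2 : `|f l| < (Num.truncn `|f l|).+1%:R.
    by have := truncn_itv (normr_ge0 (f l)) => /andP[].
  have h3 : (Num.truncn `|f l|).+2%:R = (Num.truncn `|f l|).+1%:R + 1 :> R.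
    by rewrite -natr1.
  move: fj; rewrite ltr_norml => /andP[_].
  by have := ler_norm (- f l); rewrite normrN; lra.
have /choice[u uP] : forall k : nat,
    exists x, A x /\ f x < inf [set f x | x in A] + k.+1%:R^-1.
  move=> k; have [|_ [x Ax <-] fx] := @inf_adherent _ _ k.+1%:R^-1 _ lbA.
    by rewrite invr_gt0.
  by exists x.
have [s [l [sk Al cv]]] := cA u (fun k => proj1 (uP k)).
exists l => // y Ay; apply: le_trans (_ : _ <= inf [set f x | x in A]) _; last first.
  by apply: ge_inf; [case: lbA|exists y].
suff K : forall e : R, 0 < e -> f l <= inf [set f x | x in A] + e.
  by apply/ler_addgt0Pr.
move=> e e0.
have /cvgrPdist_lt/(_ (e / 2))[|N _ H] := cv; first lra.
have [|M HM] := @invSn_lt (e / 2); first lra.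
have := H (maxn N M) (leq_maxl _ _); rewrite /= ltr_norml => /andP[_].
have [_ fu] := uP (s (maxn N M)).
have := HM (s (maxn N M)) (leq_trans (leq_maxr _ _) (sk _)).
move=> h1 h2.
have h3 : f l - f (u (s (maxn N M))) < e / 2 by exact: h2.
have h4 : f (u (s (maxn N M))) < inf [set f x | x in A] + e / 2.
  by apply: lt_trans fu _; rewrite ltrD2l.
lra.
Qed.

End sequences.

(** * Descent, error bounds and local minimisers *)

Section descent.
Context {R : realType} {d : nat}.
Local Notation E := 'rV[R]_d.
Implicit Types (f : E -> R) (x y z u : E) (s t r e L rho del : R).

Lemma cvg_norm_le n (u : nat -> 'rV[R]_n) (l c : 'rV[R]_n) r :
  u @ \oo --> l -> (forall k, `|u k - c| <= r) -> `|l - c| <= r.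
Proof.
move=> ul uc; rewrite leNgt; apply/negP => lr.
have /cvgrPdist_lt/(_ (`|l - c| - r))[|N _ H] := ul; first lra.
have := H N (leqnn N) => /= h; have h2 := uc N.
have : `|l - c| <= `|l - u N| + `|u N - c|.
  by have := ler_normD (l - u N) (u N - c); rewrite addrA subrK.
lra.
Qed.

Lemma closed_ball_min (f : E -> R) c r : 0 <= r ->
  (forall x, `|x - c| <= r -> {for x, continuous f}) ->
  exists2 x, `|x - c| <= r & forall y, `|y - c| <= r -> f x <= f y.
Proof.
move=> r0 cf; apply: (@seq_compact_min _ _ (fun x : E => `|x - c| <= r)).
  move=> u uA.
  have [|s [l [sk ul]]] := @bolzano_weierstrass_rV _ _ u (r + `|c|).
    move=> k; have := ler_normD (u k - c) c; rewrite subrK.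
    have := uA k; lra.
  have lA : `|l - c| <= r by apply: cvg_norm_le ul _ => k; exact: uA.
  exists s, l; split => //.
  exact: (cvg_comp (u \o s) f ul (cf l lA)).
by exists c; rewrite subrr normr0.
Qed.

Lemma norm_segment_le x y c r t : `|x - c| <= r -> `|y - c| <= r ->
  0 <= t <= 1 -> `|x + t *: (y - x) - c| <= r.
Proof.
move=> xr yr /andP[t0 t1].
have -> : x + t *: (y - x) - c = (1 - t) *: (x - c) + t *: (y - c).
  by rewrite !scalerBr !scalerBl !scale1r opprB addrACA -!addrA; congr (_ + _);
     apply/rowP => i; rewrite !mxE; ring.
apply: le_trans (ler_normD _ _) _; rewrite !normrZ !ger0_norm ?subr_ge0//.
have : (1 - t) * `|x - c| <= (1 - t) * r by apply: ler_wpM2l => //; lra.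
have : t * `|y - c| <= t * r by apply: ler_wpM2l.
lra.
Qed.

Definition local_min f x := exists2 r : R, 0 < r & forall y, `|y - x| < r -> f x <= f y.

(** One direction [u] serves all base points of a ball, because neighbouring points of a polygon are
    later pushed along a common direction. The radius [r] bounds the step length as well. *)
Definition descends f (del : R) y (r : R) u := `|u| <= 1 /\
  forall x (s : R), `|x - y| < r -> 0 <= s < r -> f (x + s *: u) <= f x - del * s.

Definition descent_point f del x := exists u, exists2 r : R, 0 < r & descends f del x r u.

Lemma descends_shrink f del y r u y' r' : descends f del y r u ->
  r' <= r / 2 -> `|y' - y| < r / 2 -> descends f del y' r' u.
Proof.
move=> [u1 H] r'r y'y; split=> // x s xy' /andP[s0 sr].
apply: H; last by rewrite s0 /=; lra.
have := ler_normD (x - y') (y' - y); rewrite addrA subrK; lra.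
Qed.

Definition lipschitz_ball f (c : E) (r L : R) :=
  forall x y, `|x - c| < r -> `|y - c| < r -> `|f x - f y| <= L * `|x - y|.

Lemma lipschitz_ball_continuous f c r L x : 0 < L -> lipschitz_ball f c r L ->
  `|x - c| < r -> {for x, continuous f}.
Proof.
move=> L0 Lf xr; apply/(@cvgrPdist_lt _ _ _ (nbhs x)) => e e0.
have rx : 0 < r - `|x - c| by rewrite subr_gt0.
have eL : 0 < e / L by rewrite divr_gt0.
apply: (iffRL (near_distP x _)); exists (Num.min (r - `|x - c|) (e / L)).
  by rewrite lt_min rx.
move=> y; rewrite lt_min => /andP[xy1 xy2].
apply: le_lt_trans (Lf _ _ xr _) _.
  have := ler_distD x y c; lra.
by rewrite -ltr_pdivlMl// mulrC distrC.
Qed.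

(* Minimise [f + del/2 |. - x|]: at a minimiser [f] has no descent direction. *)
Lemma error_bound_of_descent f xbar rho L del :
  0 < rho -> 0 < L -> 0 < del -> lipschitz_ball f xbar rho L ->
  (forall x, 0 <= f x) -> f xbar = 0 ->
  (forall x, `|x - xbar| < rho -> 0 < f x -> descent_point f del x) ->
  exists2 rho' : R, 0 < rho' & forall x, `|x - xbar| < rho' ->
    exists y, f y = 0 /\ `|x - y| <= 2 / del * f x.
Proof.
move=> rho0 L0 del0 Lf f0 fxbar desc.
have K0 : 0 <= 2 / del * L by rewrite !mulr_ge0 ?invr_ge0// ltW.
(* Keeps both [|x - xbar|] and [2 / del * f x] below [rho / 4], so that the minimiser lies in the
   open ball of radius [rho / 2] and can still be moved. *)
exists (rho / 4 / (1 + 2 / del * L)).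
  by rewrite !divr_gt0//; lra.
move=> x xr.
have {}xr : `|x - xbar| * (1 + 2 / del * L) < rho / 4.
  by rewrite -ltr_pdivlMr//; lra.
have xr4 : `|x - xbar| < rho / 4.
  by apply: le_lt_trans xr; rewrite ler_peMr// lerDl.
have fx : f x <= L * `|x - xbar|.
  have := Lf x xbar; rewrite subrr normr0 fxbar subr0 ger0_norm//.
  by apply=> //; lra.
have bx : 2 / del * f x < rho / 4.
  apply: le_lt_trans xr; rewrite mulrDr mulr1 mulrC.
  apply: le_trans (_ : _ <= L * `|x - xbar| * (2 / del)) _.
    by apply: ler_wpM2r => //; rewrite divr_ge0 ?ltW.
  have := normr_ge0 (x - xbar); nra.
pose G y := f y + del / 2 * `|y - x|.
have LG : lipschitz_ball G xbar rho (L + del / 2).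
  move=> a b ar br; rewrite /G.
  have -> : f a + del / 2 * `|a - x| - (f b + del / 2 * `|b - x|) =
      f a - f b + del / 2 * (`|a - x| - `|b - x|) by ring.
  apply: le_trans (ler_normD _ _) _; rewrite mulrDl; apply: lerD; first exact: Lf.
  rewrite normrM (gtr0_norm (_ : 0 < del / 2)); last lra.
  apply: ler_wpM2l; first lra.
  by apply: le_trans (ler_dist_dist _ _) _; rewrite opprB addrA subrK.
have Gc y : `|y - xbar| <= rho / 2 -> {for y, continuous G}.
  by move=> yr; apply: (lipschitz_ball_continuous _ LG); lra.
have rho2 : 0 <= rho / 2 by lra.
have [y /= yr ymin] := closed_ball_min rho2 Gc.
have Gyx : G y <= f x.
  have := ymin x; rewrite /G subrr normr0 mulr0 addr0; apply; lra.
have yx : `|x - y| <= 2 / del * f x.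
  rewrite distrC; have d2 : 0 < del / 2 by lra.
  rewrite -(ler_pM2l d2); move: Gyx; rewrite /G.
  have -> : del / 2 * (2 / del * f x) = f x by field; rewrite gt_eqF.
  have := f0 y; lra.
exists y; split => //; apply/eqP; rewrite eq_le f0 andbT leNgt; apply/negP => fy.
have yr2 : `|y - xbar| < rho / 2.
  have := ler_distD x y xbar; rewrite (distrC y x); lra.
have [|u [r r0 [u1 H]]] := desc y _ fy; first lra.
pose s := Num.min (r / 2) (rho / 2 - `|y - xbar|).
have s0 : 0 < s by rewrite lt_min; apply/andP; split; lra.
have sr : s < r by rewrite /s gt_min; apply/orP; left; lra.
have srho : s <= rho / 2 - `|y - xbar| by rewrite /s ge_min lexx orbT.
have su : `|s *: u| <= s by rewrite normrZ gtr0_norm// ler_piMr// ltW.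
(* A step of length [s] lowers [f] by [del * s] and raises the penalty by at most [del / 2 * s], so
   [G] would decrease. *)
have := ymin (y + s *: u); rewrite /G.
have h1 : `|y + s *: u - xbar| <= rho / 2.
  have := ler_normD (y - xbar) (s *: u); rewrite addrAC; lra.
have h2 : `|y + s *: u - x| <= `|y - x| + s.
  have := ler_normD (y - x) (s *: u); rewrite addrAC; lra.
have := H y s; rewrite subrr normr0 => /(_ r0); rewrite sr (ltW s0) => /(_ isT).
move=> h3 /(_ h1).
have : del / 2 * `|y + s *: u - x| <= del / 2 * (`|y - x| + s).
  by apply: ler_wpM2l h2; lra.
have := mulr_gt0 del0 s0.
lra.
Qed.

(** Polygons play the role of the paths of a mountain-pass argument: a push acts on their points,
    and induction over segments replaces reasoning on a curve parameter. *)
Inductive linked (V : E -> Prop) x : E -> Prop :=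
| linked_refl : V x -> linked V x x
| linked_step y z : linked V x y ->
    (forall t : R, 0 <= t <= 1 -> V (y + t *: (z - y))) -> linked V x z.

Lemma linked_mem V x z : linked V x z -> V z.
Proof.
case=> // y {}z _ /(_ 1); rewrite ler01 lexx scale1r addrC subrK; exact.
Qed.

(** Cutting each segment into equal pieces shorter than [e] turns induction over the polygon into
    induction over arbitrarily small moves, which is the scale at which local descent information
    can be used. *)
Lemma linked_ind_small V (P : E -> Prop) x z e : 0 < e -> P x ->
  (forall y y', V y -> V y' -> `|y' - y| < e -> P y -> P y') ->
  linked V x z -> P z.
Proof.
move=> e0 Px step; elim=> // y {}z _ Py yz.
pose N := (Num.truncn (`|z - y| / e)).+1.
have N0 : 0 < N%:R :> R by rewrite ltr0n.
have zyN : `|z - y| / N%:R < e.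
  rewrite ltr_pdivrMr// mulrC -ltr_pdivrMr//.
  by have /andP[_] := truncn_itv (divr_ge0 (normr_ge0 (z - y)) (ltW e0)).
have tN k : (k <= N)%N -> 0 <= (k%:R / N%:R : R) <= 1.
  by move=> kN; rewrite divr_ge0//= ler_pdivrMr// mul1r ler_nat.
have H k : (k <= N)%N -> P (y + (k%:R / N%:R) *: (z - y)).
  elim: k => [|k IH] kN; first by rewrite mul0r scale0r addr0.
  apply: (step (y + (k%:R / N%:R) *: (z - y))).
  - exact: yz (tN k (ltnW kN)).
  - exact: yz (tN k.+1 kN).
  - rewrite opprD addrACA subrr add0r -scalerBl -mulrBl -natr1 addrAC subrr add0r.
    by rewrite mul1r normrZ gtr0_norm ?invr_gt0// mulrC.
  - exact: IH (ltnW kN).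
have := H N (leqnn N).
by rewrite divff ?gt_eqF// scale1r addrC subrK.
Qed.

(** Compactness of the closed ball makes the local dichotomy uniform. A limit [l] of points
    violating all three alternatives would have [f l = c]; then a descent direction at [l] serves
    its neighbours, and a local minimum at [l] means [f >= c] around it. *)
Lemma mountain_pass_cover f xbar (c del rad rho L : R) : 0 < L ->
  lipschitz_ball f xbar rho L -> rad < rho -> 0 < c ->
  (forall x, `|x - xbar| < rho -> 0 < f x ->
    local_min f x \/ descent_point f del x) ->
  exists2 r : R, 0 < r & forall y, `|y - xbar| <= rad ->
    [\/ exists u, descends f del y r u,
        forall x, `|x - y| < r -> c <= f x | r <= `|f y - c|].
Proof.
move=> L0 Lf radrho c0 dich; apply: contrapT => nH.
have /choice[y yP] : forall k : nat, exists y, `|y - xbar| <= rad /\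
    ~ [\/ exists u, descends f del y k.+1%:R^-1 u,
        forall x, `|x - y| < k.+1%:R^-1 -> c <= f x | k.+1%:R^-1 <= `|f y - c|].
  move=> k; apply: contrapT => nk; apply: nH; exists k.+1%:R^-1.
    by rewrite invr_gt0.
  by move=> y yr; apply: contrapT => ny; apply: nk; exists y.
have [|s [l [sk yl]]] := @bolzano_weierstrass_rV _ _ y (rad + `|xbar|).
  move=> k; have [yr _] := yP k.
  have := ler_normD (y k - xbar) xbar; rewrite subrK; lra.
have lr : `|l - xbar| <= rad by apply: cvg_norm_le yl _ => k; have [] := yP (s k).
have near_l (e : R) : 0 < e -> exists k, `|y (s k) - l| < e /\ (s k).+1%:R^-1 < e.
  move=> e0; have /cvgrPdist_lt/(_ _ e0)[N _ HN] := yl.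
  have [M HM] := invSn_lt e0.
  exists (maxn N M); split; first by rewrite distrC; apply: HN => /=; exact: leq_maxl.
  by apply: HM; exact: leq_trans (leq_maxr N M) (sk _).
have lrho : `|l - xbar| < rho by lra.
have [flc|flc] := eqVneq (f l) c; last first.
  pose e : R := `|f l - c|.
  have e0 : 0 < e by rewrite normr_gt0 subr_eq0.
  have cf := lipschitz_ball_continuous L0 Lf lrho.
  have e2 : 0 < e / 2 by lra.
  have /cvgrPdist_lt/(_ _ e2) ne := cf.
  have [r1 r10 H1] := (iffLR (near_distP l _)) ne.
  have [|k [kl ke]] := near_l (Num.min r1 (e / 2)).
    by rewrite lt_min r10.
  move: kl ke; rewrite !lt_min => /andP[kl _] /andP[_ ke].
  have [_ []] := yP (s k); apply: Or33.
  have h := H1 _ kl.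
  have hd : e <= `|f l - f (y (s k))| + `|f (y (s k)) - c| by exact: ler_distD.
  by apply: ltW; apply: lt_le_trans ke _; lra.
have fl0 : 0 < f l by rewrite flc.
have [[r1 r10 H1]|[u [r1 r10 H1]]] := dich l lrho fl0.
  have [|k [kl ke]] := near_l (r1 / 2); first lra.
  have [_ []] := yP (s k); apply: Or32 => x xy; rewrite -flc; apply: H1.
  have xy2 := lt_trans xy ke; have := ler_distD (y (s k)) x l; lra.
have [|k [kl ke]] := near_l (r1 / 2); first lra.
have [_ []] := yP (s k); apply: Or31; exists u.
by apply: descends_shrink H1 _ kl; exact: ltW.
Qed.

(* Among the polygons from [xbar] to a local minimiser [z] that stay in
   [{f <= c}] and in a ball whose radius grows as [c] decreases, no level [c]
   can be minimal: pushing a polygon down by [theta] lowers its level by about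
   [del * theta] at the cost of [theta] in the radius. *)
Lemma no_local_min_of_descent f xbar rho L del :
  0 < rho -> 0 < L -> 0 < del -> lipschitz_ball f xbar rho L -> f xbar = 0 ->
  (forall x, `|x - xbar| < rho -> 0 < f x ->
    local_min f x \/ descent_point f del x) ->
  exists2 rho' : R, 0 < rho' & forall z, `|z - xbar| < rho' -> 0 < f z ->
    ~ local_min f z.
Proof.
move=> rho0 L0 del0 Lf fxbar dich.
have K0 : 0 <= 2 / del * L by rewrite !mulr_ge0 ?invr_ge0// ltW.
exists (rho / 4 / (1 + 2 / del * L)).
  by rewrite !divr_gt0//; lra.
move=> z zr fz zmin.
(* [c0] bounds [f] on the segment from [xbar] to [z], so this level is attained. In [rad], lowering
   the level by [del * th / 2] frees exactly the radius [th], the length of one push. *)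
pose tau : R := `|z - xbar|; pose c0 : R := L * tau.
pose rad (c : R) : R := tau + 2 / del * (c0 - c).
have tau0 : 0 <= tau by exact: normr_ge0.
have d2 : 0 < 2 / del by rewrite divr_gt0.
have rad_le (c c' : R) : c <= c' -> rad c' <= rad c.
  by move=> cc'; rewrite lerD2l ler_pM2l//; lra.
have rad0 : rad 0 < rho / 4.
  have : tau * (1 + 2 / del * L) < rho / 4 by rewrite -ltr_pdivlMr//; lra.
  by rewrite /rad /c0; congr (_ < _); ring.
pose V (c : R) x := f x <= c /\ `|x - xbar| <= rad c.
pose S := [set c : R | 0 <= c /\ linked (V c) xbar z].
have rho_of (c : R) x : 0 <= c -> `|x - xbar| <= rad c -> `|x - xbar| < rho.
  by move=> c_ge0 h; have := rad_le _ _ c_ge0; lra.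
have c00 : 0 <= c0 by rewrite mulr_ge0 // ltW.
have Sc0 : S c0.
  split=> //; apply: (@linked_step _ _ xbar).
    by apply: linked_refl; split; rewrite ?fxbar// subrr normr0 /rad subrr mulr0 addr0.
  move=> t t01; have tn : `|xbar + t *: (z - xbar) - xbar| <= tau.
    rewrite addrC addKr normrZ; case/andP: t01 => t0 t1.
    by rewrite ger0_norm// ler_piMl.
  have tr : `|xbar + t *: (z - xbar) - xbar| <= rad c0.
    by rewrite /rad subrr mulr0 addr0.
  split => //.
  have := Lf (xbar + t *: (z - xbar)) xbar (rho_of _ _ c00 tr).
  rewrite subrr normr0 fxbar subr0 => /(_ rho0) h.
  apply: le_trans (ler_norm _) _; apply: le_trans h _.
  by apply: ler_wpM2l => //; exact: ltW.
have Sinf : has_inf S by split; [exists c0|exists 0 => c []].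
pose cs : R := inf S.
have cs_le c : S c -> cs <= c by move=> Sc; apply: ge_inf => //; case: Sinf.
have fz_le c : S c -> f z <= c by move=> [_ /linked_mem[]].
have fzcs : f z <= cs.
  apply: lb_le_inf; first by exists c0.
  by move=> c /fz_le.
have cs0 : 0 < cs by lra.
have csc0 : cs <= c0 by exact: cs_le.
have [|r0 r00 cover] := @mountain_pass_cover f xbar cs del (rad 0) rho L L0 Lf _ cs0 dich.
  lra.
(* The push length: a push stays inside the uniform radius [r0], the levels involved stay within
   [r0] of [cs], which discards the third alternative of the cover, and the lowered level stays
   positive. *)
have [th [th0 th1 th2 th3]] : exists th : R,
    [/\ 0 < th, th < r0 / 2, del * th < r0 & del * th < cs].
  exists (Num.min (r0 / 4) (Num.min (r0 / (2 * del)) (cs / (2 * del)))).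
  have h1 : 0 < r0 / (2 * del) by rewrite divr_gt0// mulr_gt0.
  have h2 : 0 < cs / (2 * del) by rewrite divr_gt0// mulr_gt0.
  set m := Num.min _ _.
  have m0 : 0 < m by rewrite !lt_min h1 h2 !andbT; lra.
  have m1 : m <= r0 / 4 by rewrite ge_min lexx.
  have m2 : m <= r0 / (2 * del) by rewrite !ge_min lexx orbT.
  have m3 : m <= cs / (2 * del) by rewrite !ge_min lexx !orbT.
  split => //; first lra.
    move: m2; rewrite ler_pdivlMr ?mulr_gt0//; nra.
  move: m3; rewrite ler_pdivlMr ?mulr_gt0//; nra.
have dth : 0 < del * th by exact: mulr_gt0.
have [c [c_ge0 Ec] ccs] : exists2 c, S c & c < cs + del * th / 4.
  by apply: inf_adherent => //; lra.
have csc : cs <= c by exact: cs_le.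
(* [c1] is the level to be reached. A push from level at most [c < cs + del * th / 4] lands below
   [c2], and the margin [del * th / 4] between [c2] and [c1] absorbs the variation of [f] on short
   connecting segments. *)
pose c1 : R := cs - del * th / 2.
pose c2 : R := cs - 3 * (del * th) / 4.
have c10 : 0 < c1 by rewrite /c1; lra.
have rad1 : rad c1 = rad cs + th by rewrite /rad /c1; field; rewrite gt_eqF.
have radc : rad c <= rad cs by exact: rad_le.
pose eps : R := Num.min (r0 / 2) (del * th / (4 * L)).
have eps0 : 0 < eps by rewrite lt_min; apply/andP; split; [lra|rewrite divr_gt0 ?mulr_gt0].
have epsr : eps <= r0 / 2 by rewrite ge_min lexx.
have epsL : L * eps <= del * th / 4.
  have : eps <= del * th / (4 * L) by rewrite ge_min lexx orbT.
  rewrite ler_pdivlMr ?mulr_gt0//; lra.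
(* The invariant carried along the polygon: a low point is itself reached below level [c1], a high
   point is reached after being pushed down. *)
pose good y := (f y <= c2 /\ linked (V c1) xbar y) \/
  (c2 < f y /\ exists u, descends f del y r0 u /\ linked (V c1) xbar (y + th *: u)).
have push_rad y u (s : R) : `|y - xbar| <= rad c -> `|u| <= 1 -> 0 <= s <= th ->
    `|y + s *: u - xbar| <= rad c1.
  move=> yr u1 /andP[s0 sth]; rewrite addrAC; apply: le_trans (ler_normD _ _) _.
  rewrite normrZ ger0_norm// rad1.
  have : s * `|u| <= s by rewrite ler_piMr.
  lra.
have lipV y y' : `|y - xbar| <= rad c1 -> `|y' - xbar| <= rad c1 ->
    `|y' - y| < eps -> f y <= c1 - del * th / 4 ->
    forall t : R, 0 <= t <= 1 -> V c1 (y + t *: (y' - y)).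
  move=> yr y'r yy' fy t t01; have tr := norm_segment_le yr y'r t01.
  split => //; have := Lf _ _ (rho_of _ _ (ltW c10) tr) (rho_of _ _ (ltW c10) yr).
  rewrite [y + _ - y]addrC addKr normrZ; case/andP: t01 => t0 t1; rewrite ger0_norm//.
  move=> h; have h1 := le_trans (ler_norm _) h.
  have h2 : t * `|y' - y| <= eps.
    by apply: le_trans (ltW yy'); rewrite ler_piMl.
  have h3 : L * (t * `|y' - y|) <= L * eps by apply: ler_wpM2l h2; exact: ltW.
  lra.
have segE (y u : E) (t : R) : y + t *: (y + th *: u - y) = y + (t * th) *: u.
  by rewrite [y + _ - y]addrC addKr scalerA.
have segE' (y u : E) (t : R) : y + th *: u + t *: (y - (y + th *: u)) = y + ((1 - t) * th) *: u.
  by rewrite opprD addNKr scalerN scalerA -addrA -scalerBl; congr (_ + _ *: _); ring.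
have tth (t : R) : 0 <= t <= 1 -> 0 <= t * th <= th.
  by move=> /andP[t0 t1]; rewrite mulr_ge0 ?(ltW th0)//= ler_piMl// ltW.
have tth0 (t : R) : 0 <= t <= 1 -> 0 <= t * th < r0.
  by move=> /tth/andP[-> h] /=; lra.
have onem01 (t : R) : 0 <= t <= 1 -> 0 <= 1 - t <= 1.
  by move=> /andP[t0 t1]; rewrite subr_ge0 t1 gerBl t0.
have push y y' u : descends f del y r0 u -> `|y' - y| < eps -> forall s : R, 0 <= s < r0 ->
    f (y' + s *: u) <= f y' - del * s.
  by move=> [_ H] yy' s sr; apply: H sr; lra.
have step y y' : V c y -> V c y' -> `|y' - y| < eps -> good y -> good y'.
  have c1E : c1 = cs - del * th / 2 by [].
  have c2E : c2 = cs - 3 * (del * th) / 4 by [].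
  clearbody c1 c2 eps cs rad tau c0; clear K0 dich fz zmin c00 Sc0 cs_le fz_le fzcs csc0 Ec Sinf epsL th3 fxbar zr.
  move=> [fyc yr] [fyc' yr'] yy'.
  have yr1 : `|y - xbar| <= rad c1 by lra.
  have yr1' : `|y' - xbar| <= rad c1 by lra.
  have r0th : 0 <= th < r0 by apply/andP; split; lra.
  have thth : 0 <= th <= th by rewrite ltW//=.
  have yy0 : `|y - y| < eps by rewrite subrr normr0.
  have yy'0 : `|y' - y'| < eps by rewrite subrr normr0.
  have y'y : `|y - y'| < eps by rewrite distrC.
  have cov p : `|p - xbar| <= rad c -> f p <= c -> c2 < f p ->
      (exists u, descends f del p r0 u) \/ forall x, `|x - p| < r0 -> cs <= f x.
    move=> pr fp fpc2; have [||//|] := cover p; first by have := rad_le _ _ c_ge0; lra.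
    - by left.
    - by right.
    - move=> h; exfalso; move: h; rewrite leNgt ltr_norml.
      by move=> /negP; apply; apply/andP; split; lra.
  have shift (a b u : E) : `|a - b| < eps -> `|a + th *: u - (b + th *: u)| < eps.
    by rewrite opprD addrACA subrr addr0.
  (* Four cases, by the positions of [y] and [y'] relative to [c2]. If [y'] is high it has a descent
     direction: [f >= cs] around it is refuted by [y] when that is low, and by the pushed [y]
     otherwise. When both are high, the two pushes of [y] are joined through convex combinations of
     [u] and [v], which also descend. *)
  case=> [[fyl yl]|[fyl [u [yu yl]]]]; have [fyl'|fyl'] := leP (f y') c2.
  - left; split => //; apply: (linked_step yl).
    by apply: lipV => //; lra.
  - right; split => //; have [[u y'u]|] := cov y' yr' fyc' fyl'; last first.
      by move=> /(_ y); have := yy'; rewrite distrC => h /(_ (lt_le_trans h _)); lra.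
    have u1 : `|u| <= 1 by case: y'u.
    exists u; split => //.
    apply: (@linked_step _ _ (y + th *: u)).
      apply: (linked_step yl) => t t01; rewrite segE; split; last exact: push_rad (tth _ t01).
      have := push _ _ _ y'u y'y _ (tth0 _ t01).
      have /andP[h _] := tth _ t01; have := mulr_ge0 (ltW del0) h.
      lra.
    apply: lipV; [exact: push_rad|exact: push_rad|exact: shift|].
    have := push _ _ _ y'u y'y _ r0th; lra.
  - left; split => //; have u1 : `|u| <= 1 by case: yu.
    apply: (@linked_step _ _ (y' + th *: u)).
      apply: (linked_step yl).
      apply: lipV; [exact: push_rad|exact: push_rad|exact: shift|].
      have := push _ _ _ yu yy0 _ r0th; lra.
    move=> t t01; rewrite segE'.
    have t01' : 0 <= 1 - t <= 1 by exact: onem01.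
    split; last exact: push_rad (tth _ t01').
    have := push _ _ _ yu yy' _ (tth0 _ t01').
    have /andP[h _] := tth _ t01'; have := mulr_ge0 (ltW del0) h.
    lra.
  - right; split => //; have u1 : `|u| <= 1 by case: yu.
    have fyu := push _ _ _ yu yy0 _ r0th.
    have [[v y'v]|] := cov y' yr' fyc' fyl'; last first.
      move=> /(_ (y + th *: u)).
      have h : `|y + th *: u - y'| < r0.
        rewrite addrAC; apply: le_lt_trans (ler_normD _ _) _.
        have : `|th *: u| <= th by rewrite normrZ gtr0_norm// ler_piMr// ltW.
        lra.
      by move=> /(_ h); lra.
    have v1 : `|v| <= 1 by case: y'v.
    exists v; split => //.
    apply: (@linked_step _ _ (y + th *: v)).
      apply: (linked_step yl) => t t01.
      have -> : y + th *: u + t *: (y + th *: v - (y + th *: u)) =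
          y + th *: (u + t *: (v - u)).
        rewrite opprD addrACA subrr add0r -scalerBr scalerA [t * th]mulrC -scalerA.
        by rewrite -addrA -scalerDr.
      split; last first.
        apply: push_rad => //; have := @norm_segment_le u v 0 1 t.
        by rewrite !subr0; exact.
      have -> : y + th *: (u + t *: (v - u)) = y + (t * th) *: v + ((1 - t) * th) *: u.
        by apply/rowP => i; rewrite !mxE; ring.
      have t01' : 0 <= 1 - t <= 1 by exact: onem01.
      have h1 := push _ _ _ y'v y'y _ (tth0 _ t01).
      have h2 : f (y + (t * th) *: v + ((1 - t) * th) *: u) <=
          f (y + (t * th) *: v) - del * ((1 - t) * th).
        case: yu => _; apply; last exact: tth0.
        rewrite addrC addKr normrZ; have /andP[h _] := tth _ t01.
        rewrite ger0_norm//; have : t * th * `|v| <= t * th by rewrite ler_piMr.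
        have /andP[_] := tth _ t01; lra.
      have : del * ((1 - t) * th) + del * (t * th) = del * th by ring.
      lra.
    apply: lipV; [exact: push_rad|exact: push_rad|exact: shift|].
    have := push _ _ _ y'v y'y _ r0th; lra.
have good0 : good xbar.
  left; rewrite fxbar; split; first by rewrite /c2; lra.
  apply: linked_refl; split; first by rewrite fxbar ltW.
  rewrite subrr normr0; apply: addr_ge0 => //; apply: mulr_ge0; first exact: ltW.
  by rewrite /c1; lra.
have := linked_ind_small eps0 good0 step Ec.
(* Either [z] is reached at level [c1 < cs], against the choice of the infimum, or [f] descends at
   the local minimiser [z]. *)
case=> [[_ zl]|[_ [u [[u1 H] _]]]].
  by have := cs_le c1 (conj (ltW c10) zl); rewrite /c1; lra.
case: zmin => r rr zmin; clear - H u1 rr zmin th0 th1 del0 r00.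
pose s : R := Num.min (th / 2) (r / 2).
have s0 : 0 < s by rewrite lt_min; apply/andP; split; lra.
have sr : s <= r / 2 by rewrite ge_min lexx orbT.
have sth : s <= th / 2 by rewrite ge_min lexx.
have zz : `|z - z| < r0 by rewrite subrr normr0.
have := H z s zz; rewrite ltW//= => /(_ (_ : s < r0)) h.
have := zmin (z + s *: u); rewrite addrC addKr normrZ gtr0_norm//.
have : s * `|u| <= s by rewrite ler_piMr// ltW.
have := mulr_gt0 del0 s0; move=> h1 h2 h3.
have h4 : f (z + s *: u) <= f z - del * s by apply: h; lra.
have h5 : f z <= f (z + s *: u) by apply: h3; lra.
lra.
Qed.
End descent.

(** * Subdifferentials on a ball *)

Section convex_analysis.
Context {R : realType}.

Lemma cvg_dotv n (u w : nat -> 'rV[R]_n) (a b : 'rV[R]_n) :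
  u @ \oo --> a -> w @ \oo --> b -> (fun k => dotv (u k) (w k)) @ \oo --> dotv a b.
Proof.
move=> ua wb; rewrite /dotv.
by apply: cvg_bigsum => i _; apply: cvgM; exact: cvg_coord.
Qed.

Lemma seq_cvg_unique (V : normedModType R) (u : nat -> V) (a b : V) :
  u @ \oo --> a -> u @ \oo --> b -> a = b.
Proof. by apply: cvg_unique; exact: norm_hausdorff. Qed.

Lemma eq_seq_cvg (V : topologicalType) (u w : nat -> V) (l : V) :
  (forall k, u k = w k) -> u @ \oo --> l -> w @ \oo --> l.
Proof. by move=> /funext ->. Qed.

Lemma seq_cvg_ge (u : nat -> R) (a l : R) :
  u @ \oo --> l -> (forall k, a <= u k) -> a <= l.
Proof.
move=> ul au; rewrite leNgt; apply/negP => la.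
have al0 : 0 < a - l by rewrite subr_gt0.
have /cvgrPdist_lt/(_ _ al0)[N _ /(_ N (leqnn N))] := ul.
have := ler_norm (u N - l); have := au N; rewrite /= distrC; clear; lra.
Qed.

Lemma seq_cvg_le (u : nat -> R) (a l : R) :
  u @ \oo --> l -> (forall k, u k <= a) -> l <= a.
Proof.
move=> ul ua; rewrite -lerN2; apply: (@seq_cvg_ge (fun k => - u k)).
  exact: cvgN.
by move=> k; rewrite lerN2.
Qed.

Lemma cvg_mulmxl n m (u : nat -> 'rV[R]_n) (a : 'rV[R]_n) (B : 'M[R]_(n, m)) :
  u @ \oo --> a -> (fun k => u k *m B) @ \oo --> a *m B.
Proof.
move=> ua; apply: cvg_rVP => i; rewrite mxE.
under eq_fun do rewrite mxE.
by apply: cvg_bigsum => j _; apply: cvgM; [exact: cvg_coord|exact: cvg_cst].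
Qed.

Lemma finite_pos_lb (Q : finType) (r : Q -> R) : (forall q, 0 < r q) ->
  exists2 m : R, 0 < m & forall q, m <= r q.
Proof.
move=> r0; exists (\big[Num.min/1]_q r q).
  by elim/big_ind: _ => // x y x0 y0; rewrite lt_min x0.
by move=> q; rewrite (bigD1 q)//= ge_min lexx.
Qed.

Lemma dotv_sqrD n (a b : 'rV[R]_n) :
  dotv (a + b) (a + b) = dotv a a + 2 * dotv a b + dotv b b.
Proof. by rewrite dotvDl !dotvDr (dotvC b a); ring. Qed.

(** The Euclidean projection of the origin and its variational inequality. Closedness is sequential
    and convexity is along segments, the forms in which subdifferentials supply them. *)
Lemma min_norm_point n (Z : set 'rV[R]_n) : Z !=set0 ->
  (forall (zs : nat -> 'rV[R]_n) z, (forall k, Z (zs k)) -> zs @ \oo --> z -> Z z) ->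
  (forall v w (t : R), Z v -> Z w -> 0 <= t <= 1 -> Z (v + t *: (w - v))) ->
  exists2 z0, Z z0 & forall z, Z z -> dotv z0 z0 <= dotv z0 z.
Proof.
move=> [z1 Zz1] Zcl Zcv.
pose A z := Z z /\ dotv z z <= dotv z1 z1.
have [||z0 [Zz0 z01] z0min] := @seq_compact_min R _ A (fun z => dotv z z); last first.
- exists z0 => // z Zz; rewrite leNgt; apply/negP => lt0.
  have min0 w : Z w -> dotv z0 z0 <= dotv w w.
    move=> Zw; have [w1|/ltW w1] := leP (dotv w w) (dotv z1 z1).
      by apply: z0min.
    exact: le_trans w1.
  pose a := dotv z0 z0 - dotv z0 z; pose b := dotv (z - z0) (z - z0).
  have a0 : 0 < a by rewrite subr_gt0.
  have b0 : 0 <= b by exact: dotvv_ge0.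
  (* With this [t] one has [t * b < 2 * a], so the quadratic [- 2 * t * a + t * t * b] is
     negative. *)
  pose t := Num.min 1 (a / (b + 1)).
  have ab0 : 0 < a / (b + 1) by rewrite divr_gt0//; lra.
  have t0 : 0 < t by rewrite lt_min ltr01.
  have t1 : t <= 1 by rewrite ge_min lexx.
  have tab : t * (b + 1) <= a.
    by rewrite -ler_pdivlMr; [rewrite ge_min lexx orbT|lra].
  have := min0 (z0 + t *: (z - z0)) (Zcv _ _ _ Zz0 Zz _).
  rewrite (ltW t0) t1 => /(_ isT).
  have -> : dotv (z0 + t *: (z - z0)) (z0 + t *: (z - z0)) =
      dotv z0 z0 - 2 * t * a + t * t * b.
    by rewrite dotv_sqrD !(dotvZl, dotvZr) dotvBr -/b /a; ring.
  move: t0 t1 tab a0 b0; clear; nra.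
- by exists z1.
- move=> u uA.
  have [|s [l [sk ul]]] := @bolzano_weierstrass_rV _ _ u (Num.sqrt (dotv z1 z1)).
    move=> k; have [_ uk] := uA k.
    rewrite -[leLHS]ger0_norm// -sqrtr_sqr ler_sqrt ?dotvv_ge0//.
    exact: le_trans (sqr_norm_dotvv _) uk.
  have ul2 : ((fun z => dotv z z) \o u \o s) @ \oo --> dotv l l by exact: cvg_dotv.
  exists s, l; split=> //; split.
    by apply: Zcl ul => k; have [] := uA (s k).
  rewrite leNgt; apply/negP => lt0.
  have lt0' : 0 < dotv l l - dotv z1 z1 by rewrite subr_gt0.
  have /cvgrPdist_lt/(_ _ lt0')[N _ H] := ul2.
  have := H N (leqnn N) => /= h; have [_ h2] := uA (s N).
  have := ler_norm (dotv l l - dotv (u (s N)) (u (s N))).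
  move: h h2; clear; lra.
Qed.

End convex_analysis.

Section subdiff_on_pairs.
Context {R : realType} {d : nat}.
Local Notation E := 'rV[R]_d.
Implicit Types (phi psi : E -> R) (D : E -> set E) (x y z u v w c : E)
  (s t r e L rho kap del : R).

(* What the argument uses of the pair (function, subdifferential); stable
   under finite maxima and addition of smooth functions. *)
Record subdiff_on c rho phi D : Prop := SubdiffOn {
  subdiff_on_cont : forall x, `|x - c| < rho -> {for x, continuous phi};
  subdiff_on_ne : forall x, `|x - c| < rho -> D x !=set0;
  subdiff_on_bnd : exists M : R, forall x v, `|x - c| < rho -> D x v -> `|v| <= M;
  subdiff_on_closed : forall (xs vs : nat -> E) x v, (forall k, `|xs k - c| < rho) ->
    `|x - c| < rho -> xs @ \oo --> x -> vs @ \oo --> v ->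
    (forall k, D (xs k) (vs k)) -> D x v;
  subdiff_on_cvx : forall x v w t, `|x - c| < rho -> D x v -> D x w -> 0 <= t <= 1 ->
    D x (v + t *: (w - v));
  subdiff_on_lower : forall x v, `|x - c| < rho -> D x v -> regular_subdiff phi x v;
  subdiff_on_upper : forall x w kap, `|x - c| < rho ->
    (forall v, D x v -> dotv v w <= kap) -> forall e, 0 < e ->
    exists2 r, 0 < r & forall t, 0 < t < r ->
      phi (x + t *: w) <= phi x + t * (kap + e) }.

Lemma regular_subdiffP phi x v : regular_subdiff phi x v <->
  forall e, 0 < e -> exists2 r, 0 < r & forall y, `|y - x| < r ->
    phi x + dotv v (y - x) - e * `|y - x| <= phi y.
Proof.
split=> H e e0.
  exact: (iffLR (near_distP x (fun y => phi x + dotv v (y - x) - e * `|y - x| <= phi y))) (H e e0).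
exact: (iffRL (near_distP x (fun y => phi x + dotv v (y - x) - e * `|y - x| <= phi y))) (H e e0).
Qed.

Lemma segment_continuous phi a b (t : R) :
  {for a + t *: (b - a), continuous phi} ->
  {for t, continuous (fun t : R => phi (a + t *: (b - a)))}.
Proof.
move=> cphi; apply: (@continuous_comp _ _ _ (fun t : R => a + t *: (b - a)) phi) => //.
by apply: cvgD; [exact: cvg_cst|apply: cvgZr_tmp; exact: cvg_id].
Qed.

(* The maximum over [0, 1] of t |-> phi(a + t(b - a)) - (kap + e)t is at 0. *)
Lemma subdiff_on_mean_value c rho phi D a b kap : subdiff_on c rho phi D ->
  `|a - c| < rho -> `|b - c| < rho ->
  (forall t, 0 <= t <= 1 -> exists2 v, D (a + t *: (b - a)) v & dotv v (b - a) <= kap) ->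
  phi b <= phi a + kap.
Proof.
move=> gd ac bc Dk.
have tin t : 0 <= t <= 1 -> `|a + t *: (b - a) - c| < rho.
  move=> t01; apply: le_lt_trans (_ : Num.max `|a - c| `|b - c| < rho); last by rewrite gt_max ac.
  by apply: norm_segment_le => //; rewrite le_max lexx ?orbT.
suff K e : 0 < e -> phi b <= phi a + kap + e.
  have : forall e : R, 0 < e -> phi b <= phi a + kap + e by exact: K.
  by move=> H; apply/ler_addgt0Pr.
move=> e0.
pose q t := phi (a + t *: (b - a)) - (kap + e) * t.
have [|/= t] := @EVT_max R q 0 1 ler01.
  apply: continuous_in_subspaceT => t; rewrite inE /= in_itv /= => t01.
  apply: (@cvgB _ _ _ _ _ (fun t => phi (a + t *: (b - a))) (fun t => (kap + e) * t)).
    by apply: segment_continuous; exact: subdiff_on_cont gd _ (tin _ t01).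
  by apply: cvgM; [exact: cvg_cst|exact: cvg_id].
rewrite in_itv /= => t01 qmax; have /andP[t0 t1] := t01.
have [t00|tn0] := eqVneq t 0.
  have := qmax 1; rewrite in_itv /= ler01 lexx => /(_ isT).
  rewrite t00 /q scale0r addr0 mulr0 scale1r [a + _]addrC subrK.
  by move: e0; clear; lra.
have {tn0 t0} t0 : 0 < t by rewrite lt_def tn0.
have [v Dv vk] := Dk _ t01.
have /regular_subdiffP := subdiff_on_lower gd (tin _ t01) Dv.
pose n1 : R := 1 + `|b - a|.
have n10 : 0 < n1 by rewrite /n1; have := normr_ge0 (b - a); lra.
have e2 : 0 < e / (2 * n1) by rewrite divr_gt0// mulr_gt0.
move=> /(_ _ e2)[r r0 H].
(* Moving back by [s] from a maximiser [t > 0], [phi] falls by at most [s * kap + e * s / 2] because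
   [v] supports it from below, while the linear term gives back [(kap + e) * s]. *)
pose s := Num.min t (r / (2 * n1)).
have s0 : 0 < s by rewrite lt_min t0 divr_gt0// mulr_gt0.
have st : s <= t by rewrite ge_min lexx.
have sr : s * (2 * n1) <= r by rewrite -ler_pdivlMr ?mulr_gt0// ge_min lexx orbT.
have := H (a + (t - s) *: (b - a)).
have -> : a + (t - s) *: (b - a) - (a + t *: (b - a)) = - s *: (b - a).
  by rewrite opprD addrACA subrr add0r -scalerBl; congr (_ *: _); ring.
rewrite normrZ normrN gtr0_norm// dotvZr.
have h1 : s * `|b - a| < r.
  by move: s0 sr (normr_ge0 (b - a)); rewrite /n1; clear; nra.
move=> /(_ h1) h2.
have := qmax (t - s); rewrite in_itv /=.
have -> : (0 <= t - s <= 1) = true.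
  by apply/andP; move: st s0 t1; clear; split; lra.
move=> /(_ isT); rewrite /q => h3.
have h4 : e / (2 * n1) * (s * `|b - a|) <= e * s / 2.
  have -> : e / (2 * n1) * (s * `|b - a|) = e * s / 2 * (`|b - a| / n1).
    by field; rewrite gt_eqF.
  apply: ler_piMr; first by rewrite divr_ge0// mulr_ge0// ltW.
  by rewrite ler_pdivrMr// mul1r /n1; lra.
have h5 : s * dotv v (b - a) <= s * kap by rewrite ler_pM2l.
have h6 : 0 < e * s by exact: mulr_gt0.
by move: h2 h3 h4 h5 h6; clear; nra.
Qed.

Lemma subdiff_on_lipschitz c rho phi D : subdiff_on c rho phi D ->
  exists2 L, 0 < L & lipschitz_ball phi c rho L.
Proof.
move=> gd; have [M MP] := subdiff_on_bnd gd.
exists (d%:R * `|M| + 1); first by rewrite ltr_wpDl// mulr_ge0.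
have half x y : `|x - c| < rho -> `|y - c| < rho ->
    phi x <= phi y + (d%:R * `|M| + 1) * `|x - y|.
  move=> xr yr; apply: (subdiff_on_mean_value gd) => // t t01.
  have tr : `|y + t *: (x - y) - c| < rho.
    apply: le_lt_trans (_ : Num.max `|y - c| `|x - c| < rho); last by rewrite gt_max yr.
    by apply: norm_segment_le => //; rewrite le_max lexx ?orbT.
  have [v Dv] := subdiff_on_ne gd tr; exists v => //.
  apply: le_trans (ler_norm _) _; apply: le_trans (dotv_le _ _) _.
  rewrite mulrDl mul1r mulrA; apply: ler_wpDr => //.
  apply: ler_wpM2r => //; apply: ler_wpM2l => //.
  exact: le_trans (MP _ _ tr Dv) (ler_norm _).
move=> x y xr yr; rewrite ler_norml; have h1 := half _ _ xr yr.
have := half _ _ yr xr; rewrite (distrC y x) => h2.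
by apply/andP; move: h1 h2; clear; split; lra.
Qed.

(** The direction is opposite to the Euclidean min-norm subgradient at [x]. Closedness and
    boundedness of [D] carry its negative slope to neighbouring points, at the price of half of
    [del], and the mean value inequality integrates it along segments. *)
Lemma subdiff_on_descent c rho phi D x del : subdiff_on c rho phi D -> `|x - c| < rho ->
  0 < del -> (forall w, D x w -> del <= `|w|) -> descent_point phi (del / 2) x.
Proof.
move=> gd xr del0 Ddel.
have [|||v0 Dv0 v0min] := @min_norm_point R d (D x).
- exact: subdiff_on_ne gd _ xr.
- move=> zs z Dz zz; apply: (subdiff_on_closed gd (xs := fun=> x) (vs := zs)) => //.
  exact: cvg_cst.
- by move=> v w t Dv Dw t01; exact: subdiff_on_cvx gd _ _ _ _ xr Dv Dw t01.
pose n0 : R := Num.sqrt (dotv v0 v0).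
have n0v : `|v0| <= n0.
  by rewrite -[leLHS]ger0_norm// -sqrtr_sqr ler_sqrt ?dotvv_ge0// sqr_norm_dotvv.
have n0del : del <= n0 by apply: le_trans n0v; exact: Ddel.
have n00 : 0 < n0 by exact: lt_le_trans n0del.
have n02 : n0 * n0 = dotv v0 v0 by rewrite -expr2 sqr_sqrtr// dotvv_ge0.
pose u := - (n0^-1 *: v0).
have u1 : `|u| <= 1.
  by rewrite normrN normrZ gtr0_norm ?invr_gt0// mulrC ler_pdivrMr// mul1r.
have Du v : D x v -> dotv v u <= - del.
  move=> Dv; rewrite dotvNr dotvZr lerN2; apply: le_trans n0del _.
  by rewrite mulrC ler_pdivlMr// n02 dotvC v0min.
have [r r0 Dr] : exists2 r : R, 0 < r & forall y v, `|y - x| < r -> `|y - c| < rho ->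
    D y v -> dotv v u <= - (del / 2).
  apply: contrapT => nH.
  have /choice[p pP] : forall k : nat, exists p : E * E,
      [/\ `|p.1 - x| < k.+1%:R^-1, `|p.1 - c| < rho, D p.1 p.2 & - (del / 2) < dotv p.2 u].
    move=> k; apply: contrapT => nk; apply: nH; exists k.+1%:R^-1.
      by rewrite invr_gt0.
    move=> y v yx yc Dv; rewrite leNgt; apply/negP => lt0; apply: nk.
    by exists (y, v).
  have [M MP] := subdiff_on_bnd gd.
  have [|s [v [sk vv]]] := @bolzano_weierstrass_rV _ _ (fun k => (p k).2) M.
    by move=> k; have [_ h1 h2 _] := pP k; exact: MP h1 h2.
  have xx : (fun k => (p (s k)).1) @ \oo --> x.
    apply/cvgrPdist_lt => e e0; have [N NP] := invSn_lt e0.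
    exists N => // k /= Nk; have [h _ _ _] := pP (s k); rewrite distrC.
    by apply: lt_trans h (NP _ _); exact: leq_trans (sk k).
  have Dv : D x v.
    apply: (subdiff_on_closed gd _ xr xx vv) => k.
      by have [] := pP (s k).
    by have [] := pP (s k).
  have vu : (fun k => dotv (p (s k)).2 u) @ \oo --> dotv v u.
    by apply: cvg_dotv; [exact: vv|exact: cvg_cst].
  have d4 : 0 < del / 4 by lra.
  have /cvgrPdist_lt/(_ _ d4)[N _ HN] := vu.
  have := HN N (leqnn N) => /= h1; have [_ _ _ h2] := pP (s N).
  have := Du _ Dv; have := ler_norm (dotv v u - dotv (p (s N)).2 u).
  rewrite distrC in h1; have := ler_norm (dotv (p (s N)).2 u - dotv v u).
  by move: h1 h2 del0; clear; lra.
exists u; pose r1 := Num.min r (rho - `|x - c|).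
have r10 : 0 < r1 by rewrite lt_min r0 subr_gt0.
have r1r : r1 <= r by rewrite ge_min lexx.
have r1rho : r1 <= rho - `|x - c| by rewrite ge_min lexx orbT.
exists (r1 / 2); first by lra.
split=> // y s yx /andP[s0 sr].
have near_x z : `|z - x| < r1 -> `|z - c| < rho.
  move=> zx; have := ler_distD x z c; move: zx r1rho; clear; lra.
have tx t : 0 <= t <= 1 -> `|y + t *: (y + s *: u - y) - x| < r1.
  move=> /andP[t0 t1]; rewrite [y + _ - y]addrC addKr scalerA addrAC.
  apply: le_lt_trans (ler_normD _ _) _; rewrite normrZ ger0_norm ?mulr_ge0//.
  have : t * s * `|u| <= s.
    apply: le_trans (_ : _ <= t * s * 1) _.
      by apply: ler_wpM2l => //; exact: mulr_ge0.
    by rewrite mulr1 ler_piMl.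
  by move: yx sr; clear; lra.
apply: (subdiff_on_mean_value gd).
- by apply: near_x; move: yx r10; clear; lra.
- have := tx 1; rewrite ler01 lexx scale1r [y + (_ - _)]addrC subrK => /(_ isT).
  exact: near_x.
- move=> t t01; have h := tx t t01; have h2 := near_x _ h.
  have [v Dv] := subdiff_on_ne gd h2; exists v => //.
  have h3 := Dr _ _ (lt_le_trans h r1r) h2 Dv.
  rewrite [y + _ - y]addrC addKr dotvZr -mulNr mulrC; exact: ler_wpM2r.
Qed.

End subdiff_on_pairs.

(** * Subdifferentials of regular Lipschitz functions *)

Section regular_lipschitz.
Context {R : realType} {d : nat}.
Local Notation E := 'rV[R]_d.
Implicit Types (phi psi : E -> R) (D : E -> set E) (x y z u v w c : E)
  (s t r e L rho kap del eta : R).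

(** Moving along a signed coordinate vector bounds one coordinate of [v], which is all the max norm
    asks; the extra 1 is the tolerance in the subgradient inequality. *)
Lemma regular_subdiff_bounded phi c rho L x v : 0 <= L -> lipschitz_ball phi c rho L ->
  `|x - c| < rho -> regular_subdiff phi x v -> `|v| <= L + 1.
Proof.
move=> L0 Lphi xr /regular_subdiffP/(_ 1 ltr01)[r r0 H].
apply: normrV_le => [|i]; first by lra.
pose sg : R := if 0 <= v 0 i then 1 else -1.
have sg1 : `|sg| = 1 by rewrite /sg; case: ifP; rewrite ?normrN normr1.
have sgv : sg * v 0 i = `|v 0 i|.
  rewrite /sg; case: (lerP 0 (v 0 i)) => h; first by rewrite mul1r ger0_norm.
  by rewrite mulN1r ltr0_norm.
pose s := Num.min (r / 2) ((rho - `|x - c|) / 2).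
have s0 : 0 < s by rewrite lt_min; apply/andP; split; lra.
have sr : s < r by apply: le_lt_trans (_ : r / 2 < r); [rewrite ge_min lexx|lra].
have srho : s < rho - `|x - c|.
  apply: le_lt_trans (_ : (rho - `|x - c|) / 2 < _); first by rewrite ge_min lexx orbT.
  by lra.
pose y := x + (s * sg) *: delta_mx 0 i.
have yx : `|y - x| <= s.
  rewrite /y addrC addKr normrZ normrM sg1 mulr1 gtr0_norm//.
  apply: ler_piMr; first exact: ltW.
  apply: normrV_le => // j; rewrite mxE eqxx /=.
  by case: eqP; rewrite ?normr1 ?normr0.
have dy : dotv v (y - x) = s * `|v 0 i|.
  rewrite /y addrC addKr dotvZr -mulrA; congr (_ * _); rewrite -sgv; congr (_ * _).
  rewrite /dotv (bigD1 i)//= mxE !eqxx mulr1 big1 ?addr0// => j ji.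
  by rewrite mxE (negbTE ji) andbF mulr0.
have h1 := H y (le_lt_trans yx sr); rewrite dy mul1r in h1.
have yc : `|y - c| < rho.
  have := ler_distD x y c; move: yx srho; clear; lra.
have h2 := le_trans (ler_norm _) (Lphi y x yc xr).
have h3 : L * `|y - x| <= L * s by apply: ler_wpM2l.
rewrite -(ler_pM2l s0); move: h1 h2 h3 yx; clear; nra.
Qed.

Lemma regular_subdiff_cvx phi x v w t : regular_subdiff phi x v ->
  regular_subdiff phi x w -> 0 <= t <= 1 -> regular_subdiff phi x (v + t *: (w - v)).
Proof.
move=> /regular_subdiffP Hv /regular_subdiffP Hw /andP[t0 t1].
apply/regular_subdiffP => e e0.
have [r1 r10 H1] := Hv _ e0; have [r2 r20 H2] := Hw _ e0.
exists (Num.min r1 r2); first by rewrite lt_min r10.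
move=> y; rewrite lt_min => /andP[/H1 h1 /H2 h2].
rewrite dotvDl dotvZl dotvBl.
have h3 : t * (phi x + dotv w (y - x) - e * `|y - x|) <= t * phi y by apply: ler_wpM2l.
have h4 : (1 - t) * (phi x + dotv v (y - x) - e * `|y - x|) <= (1 - t) * phi y.
  by apply: ler_wpM2l => //; lra.
move: h3 h4; clear; nra.
Qed.

(* Minimise phi(x) - tau r + M |x - (a + tau (b - a))|^2 over x near a and
   tau in [0, 1]; for M large the minimiser has tau < 1. *)
Lemma fuzzy_mean_value phi c rho L a b r0 r eta : 0 < L -> lipschitz_ball phi c rho L ->
  0 < r0 -> `|a - c| + r0 < rho -> `|b - a| <= r0 / 2 -> r < phi b - phi a ->
  0 < eta -> exists y v, [/\ regular_subdiff phi y v, `|y - a| <= `|b - a| + eta,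
    `|y - c| < rho & r <= dotv v (b - a)].
Proof.
move=> L0 Lphi r00 acr ba rphi eta0.
pose gap := phi b - phi a - r.
have gap0 : 0 < gap by rewrite /gap; lra.
(* The residual [z] will satisfy [|z| <= L / M]. The three summands make this at most [eta], at most
   [r0 / 4], and, after multiplication by [L], at most half the gap. *)
pose M : R := L / eta + 4 * L / r0 + 2 * L * L / gap.
have M1 : 0 < L / eta by rewrite divr_gt0.
have M2 : 0 < 4 * L / r0 by rewrite divr_gt0// mulr_gt0.
have M3 : 0 < 2 * L * L / gap by rewrite divr_gt0// !mulr_gt0.
have M0 : 0 < M by rewrite /M; lra.
have LM1 : L / M <= eta.
  rewrite ler_pdivrMr// mulrC -ler_pdivrMr//; rewrite /M; move: M2 M3; clear; lra.
have LM2 : L / M <= r0 / 4.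
  rewrite ler_pdivrMr// mulrC -ler_pdivrMr ?divr_gt0//.
  have -> : L / (r0 / 4) = 4 * L / r0 by field; rewrite gt_eqF.
  by rewrite /M; move: M1 M3; clear; lra.
have LM3 : L * (L / M) <= gap / 2.
  rewrite mulrA ler_pdivrMr// [_ * M]mulrC -ler_pdivrMr ?divr_gt0//.
  have -> : L * L / (gap / 2) = 2 * L * L / gap by field; rewrite gt_eqF.
  by rewrite /M; move: M1 M2; clear; lra.
pose p t := a + t *: (b - a).
pose th (X : E * R) := phi X.1 - X.2 * r + M * dotv (X.1 - p X.2) (X.1 - p X.2).
pose A (X : E * R) := `|X.1 - a| <= r0 /\ 0 <= X.2 <= 1.
have ballc x : `|x - a| <= r0 -> `|x - c| < rho.
  move=> xa; have := ler_distD a x c; move: xa acr; clear; lra.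
have [||[x t] [/= xa t01] thmin] := @seq_compact_min R _ A th.
- move=> u uA.
  have [|s1 [x [sk1 ux]]] := @bolzano_weierstrass_rV _ _ (fun k => (u k).1) (r0 + `|a|).
    move=> k; have [h _] := uA k; have := ler_normD ((u k).1 - a) a.
    rewrite subrK; move: h; clear; lra.
  have [|s2 [t [sk2 ut]]] := @bolzano_weierstrass_rV _ 1 (fun k => const_mx (u (s1 k)).2) 1.
    move=> k; apply: normrV_le => // i; rewrite mxE.
    by have [_ /andP[h1 h2]] := uA (s1 k); rewrite ger0_norm.
  have {}ut : (fun k => (u (s1 (s2 k))).2) @ \oo --> t 0 0.
    have := cvg_coord (i := 0) ut; under eq_fun do rewrite /= mxE; exact.
  have {}ux : (fun k => (u (s1 (s2 k))).1) @ \oo --> x.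
    exact: (cvg_subseq sk2 ux).
  have xa : `|x - a| <= r0.
    by apply: cvg_norm_le ux _ => k; have [] := uA (s1 (s2 k)).
  exists (s1 \o s2), (x, t 0 0); split.
  + by move=> k; apply: leq_trans (sk2 k) (sk1 _).
  + split=> //=; apply/andP; split.
      apply: (seq_cvg_ge ut) => k.
      by have [_ /andP[]] := uA (s1 (s2 k)).
    apply: (seq_cvg_le ut) => k.
    by have [_ /andP[]] := uA (s1 (s2 k)).
  + have cphi := lipschitz_ball_continuous L0 Lphi (ballc _ xa).
    rewrite /th; apply: cvgD.
      apply: cvgB; first exact: (cvg_comp _ phi ux cphi).
      by apply: cvgM; [exact: ut|exact: cvg_cst].
    apply: cvgM; first exact: cvg_cst.
    have up : (fun k => (u (s1 (s2 k))).1 - p (u (s1 (s2 k))).2) @ \oo --> x - p (t 0 0).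
      apply: cvgB => //; apply: cvgD; first exact: cvg_cst.
      by apply: cvgZr_tmp.
    exact: cvg_dotv.
- by exists (a, 0); split; rewrite /= ?subrr ?normr0 ?lexx ?ler01// ltW.
have /andP[t0 t1] := t01.
pose z := x - p t.
have pa : `|p t - a| <= `|b - a|.
  by rewrite /p addrC addKr normrZ ger0_norm// ler_piMl.
have pA : A (p t, t) by split => //=; move: pa ba r00; clear; lra.
have nz : `|z| <= L / M.
  have := thmin _ pA; rewrite /th /= subrr dotv0l mulr0 addr0 -/z => h1.
  have [pA1 _] := pA.
  have := le_trans (ler_norm _) (Lphi _ _ (ballc _ pA1) (ballc _ xa)).
  rewrite distrC -/z => h2.
  have h3 : M * `|z| ^+ 2 <= L * `|z|.
    have : M * `|z| ^+ 2 <= M * dotv z z.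
      by apply: ler_wpM2l (sqr_norm_dotvv _); exact: ltW.
    by move: h1 h2; clear; lra.
  have [->|zn0] := eqVneq `|z| 0; first by rewrite divr_ge0 ?ltW.
  have zp : 0 < `|z| by rewrite lt_def zn0 /=.
  rewrite ler_pdivlMr//; rewrite expr2 in h3; move: h3 zp; clear; nra.
have xa2 : `|x - a| < r0.
  have := ler_distD (p t) x a; rewrite -/z; move: pa ba nz LM2 r00; clear; lra.
have xc : `|x - c| < rho by apply: ballc; exact: ltW.
exists x, (- (2 * M) *: z); split => //.
- apply/regular_subdiffP => e e0.
  pose q : R := Num.min (r0 - `|x - a|) (e / (M * d%:R + 1)).
  have Md : 0 < M * d%:R + 1 by rewrite ltr_wpDl// mulr_ge0// ltW.
  exists q; first by rewrite lt_min subr_gt0 xa2 divr_gt0.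
  move=> y; rewrite lt_min => /andP[y1 y2].
  have yA : A (y, t).
    split => //=; have := ler_distD x y a; move: y1; clear; lra.
  have := thmin _ yA; rewrite /th /= -/z.
  have -> : y - p t = z + (y - x) by apply/rowP => i; rewrite !mxE; ring.
  set h := y - x.
  rewrite (dotv_sqrD z) dotvZl => h1.
  have h2 : dotv h h <= d%:R * `|h| * `|h|.
    by apply: le_trans (ler_norm _) _; rewrite -mulrA; exact: dotv_le.
  have h3 : (M * d%:R + 1) * `|h| <= e by rewrite mulrC -ler_pdivlMr// ltW.
  have h4 : M * dotv h h <= M * (d%:R * `|h| * `|h|) by rewrite ler_pM2l.
  have h5 : (M * d%:R + 1) * `|h| * `|h| <= e * `|h| by apply: ler_wpM2r.
  have h6 := mulr_ge0 (normr_ge0 h) (normr_ge0 h).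
  move: h1 h4 h5 h6; clear; nra.
- have := ler_distD (p t) x a; rewrite -/z; move: pa nz LM1; clear; lra.
(* With parameter 1 the value would be at least [phi b - r - gap / 2], which exceeds the value
   [phi a] taken at [(a, 0)]. *)
have tn1 : t != 1.
  apply/eqP => t1E; have aA : A (a, 0).
    by split; rewrite /= ?subrr ?normr0 ?lexx ?ler01// ltW.
  have := thmin _ aA.
  have pb : p t = b by rewrite /p t1E scale1r addrC subrK.
  have p0 : p 0 = a by rewrite /p scale0r addr0.
  rewrite /th /= p0 subrr dotv0l mulr0 addr0 mul0r subr0 t1E mul1r -t1E -/z => h1.
  have bc : `|b - c| < rho by apply: ballc; move: ba r00; clear; lra.
  have := le_trans (ler_norm _) (Lphi _ _ bc xc); rewrite distrC -pb -/z pb => h2.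
  have h3 : L * `|z| <= L * (L / M) by rewrite ler_pM2l.
  have h4 : 0 <= M * dotv z z by rewrite mulr_ge0 ?dotvv_ge0// ltW.
  by move: h1 h2 h3 h4 LM3 gap0; rewrite /gap; clear; lra.
have {tn1} t1' : t < 1 by rewrite lt_def eq_sym tn1.
(* As [t < 1], the parameter may be increased; if the claimed slope failed, this would lower [th] to
   first order. *)
rewrite dotvZl leNgt; apply/negP => lt0.
pose B := M * dotv (b - a) (b - a).
have B0 : 0 <= B by rewrite mulr_ge0 ?dotvv_ge0// ltW.
pose g := r - - (2 * M) * dotv z (b - a).
have g0 : 0 < g by rewrite /g; lra.
pose s : R := Num.min (1 - t) (g / (2 * (B + 1))).
have s0 : 0 < s by rewrite lt_min subr_gt0 t1' divr_gt0// mulr_gt0//; lra.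
have s1 : s <= 1 - t by rewrite ge_min lexx.
have s2 : s * (2 * (B + 1)) <= g.
  by rewrite -ler_pdivlMr ?ge_min ?lexx ?orbT// mulr_gt0//; lra.
have sA : A (x, t + s).
  by split => //=; apply/andP; move: s0 s1 t0; clear; split; lra.
have := thmin _ sA; rewrite /th /= -/z.
have -> : x - p (t + s) = z - s *: (b - a).
  by apply/rowP => i; rewrite /z /p !mxE; ring.
rewrite (dotv_sqrD z) !(dotvNl, dotvNr, dotvZl, dotvZr) => h1.
have h2 : 0 <= s * (g - s * B - s * B - s - s).
  by apply: mulr_ge0; [exact: ltW|move: s2; clear; lra].
have h3 : 0 < s * g by exact: mulr_gt0.
move: h1 h2 h3 s0 B0; rewrite /B /g; clear; nra.
Qed.

(** Regularity merges the virtues of two subdifferentials: closedness from the limiting one,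
    convexity and lower support from the Fréchet one. Nonemptiness and the upper estimate come from
    the fuzzy mean value inequality, whose subgradients at nearby points accumulate at [x]. *)
Lemma subdiff_on_regular phi c rho L : 0 < L -> lipschitz_ball phi c rho L ->
  (forall x, limiting_subdiff phi x = regular_subdiff phi x) ->
  subdiff_on c rho phi (regular_subdiff phi).
Proof.
move=> L0 Lphi reg.
have cphi x : `|x - c| < rho -> {for x, continuous phi}.
  by move=> xr; exact: lipschitz_ball_continuous L0 Lphi xr.
have bnd x v : `|x - c| < rho -> regular_subdiff phi x v -> `|v| <= L + 1.
  by move=> xr; exact: regular_subdiff_bounded (ltW L0) Lphi xr.
have clo (xs vs : nat -> E) x v : `|x - c| < rho -> xs @ \oo --> x ->
    vs @ \oo --> v -> (forall k, regular_subdiff phi (xs k) (vs k)) -> regular_subdiff phi x v.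
  move=> xr xsx vsv Dk; rewrite -reg; exists xs, vs; split => //.
  exact: (cvg_comp xs phi xsx (cphi x xr)).
have clo2 x w kap : `|x - c| < rho -> (forall eta : R, 0 < eta -> exists y v,
    [/\ regular_subdiff phi y v, `|y - x| <= eta, `|y - c| < rho & kap <= dotv v w]) ->
    exists2 v, regular_subdiff phi x v & kap <= dotv v w.
  move=> xr H.
  have /choice[p pP] : forall k : nat, exists p : E * E, [/\ regular_subdiff phi p.1 p.2,
      `|p.1 - x| <= k.+1%:R^-1, `|p.1 - c| < rho & kap <= dotv p.2 w].
    move=> k; have [|y [v Hyv]] := H k.+1%:R^-1; first by rewrite invr_gt0.
    by exists (y, v).
  have [|s [v [sk vv]]] := @bolzano_weierstrass_rV _ _ (fun k => (p k).2) (L + 1).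
    by move=> k; have [h1 _ h2 _] := pP k; exact: bnd h2 h1.
  have xx : (fun k => (p (s k)).1) @ \oo --> x.
    apply/cvgrPdist_lt => e e0; have [N NP] := invSn_lt e0.
    exists N => // k /= Nk; have [_ h _ _] := pP (s k); rewrite distrC.
    by apply: le_lt_trans h (NP _ _); exact: leq_trans (sk k).
  exists v; first by apply: clo xr xx vv _ => k; have [] := pP (s k).
  have vw : (fun k => dotv (p (s k)).2 w) @ \oo --> dotv v w.
    by apply: cvg_dotv; [exact: vv|exact: cvg_cst].
  apply: (seq_cvg_ge vw) => k.
  by have [] := pP (s k).
have room x : `|x - c| < rho -> exists2 r0 : R, 0 < r0 & `|x - c| + r0 < rho.
  by move=> xr; exists ((rho - `|x - c|) / 2); lra.
split => //.
- move=> x xr; have [r0 r00 xr0] := room x xr.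
  (* The zero direction with slope -1 demands nothing but the existence of a subgradient. *)
  have [|v Dv _] := clo2 x 0 (-1) xr; last by exists v.
  move=> eta eta0.
  have [|||y [v [h1 h2 h3 h4]]] := @fuzzy_mean_value phi c rho L x x r0 (-1) eta L0 Lphi r00 xr0.
  + by rewrite subrr normr0; lra.
  + by rewrite subrr; lra.
  + by exact: eta0.
  by exists y, v; split => //; [rewrite subrr normr0 add0r in h2|rewrite subrr in h4].
- by exists (L + 1).
- by move=> xs vs x v _; exact: clo.
- by move=> x v w t _; exact: regular_subdiff_cvx.
- move=> x w kap xr Dk e e0; apply: contrapT => nH.
  have [r0 r00 xr0] := room x xr.
  have [|v Dv] := clo2 x w (kap + e) xr; last first.
    by have := Dk _ Dv; lra.
  move=> eta eta0.
  pose w1 : R := `|w| + 1.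
  have w10 : 0 < w1 by rewrite ltr_wpDl.
  pose r : R := Num.min (eta / 2 / w1) (r0 / 2 / w1).
  have r_gt0 : 0 < r by rewrite lt_min !divr_gt0.
  have [t [/andP[t0 tr] tphi]] : exists t, 0 < t < r /\
      phi x + t * (kap + e) < phi (x + t *: w).
    apply: contrapT => nt; apply: nH; exists r => // t tr.
    by rewrite leNgt; apply/negP => lt0; apply: nt; exists t.
  have nb (q : R) : 0 < q -> r <= q / 2 / w1 -> `|x + t *: w - x| <= q / 2.
    move=> q0 rq; rewrite addrC addKr normrZ gtr0_norm//.
    have : t * w1 <= q / 2 by rewrite -ler_pdivlMr//; exact: le_trans (ltW tr) rq.
    by rewrite /w1; move: t0; clear; nra.
  have eta20 : 0 < eta / 2 by lra.
  have [|||y [v [h1 h2 h3 h4]]] :=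
      @fuzzy_mean_value phi c rho L x (x + t *: w) r0 (t * (kap + e)) (eta / 2) L0 Lphi r00 xr0.
  + by apply: nb => //; rewrite ge_min lexx orbT.
  + by lra.
  + by [].
  exists y, v; split => //.
    apply: le_trans h2 _; have := nb eta eta0; rewrite ge_min lexx => /(_ isT); lra.
  by rewrite [x + _ - x]addrC addKr dotvZr ler_pM2l in h4.
Qed.

End regular_lipschitz.

(** * Stationarity, sum rule and maximum rule *)

Section subdiff_on_operations.
Context {R : realType} {d : nat}.
Local Notation E := 'rV[R]_d.
Implicit Types (phi psi : E -> R) (D : E -> set E) (G : E -> E)
  (x y z u v w c : E) (s t r e L rho kap del : R).

Lemma dotv_row_mx m n (a b : 'rV[R]_m) (a' b' : 'rV[R]_n) :
  dotv (row_mx a a') (row_mx b b') = dotv a b + dotv a' b'.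
Proof. by rewrite !dotvE tr_row_mx mul_row_col mxE. Qed.

(** A multiplier rule: [x] is stationary for free moves in the row space of [B] and one-sided moves
    against [e]. The pairs of [v *m B^T] and [dotv v e + kap + s] with slack [s >= 0] form a closed
    convex set; if it missed the origin, the negative of its min-norm point would give a direction
    in which [phi] falls too fast. *)
Lemma subdiff_on_stationary c rho phi D x k (B : 'M[R]_(k, d)) (e : E) kap :
  subdiff_on c rho phi D -> `|x - c| < rho ->
  (forall (a : 'rV[R]_k) s, 0 <= s -> exists2 r, 0 < r & forall t, 0 < t < r ->
    phi x + t * (kap * s) <= phi (x + t *: (a *m B - s *: e))) ->
  exists v, [/\ D x v, v *m B^T = 0 & dotv v e <= - kap].
Proof.
move=> gd xr stat.
pose Z : set 'rV[R]_(k + 1) := [set z | exists v s, [/\ D x v, 0 <= s &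
  z = row_mx (v *m B^T) ((dotv v e + kap + s)%:M)]].
have dot1 (a b : R) : dotv (a%:M : 'rV[R]_1) b%:M = a * b.
  by rewrite /dotv big_ord1 !mxE eqxx !mulr1n.
have [|||z0 [v0 [s0 [Dv0 s0_ge0 z0E]]] z0min] := @min_norm_point R _ Z.
- have [v Dv] := subdiff_on_ne gd xr.
  by exists (row_mx (v *m B^T) ((dotv v e + kap + 0)%:M)), v, 0.
- move=> zs z Zk zz.
  have /choice[p pP] : forall k, exists p : E * R, [/\ D x p.1, 0 <= p.2 &
      zs k = row_mx (p.1 *m B^T) ((dotv p.1 e + kap + p.2)%:M)].
    by move=> j; have [v [s H]] := Zk j; exists (v, s).
  have [M MP] := subdiff_on_bnd gd.
  have [|s [v [sk vv]]] := @bolzano_weierstrass_rV _ _ (fun k => (p k).1) M.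
    by move=> j; have [h1 _ _] := pP j; exact: MP h1.
  have Dv : D x v.
    apply: (subdiff_on_closed gd (xs := fun=> x)) vv _ => //; first exact: cvg_cst.
    by move=> j; have [] := pP (s j).
  have zs' := cvg_subseq sk zz.
  have zl : lsubmx z = v *m B^T.
    apply: (@seq_cvg_unique _ _ (fun j => (p (s j)).1 *m B^T)).
    - apply: cvg_rVP => i; rewrite mxE.
      apply: eq_seq_cvg (cvg_coord (i := lshift 1 i) zs') => j /=.
      by have [_ _ ->] := pP (s j); rewrite row_mxEl.
    - exact: cvg_mulmxl.
  pose zr := z 0 (rshift k 0).
  have sl : (fun j => (p (s j)).2) @ \oo --> zr - (dotv v e + kap).
    have h1 := cvg_coord (i := rshift k 0) zs'.
    have h2 : (fun j => dotv (p (s j)).1 e + kap) @ \oo --> dotv v e + kap.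
      by apply: cvgD; [apply: cvg_dotv => //; exact: cvg_cst|exact: cvg_cst].
    have -> : (fun j => (p (s j)).2) =
        (fun j => zs (s j) 0 (rshift k 0) - (dotv (p (s j)).1 e + kap)).
      apply/funext => j; have [_ _ ->] := pP (s j).
      by rewrite row_mxEr !mxE eqxx mulr1n addrAC subrr add0r.
    exact: cvgB.
  exists v, (zr - (dotv v e + kap)); split => //.
    by apply: (seq_cvg_ge sl) => j; have [] := pP (s j).
  rewrite -[LHS]hsubmxK zl; congr (row_mx _ _); apply/rowP => i.
  by rewrite ord1 !mxE eqxx mulr1n [RHS]addrC subrK.
- move=> _ _ t [v [s [Dv s_ge0 ->]]] [w [s' [Dw s'_ge0 ->]]] t01.
  have /andP[t0 t1] := t01.
  exists (v + t *: (w - v)), (s + t * (s' - s)); split.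
  + exact: subdiff_on_cvx gd _ _ _ _ xr Dv Dw t01.
  + have : 0 <= (1 - t) * s + t * s' by rewrite addr_ge0// mulr_ge0// subr_ge0.
    by move=> h; have -> : s + t * (s' - s) = (1 - t) * s + t * s' by ring.
  + rewrite opp_row_mx add_row_mx scale_row_mx add_row_mx; congr (row_mx _ _).
      by rewrite mulmxDl -scalemxAl mulmxBl.
    by apply/rowP => i; rewrite ord1 !mxE eqxx !mulr1n dotvDl dotvZl dotvBl; ring.
have [N0|N0] := eqVneq (dotv z0 z0) 0.
  move: (dotvv_eq0 N0); rewrite z0E -row_mx0 => /eq_row_mx[h1 h2].
  exists v0; split => //; have := congr1 (fun M : 'M[R]_1 => M 0 0) h2.
  by rewrite /= !mxE eqxx mulr1n; move: s0_ge0; clear; lra.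
have {}N0 : 0 < dotv z0 z0 by rewrite lt_def N0 dotvv_ge0.
pose a0 := v0 *m B^T; pose tau := dotv v0 e + kap + s0.
have NE : dotv z0 z0 = dotv a0 a0 + tau * tau by rewrite z0E dotv_row_mx dot1.
have dz v s : D x v -> 0 <= s ->
    dotv z0 z0 <= dotv a0 (v *m B^T) + tau * (dotv v e + kap + s).
  move=> Dv s_ge0; apply: le_trans (z0min (row_mx (v *m B^T) ((dotv v e + kap + s)%:M)) _) _.
    by exists v, s.
  by rewrite z0E dotv_row_mx dot1.
(* The slack can always be increased, so the last coordinate of the min-norm point is nonnegative,
   as the one-sided hypothesis on [s] requires. *)
have tau0 : 0 <= tau.
  have := dz v0 (s0 + 1) Dv0; rewrite NE -/a0 => /(_ (addr_ge0 s0_ge0 ler01)).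
  by rewrite /tau; clear; nra.
have [r r0 H] := stat (- a0) tau tau0.
have N2 : 0 < dotv z0 z0 / 2 by rewrite divr_gt0.
have [|r1 r10 H1] := subdiff_on_upper gd (w := - a0 *m B - tau *: e)
    (kap := tau * kap - dotv z0 z0) xr _ N2.
  move=> v Dv; have := dz v 0 Dv (lexx 0).
  have -> : dotv v (- a0 *m B - tau *: e) = - dotv a0 (v *m B^T) - tau * dotv v e.
    by rewrite dotvBr dotvZr dotvC dotv_mulmx dotvNl.
  by clear; lra.
pose t := Num.min (r / 2) (r1 / 2).
have t0 : 0 < t by rewrite lt_min !divr_gt0.
have tr : t < r by apply: le_lt_trans (_ : r / 2 < r); [rewrite ge_min lexx|lra].
have tr1 : t < r1 by apply: le_lt_trans (_ : r1 / 2 < r1); [rewrite ge_min lexx orbT|lra].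
have := H t; rewrite t0 tr => /(_ isT) h1; have := H1 t; rewrite t0 tr1 => /(_ isT) h2.
have h3 : 0 < t * dotv z0 z0 by exact: mulr_gt0.
exfalso; move: h1 h2 h3; clear; nra.
Qed.

Record c1_ball c rho psi G : Prop := C1Ball {
  c1_diff : forall x, `|x - c| < rho -> forall e, 0 < e -> exists2 r, 0 < r &
    forall y, `|y - x| < r -> `|psi y - psi x - dotv (G x) (y - x)| <= e * `|y - x|;
  c1_cont : forall x, `|x - c| < rho -> {for x, continuous G};
  c1_bnd : exists M : R, forall x, `|x - c| < rho -> `|G x| <= M }.

Lemma c1_continuous c rho psi G x : c1_ball c rho psi G -> `|x - c| < rho ->
  {for x, continuous psi}.
Proof.
move=> cG xr; apply/(@cvgrPdist_lt _ _ _ (nbhs x)) => e e0.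
have [r r0 H] := c1_diff cG xr ltr01.
pose K : R := d%:R * `|G x| + 1; have K0 : 0 < K by rewrite ltr_wpDl// mulr_ge0.
apply: (iffRL (near_distP x _)); exists (Num.min r (e / K)).
  by rewrite lt_min r0 divr_gt0.
move=> y; rewrite lt_min => /andP[y1 y2]; rewrite distrC.
have h1 := H y y1; have h2 := dotv_le (G x) (y - x).
have h3 : K * `|y - x| < e by rewrite mulrC -ltr_pdivlMr.
have := ler_normD (psi y - psi x - dotv (G x) (y - x)) (dotv (G x) (y - x)).
rewrite subrK; move: h1 h2 h3; rewrite /K; clear; lra.
Qed.

Lemma subdiff_on_add_c1 c rho phi D psi G : subdiff_on c rho phi D -> c1_ball c rho psi G ->
  subdiff_on c rho (fun x => phi x + psi x) (fun x => [set v + G x | v in D x]).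
Proof.
move=> gd cG; split.
- move=> x xr; have h1 := subdiff_on_cont gd xr; have h2 := c1_continuous cG xr.
  exact: cvgD h1 h2.
- by move=> x xr; have [v Dv] := subdiff_on_ne gd xr; exists (v + G x), v.
- have [M MP] := subdiff_on_bnd gd; have [M' MP'] := c1_bnd cG.
  exists (M + M') => x _ xr [v Dv <-]; apply: le_trans (ler_normD _ _) _.
  by apply: lerD; [exact: MP Dv|exact: MP'].
- move=> xs vs x w xsr xr xx vv Dk.
  exists (w - G x); last by rewrite subrK.
  have Gx := cvg_comp xs G xx (c1_cont cG xr).
  apply: (subdiff_on_closed gd xsr xr xx (cvgB vv Gx)) => k /=.
  have -> : (vs - (G \o xs)) k = vs k - G (xs k) by [].
  by have [v Dv <-] := Dk k; rewrite addrK.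
- move=> x _ _ t xr [v Dv <-] [w Dw <-] t01; exists (v + t *: (w - v)).
    exact: subdiff_on_cvx gd _ _ _ _ xr Dv Dw t01.
  by apply/rowP => i; rewrite !mxE; ring.
- move=> x _ xr [v Dv <-]; apply/regular_subdiffP => e e0.
  have e2 : 0 < e / 2 by lra.
  have [r1 r10 H1] := (iffLR (regular_subdiffP _ _ _)) (subdiff_on_lower gd xr Dv) _ e2.
  have [r2 r20 H2] := c1_diff cG xr e2.
  exists (Num.min r1 r2); first by rewrite lt_min r10.
  move=> y; rewrite lt_min => /andP[/H1 h1 /H2]; rewrite ler_norml => /andP[h2 _].
  by rewrite dotvDl; move: h1 h2; clear; lra.
- move=> x w kap xr Dk e e0.
  have e2 : 0 < e / 2 by lra.
  have [|r1 r10 H1] := subdiff_on_upper gd (w := w) (kap := kap - dotv (G x) w) xr _ e2.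
    move=> v Dv; have := Dk (v + G x) (ex_intro2 _ _ v Dv erefl).
    by rewrite dotvDl; clear; lra.
  pose K : R := 2 * (`|w| + 1); have K0 : 0 < K by rewrite mulr_gt0// ltr_wpDl.
  have [|r2 r20 H2] := c1_diff cG xr (_ : 0 < e / K); first by rewrite divr_gt0.
  exists (Num.min r1 (r2 / K)); first by rewrite lt_min r10 divr_gt0.
  move=> t; rewrite lt_min => /andP[t0 /andP[tr1 tr2]].
  have := H1 t; rewrite t0 tr1 => /(_ isT) h1.
  have tw : `|t *: w| = t * `|w| by rewrite normrZ gtr0_norm.
  have tK : t * K < r2 by rewrite -ltr_pdivlMr.
  have := H2 (x + t *: w); rewrite addrC addKr tw dotvZr.
  have -> : t * `|w| < r2.
    by move: tK t0 (normr_ge0 w); rewrite /K; clear; nra.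
  move=> /(_ isT); rewrite ler_norml => /andP[_ h2].
  have h3 : e / K * (t * `|w|) <= t * (e / 2).
    have -> : t * (e / 2) = e / K * (t * (`|w| + 1)).
      by rewrite /K; field; rewrite gt_eqF// ltr_wpDl.
    by apply: ler_wpM2l; [rewrite ltW// divr_gt0|rewrite ler_pM2l// lerDl].
  by move: h1 h2 h3; clear; lra.
Qed.

Section maximum.
Context {Q : finType} (phi : Q -> E -> R) (D : Q -> E -> set E) (A : {set Q}) (F : E -> R).

(** The convex hull of the active subdifferentials. [v] selects a subgradient for every index, also
    for those of weight zero, so that limits can be taken index by index. *)
Definition max_subdiff x : set E := [set w | exists (lam : Q -> R) (v : Q -> E),
  [/\ forall q, 0 <= lam q, \sum_q lam q = 1,
      forall q, lam q != 0 -> q \in A /\ phi q x = F x,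
      forall q, D q x (v q) & w = \sum_q lam q *: v q]].

Lemma sum_delta (V : lmodType R) (q : Q) (f : Q -> V) :
  \sum_p ((p == q)%:R : R) *: f p = f q.
Proof.
rewrite (bigD1 q)//= eqxx scale1r big1 ?addr0// => p /negbTE ->.
by rewrite scale0r.
Qed.

Lemma sum_delta1 (q : Q) : \sum_p ((p == q)%:R : R) = 1.
Proof. by rewrite (bigD1 q)//= eqxx big1 ?addr0// => p /negbTE ->. Qed.

(** For closedness, an index of positive limit weight is active along the tail, hence in the limit.
    For the upper estimate, active pieces are tested with unit weights, and inactive pieces stay
    below the bound for a short time by continuity. *)
Lemma subdiff_on_max c rho : (forall q, subdiff_on c rho (phi q) (D q)) ->
  (forall x q, q \in A -> phi q x <= F x) ->
  (forall x, exists2 q, q \in A & F x = phi q x) ->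
  subdiff_on c rho F max_subdiff.
Proof.
move=> gd Fge Fat.
have Fc x : `|x - c| < rho -> {for x, continuous F}.
  move=> xr; apply/(@cvgrPdist_lt _ _ _ (nbhs x)) => e e0.
  have e2 : 0 < e / 2 by lra.
  have : \forall y \near x, forall q, `|phi q x - phi q y| < e / 2.
    apply: (@filter_forall _ Q (fun q y => `|phi q x - phi q y| < e / 2) (nbhs x)) => q.
    by have /cvgrPdist_lt := subdiff_on_cont (gd q) xr; exact.
  apply: filterS => y H; apply: le_lt_trans (_ : _ <= e / 2) _; last lra.
  rewrite ler_norml; have [q qA Fx] := Fat x; have [p pA Fy] := Fat y.
  have := H q; rewrite ltr_norml => /andP[h1 h1'].
  have := H p; rewrite ltr_norml => /andP[h2 h2'].
  have h3 := Fge y q qA; have h4 := Fge x p pA.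
  by apply/andP; split; lra.
have /choice[M MP] : forall q, exists M : R, forall x v, `|x - c| < rho -> D q x v -> `|v| <= M.
  by move=> q; exact: subdiff_on_bnd (gd q).
pose M1 : R := \sum_q `|M q|.
have DM q x v : `|x - c| < rho -> D q x v -> `|v| <= M1.
  move=> xr Dv; apply: le_trans (MP q x v xr Dv) _; apply: le_trans (ler_norm _) _.
  by rewrite /M1 (bigD1 q)//= lerDl sumr_ge0.
have basis_sel x : `|x - c| < rho -> exists v : Q -> E, forall q, D q x (v q).
  move=> xr; have /choice[v Dv] : forall q, exists v, D q x v.
    by move=> q; exact: (subdiff_on_ne (gd q) xr).
  by exists v.
have lam1 (lam : Q -> R) q : (forall q, 0 <= lam q) -> \sum_q lam q = 1 -> `|lam q| <= 1.
  by move=> l0 l1; rewrite ger0_norm// -l1 (bigD1 q)//= lerDl sumr_ge0.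
split => //.
- move=> x xr; have [v Dv] := basis_sel x xr; have [q qA Fx] := Fat x.
  exists (v q), (fun p => (p == q)%:R), v; split => //.
  + exact: sum_delta1.
  + by move=> p; have [->|_] := eqVneq p q; rewrite ?eqxx.
  + by rewrite sum_delta.
- exists M1 => x _ xr [lam [v [l0 l1 _ Dv ->]]].
  apply: le_trans (ler_norm_sum _ _ _) _.
  apply: (@le_trans _ _ (\sum_q lam q * M1)); last by rewrite -mulr_suml l1 mul1r.
  by apply: ler_sum => q _; rewrite normrZ ger0_norm// ler_wpM2l// (DM q x).
- move=> xs ws x w xsr xr xx ww Dk.
  have /choice[lam /choice[v H]] : forall k, exists (lam : Q -> R) (v : Q -> E),
      [/\ forall q, 0 <= lam q, \sum_q lam q = 1,
      forall q, lam q != 0 -> q \in A /\ phi q (xs k) = F (xs k),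
      forall q, D q (xs k) (v q) & ws k = \sum_q lam q *: v q] by exact: Dk.
  have [|s1 [l [s1k ll]]] := @bolzano_weierstrass_family R Q lam 1.
    by move=> k q; have [h1 h2 _ _ _] := H k; exact: lam1.
  have [|s2 [u [s2k uu]]] := @bolzano_weierstrass_rV_family R d Q (v \o s1) M1.
    by move=> k q; have [_ _ _ h _] := H (s1 k); exact: DM (xsr _) (h q).
  pose s := s1 \o s2.
  have sk k : (k <= s k)%N by apply: leq_trans (s2k k) (s1k _).
  have {}ll q : (fun k => lam (s k) q) @ \oo --> l q by exact: (cvg_subseq s2k (ll q)).
  have {}uu q : (fun k => v (s k) q) @ \oo --> u q by exact: uu.
  have xs' := cvg_subseq sk xx.
  exists l, u; split.
  + by move=> q; apply: (seq_cvg_ge (ll q)) => k; have [] := H (s k).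
  + apply: (@seq_cvg_unique _ _ (fun k => \sum_q lam (s k) q)).
    - exact: cvg_bigsum.
    - have -> : (fun k => \sum_q lam (s k) q) = fun=> 1.
        by apply/funext => k; have [] := H (s k).
      exact: cvg_cst.
  + move=> q lq; have lq0 : 0 < `|l q| by rewrite normr_gt0.
    have /cvgrPdist_lt/(_ _ lq0)[N _ HN] := ll q.
    have act k : (N <= k)%N -> q \in A /\ phi q (xs (s k)) = F (xs (s k)).
      move=> Nk; have [_ _ h _ _] := H (s k); apply: h.
      have := HN k Nk; rewrite /=; apply: contraTneq => ->.
      by rewrite subr0 ltxx.
    split; first by have [] := act N (leqnn N).
    apply: (@seq_cvg_unique _ _ (fun k => phi q (xs (s k)))).
    - exact: (cvg_comp _ (phi q) xs' (subdiff_on_cont (gd q) xr)).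
    - have := cvg_comp _ F xs' (Fc x xr); apply: cvg_trans; apply: near_eq_cvg.
      by exists N => // k /= /act[_ ->].
  + move=> q; apply: (subdiff_on_closed (gd q) _ xr xs' (uu q)) => k //=.
    by have [_ _ _ h _] := H (s k).
  + apply: (@seq_cvg_unique _ _ (fun k => ws (s k))).
    - exact: (cvg_subseq sk ww).
    - have -> : (fun k => ws (s k)) = fun k => \sum_q lam (s k) q *: v (s k) q.
        by apply/funext => k; have [] := H (s k).
      by apply: cvg_bigsum => q _; exact: cvgZ.
- move=> x _ _ t xr [l [v [l0 l1 lA Dv ->]]] [m [w [m0 m1 mA Dw ->]]] /andP[t0 t1].
  pose n (q : Q) : R := (1 - t) * l q + t * m q.
  have t1' : 0 <= 1 - t by rewrite subr_ge0.
  have n0 q : 0 <= n q by rewrite addr_ge0// mulr_ge0.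
  (* For each index the two subgradients are averaged in proportion to their weights; if both
     weights vanish, [v q] is only a default. *)
  pose z q := if n q == 0 then v q else v q + (t * m q / n q) *: (w q - v q).
  exists n, z; split => //.
  + by rewrite big_split /= -!mulr_sumr l1 m1; ring.
  + move=> q; rewrite /n; have [l00|/lA//] := eqVneq (l q) 0.
    have [m00|/mA//] := eqVneq (m q) 0.
    by rewrite l00 m00 !mulr0 addr0 eqxx.
  + move=> q; rewrite /z; have [//|nq] := eqVneq (n q) 0.
    have nq0 : 0 < n q by rewrite lt_def nq n0.
    apply: (subdiff_on_cvx (gd q)) => //; apply/andP; split.
      by rewrite divr_ge0// mulr_ge0.
    by rewrite ler_pdivrMr// mul1r /n lerDr mulr_ge0.
  + rewrite -sumrB scaler_sumr -big_split /=; apply: eq_bigr => q _.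
    rewrite /z; have [nq|nq] := eqVneq (n q) 0.
      have h1 : (1 - t) * l q = 0.
        by apply/eqP; rewrite eq_le mulr_ge0// andbT -nq lerDl mulr_ge0.
      have h2 : t * m q = 0.
        by apply/eqP; rewrite eq_le mulr_ge0// andbT -nq lerDr mulr_ge0.
      rewrite nq scale0r scalerBr !scalerA h2 scale0r sub0r -scalerBl.
      by rewrite -[X in X - _]mul1r -mulrBl h1 scale0r.
    have h : n q * (t * m q / n q) = t * m q by rewrite mulrC divfK.
    rewrite [RHS]scalerDr [n q *: (_ *: _)]scalerA h.
    by apply/rowP => i; rewrite !mxE /n; ring.
- move=> x _ xr [l [v [l0 l1 lA Dv ->]]]; apply/regular_subdiffP => e e0.
  have /choice[r rP] : forall q, exists r, 0 < r /\ forall y, `|y - x| < r ->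
      phi q x + dotv (v q) (y - x) - e * `|y - x| <= phi q y.
    move=> q; have [r r0 H] := (iffLR (regular_subdiffP _ _ _)) (subdiff_on_lower (gd q) xr (Dv q)) _ e0.
    by exists r.
  have [r1 r10 r1r] := @finite_pos_lb R Q r (fun q => proj1 (rP q)).
  exists r1 => // y yx.
  have -> : F x + dotv (\sum_q l q *: v q) (y - x) - e * `|y - x| =
      \sum_q l q * (F x + dotv (v q) (y - x) - e * `|y - x|).
    rewrite dotv_suml; under [RHS]eq_bigr do rewrite mulrBr mulrDr.
    rewrite sumrB big_split /= -!mulr_suml l1 !mul1r; congr (_ + _ - _).
    by apply: eq_bigr => q _; rewrite dotvZl.
  have -> : F y = \sum_q l q * F y by rewrite -mulr_suml l1 mul1r.
  apply: ler_sum => q _; have [->|lq] := eqVneq (l q) 0; first by rewrite !mul0r.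
  apply: ler_wpM2l => //; have [qA <-] := lA q lq.
  by apply: le_trans (Fge y q qA); apply: (proj2 (rP q)); exact: lt_le_trans yx (r1r q).
- move=> x u kap xr Dk e e0.
  have [v Dv] := basis_sel x xr.
  have /choice[r rP] : forall q, exists r, 0 < r /\ (q \in A -> forall t, 0 < t < r ->
      phi q (x + t *: u) <= F x + t * (kap + e)).
    move=> q; have [qA|] := boolP (q \in A); last by exists 1.
    have [phF|phF] := eqVneq (phi q x) (F x).
      have [|r r0 H] := subdiff_on_upper (gd q) (w := u) (kap := kap) xr _ e0.
        move=> w Dw; apply: Dk; exists (fun p => (p == q)%:R), (fun p => if p == q then w else v p).
        split => //.
        + exact: sum_delta1.
        + by move=> p; have [->|_] := eqVneq p q; rewrite ?eqxx.
        + by move=> p; have [->|_] := eqVneq p q.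
        + by rewrite sum_delta eqxx.
      by exists r; split=> // _ t tr; rewrite -phF; exact: H.
    have lt0 : 0 < F x - phi q x by rewrite subr_gt0 lt_def eq_sym phF Fge.
    pose g := F x - phi q x.
    have g2 : 0 < g / 2 by rewrite divr_gt0.
    have /cvgrPdist_lt/(_ _ g2) nq := subdiff_on_cont (gd q) xr.
    have [r1 r10 H1] := (iffLR (near_distP x (fun y => `|phi q x - phi q y| < g / 2))) nq.
    pose K1 := `|u| + 1; pose K2 := `|kap + e| + 1.
    have K10 : 0 < K1 by rewrite ltr_wpDl.
    have K20 : 0 < K2 by rewrite ltr_wpDl.
    exists (Num.min (r1 / K1) (g / 2 / K2)); split; first by rewrite lt_min !divr_gt0.
    move=> _ t; rewrite lt_min => /andP[t0 /andP[]].
    rewrite !ltr_pdivlMr// => h1 h2.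
    have h3 : `|x + t *: u - x| < r1.
      rewrite addrC addKr normrZ gtr0_norm//; apply: le_lt_trans h1.
      by rewrite ler_pM2l// /K1 lerDl.
    have := H1 _ h3; rewrite ltr_norml => /andP[h4 _].
    have h5 : - (kap + e) <= `|kap + e| by rewrite -normrN ler_norm.
    have h6 : - (t * (kap + e)) <= t * K2.
      by rewrite -mulrN ler_pM2l// /K2; move: h5; lra.
    by rewrite /g in h2 h4; lra.
  have [r1 r10 r1r] := @finite_pos_lb R Q r (fun q => proj1 (rP q)).
  exists r1 => // t /andP[t0 tr]; have [q qA ->] := Fat (x + t *: u).
  apply: (proj2 (rP q)) => //; rewrite t0 /=; exact: lt_le_trans tr (r1r q).
Qed.

End maximum.
End subdiff_on_operations.

(** * The gap property and minimal relations *)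

Section row_spaces.
Context {R : realType}.

(** [B^T] and the Gram matrix [B *m B^T] have the same row space, so [c *m B] is recovered linearly
    from [c *m B *m B^T]. *)
Lemma submx_norm_le k d (B : 'M[R]_(k, d)) : exists2 C : R, 0 <= C &
  forall l : 'rV_d, (l <= B)%MS -> `|l| <= C * `|l *m B^T|.
Proof.
have kerB : (kermx (B *m B^T) <= kermx B)%MS.
  apply/rV_subP => u /sub_kermxP uBB; apply/sub_kermxP; apply: dotvv_eq0.
  by rewrite dotv_mulmx -mulmxA uBB dotv0r.
have rkB : (\rank B^T <= \rank (B *m B^T))%N.
  have := mxrankS kerB; rewrite !mxrank_ker mxrank_tr.
  have := rank_leq_row B; have := rank_leq_row (B *m B^T); lia.
have BT : (B^T <= B *m B^T)%MS.
  have [h1 h2] := mxrank_leqif_sup (submxMl B B^T).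
  by rewrite -h2 eqn_leq h1.
have [Y BY] := submxP BT.
have [C C0 CP] := mulmx_norm_le Y^T.
exists C => // l /submxP[c ->]; apply: le_trans (CP _).
have := congr1 trmx BY; rewrite !trmx_mul !trmxK => BE.
by rewrite {1}BE !mulmxA.
Qed.

Lemma submx_orth k d (B : 'M[R]_(k, d)) (l : 'rV_d) :
  (l <= B)%MS -> l *m B^T = 0 -> l = 0.
Proof.
by move=> /submxP[c ->] cB; apply: dotvv_eq0; rewrite dotv_mulmx cB dotv0r.
Qed.

Lemma cvg_submx k d (B : 'M[R]_(k, d)) (u : nat -> 'rV[R]_d) (l : 'rV[R]_d) :
  u @ \oo --> l -> (forall n, (u n <= B)%MS) -> (l <= B)%MS.
Proof.
move=> ul uB; rewrite submxE; apply/eqP.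
apply: (@seq_cvg_unique _ _ (fun n => u n *m cokermx B)); first exact: cvg_mulmxl.
rewrite (_ : (fun n => _) = fun=> 0); first exact: cvg_cst.
by apply/funext => n; apply/eqP; rewrite -submxE.
Qed.

Lemma convex_bigsum d (S : set 'rV[R]_d) (J : finType) (a : J -> R) (v : J -> 'rV[R]_d) :
  (forall v w (t : R), S v -> S w -> 0 <= t <= 1 -> S (v + t *: (w - v))) ->
  (forall j, 0 <= a j) -> \sum_j a j = 1 -> (forall j, S (v j)) ->
  S (\sum_j a j *: v j).
Proof.
move=> Scv a0 a1 Sv.
have K (r : seq J) : 0 < \sum_(j <- r) a j ->
    S ((\sum_(j <- r) a j)^-1 *: (\sum_(j <- r) a j *: v j)).
  elim: r => [|j r IH]; first by rewrite big_nil ltxx.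
  rewrite !big_cons; set s := \sum_(i <- r) a i.
  have s0 : 0 <= s by apply: sumr_ge0.
  have [sE|sn] := eqVneq s 0.
    rewrite sE addr0 => aj0.
    have -> : \sum_(i <- r) a i *: v i = 0.
      have : forall i, i \in r -> a i = 0.
        move=> i ir; apply/eqP; rewrite eq_le a0 andbT -sE /s.
        rewrite (big_rem i)//= lerDl; exact: sumr_ge0.
      move=> h; rewrite big_seq big1// => i ir; by rewrite h// scale0r.
    by rewrite addr0 scalerA mulVf ?scale1r ?gt_eqF.
  have sp : 0 < s by rewrite lt_def sn.
  move=> ajs; have Sw := IH sp.
  have := Scv _ _ (s / (a j + s)) (Sv j) Sw.
  have -> : v j + s / (a j + s) *: (s^-1 *: (\sum_(i <- r) a i *: v i) - v j) =
      (a j + s)^-1 *: (a j *: v j + \sum_(i <- r) a i *: v i).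
    apply/rowP => i; rewrite !mxE; field.
    by rewrite sn gt_eqF.
  apply; apply/andP; split; first by rewrite divr_ge0// ltW.
  by rewrite ler_pdivrMr// mul1r lerDr.
have := K (index_enum J); rewrite a1 invr1 scale1r; apply; exact: ltr01.
Qed.

End row_spaces.

Section exchange.
Context {R : realType} {T : finType}.

(** The ratio test of the simplex method: [tau] is the largest multiple of [c] that can be removed
    from [lam] without losing nonnegativity. *)
Lemma exchange (lam c : T -> R) : (forall t, 0 <= lam t) -> (exists t, 0 < c t) ->
  exists tau t0, [/\ 0 <= tau, 0 < c t0, lam t0 - tau * c t0 = 0 &
    forall t, 0 <= lam t - tau * c t].
Proof.
move=> l0 [t1 ct1].
have [t0 /= ct0 tmin] := arg_minP (P := fun t => 0 < c t) (fun t => lam t / c t) ct1.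
exists (lam t0 / c t0), t0; split => //.
- by rewrite divr_ge0// ltW.
- by rewrite divfK ?subrr// gt_eqF.
move=> t; have [ct|ct] := ltP 0 (c t).
  by rewrite subr_ge0 -ler_pdivlMr// tmin.
apply: addr_ge0 => //; rewrite oppr_ge0.
by apply: mulr_ge0_le0 => //; rewrite divr_ge0// ltW.
Qed.

End exchange.

Section gap.
Context {R : realType} {d k : nat} {T : finType}.
Local Notation E := 'rV[R]_d.
Implicit Types (phi : T -> E -> R) (D : T -> E -> set E) (eta : E -> 'rV[R]_k)
  (H : E -> 'M[R]_(k, d)) (x y z xbar w : E) (v : T -> E) (lam c : T -> R)
  (mu nu : 'rV[R]_k) (I : {set T}) (rho del cH M : R).

(* [gs_dep]: modulo the rows of [H x], a nearly vanishing convex combination of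
   subgradients at a point near [xbar] is supported on a dependent family. *)
Record gap_system phi D eta H xbar rho del cH M : Prop := GapSystem {
  gs_subdiff : forall t, subdiff_on xbar rho (phi t) (D t);
  gs_c1 : forall mu, c1_ball xbar rho (fun x => dotv mu (eta x)) (fun x => mu *m H x);
  gs_ind_pos : 0 < cH;
  gs_ind : forall x mu, `|x - xbar| < rho -> cH * `|mu| <= `|mu *m H x|;
  gs_bnd : forall t x w, `|x - xbar| < rho -> D t x w -> `|w| <= M;
  gs_del : 0 < del;
  gs_dep : forall x v lam mu, `|x - xbar| < rho -> x <> xbar ->
    (forall t, D t x (v t)) -> (forall t, 0 <= lam t) -> \sum_t lam t = 1 ->
    `|\sum_t lam t *: v t + mu *m H x| < del ->
    exists c nu, [/\ exists t, c t != 0, forall t, lam t = 0 -> c t = 0 &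
      \sum_t c t *: v t + nu *m H x = 0] }.

Lemma gs_ind0 phi D eta H xbar rho del cH M x mu :
  gap_system phi D eta H xbar rho del cH M -> `|x - xbar| < rho ->
  mu *m H x = 0 -> mu = 0.
Proof.
move=> gs xr mH; have := gs_ind gs mu xr; rewrite mH normr0.
by rewrite pmulr_rle0 ?(gs_ind_pos gs)// normr_le0 => /eqP.
Qed.

(* Caratheodory reduction, renormalised at each step so that the weights keep
   sum 1: it stops only at an exact relation. *)
Lemma exact_relation phi D eta H xbar rho del cH M x v lam mu :
  gap_system phi D eta H xbar rho del cH M -> `|x - xbar| < rho -> x <> xbar ->
  (forall t, D t x (v t)) -> (forall t, 0 <= lam t) -> \sum_t lam t = 1 ->
  `|\sum_t lam t *: v t + mu *m H x| < del ->
  exists lam' nu, [/\ forall t, 0 <= lam' t, \sum_t lam' t = 1,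
    forall t, lam t = 0 -> lam' t = 0 & \sum_t lam' t *: v t + nu *m H x = 0].
Proof.
move=> gs xr xn Dv.
have [n] := ubnP #|[pred t | lam t != 0]|.
elim: n lam mu => // n IH lam mu; rewrite ltnS => cardn l0 l1 small.
have [c0 [nu0 [[tn ctn] c0s rel0]]] := gs_dep gs xr xn Dv l0 l1 small.
(* Up to sign, the dependence has nonpositive total. Subtracting a nonnegative multiple then leaves
   total weight at least 1, and renormalising does not enlarge the residual. *)
have [c [nu [cn cs c_le0 rel]]] : exists c nu, [/\ exists t, c t != 0,
    forall t, lam t = 0 -> c t = 0, \sum_t c t <= 0 & \sum_t c t *: v t + nu *m H x = 0].
  have [h|h] := leP (\sum_t c0 t) 0; first by exists c0, nu0; split=> //; exists tn.
  exists (fun t => - c0 t), (- nu0); split.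
  - by exists tn; rewrite oppr_eq0.
  - by move=> t /c0s ->; rewrite oppr0.
  - by rewrite sumrN oppr_le0 ltW.
  - rewrite mulNmx; under eq_bigr do rewrite scaleNr.
    by rewrite sumrN -opprD rel0 oppr0.
have [/exchange|npos] := pselect (exists t, 0 < c t).
  move=> /(_ _ l0)[tau [t0 [tau0 ct0 lt0 lpos]]].
  pose S := \sum_t (lam t - tau * c t).
  have SE : S = 1 - tau * \sum_t c t by rewrite /S sumrB l1 mulr_sumr.
  have S1 : 1 <= S by rewrite SE lerBrDl gerDr mulr_ge0_le0.
  have S0 : 0 < S by exact: lt_le_trans S1.
  pose lam1 t := (lam t - tau * c t) / S.
  have supp t : lam t = 0 -> lam1 t = 0.
    by move=> h; rewrite /lam1 h (cs _ h) mulr0 subrr mul0r.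
  have [||||lam' [nu' [h1 h2 h3 h4]]] := IH lam1 (S^-1 *: (mu - tau *: nu)).
  - apply: leq_trans cardn; apply: proper_card; apply/properP; split.
      by apply/fintype.subsetP => t; rewrite !inE; apply: contra => /eqP/supp ->.
    exists t0; rewrite !inE; last by rewrite /lam1 lt0 mul0r eqxx.
    by apply/eqP => /cs h; rewrite h ltxx in ct0.
  - by move=> t; rewrite divr_ge0// ltW.
  - by rewrite -mulr_suml -/S divff// gt_eqF.
  - have -> : \sum_t lam1 t *: v t + S^-1 *: (mu - tau *: nu) *m H x =
        S^-1 *: (\sum_t lam t *: v t + mu *m H x).
      rewrite -scalemxAl mulmxBl -scalemxAl.
      have -> : \sum_t lam1 t *: v t =
          S^-1 *: (\sum_t lam t *: v t - tau *: \sum_t c t *: v t).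
        rewrite scaler_sumr -sumrB scaler_sumr; apply: eq_bigr => t _.
        by rewrite scalerA -scalerBl scalerA mulrC.
      rewrite -scalerDr; congr (_ *: _).
      have -> : nu *m H x = - \sum_t c t *: v t.
        by apply/eqP; rewrite -addr_eq0 addrC rel.
      by rewrite scalerN opprK addrACA addNr addr0.
    rewrite normrZ gtr0_norm ?invr_gt0//; apply: le_lt_trans small.
    by rewrite ler_piMl// invf_le1.
  by exists lam', nu'; split => // t /supp/h3.
(* Without a positive entry the dependence has constant sign: negated and normalised, it is the
   relation sought. *)
have cle t : c t <= 0 by rewrite leNgt; apply/negP => h; apply: npos; exists t.
case: cn => t1 ct1; pose S := \sum_t - c t.
have S0 : 0 < S.
  rewrite /S (bigD1 t1)//= ltr_wpDr//; first by apply: sumr_ge0 => t _; rewrite oppr_ge0.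
  by rewrite oppr_gt0 lt_def eq_sym ct1 cle.
exists (fun t => - c t / S), (- S^-1 *: nu); split.
- by move=> t; rewrite divr_ge0 ?oppr_ge0// ltW.
- by rewrite -mulr_suml -/S divff// gt_eqF.
- by move=> t /cs ->; rewrite oppr0 mul0r.
- have -> : \sum_t (- c t / S) *: v t = - S^-1 *: \sum_t c t *: v t.
    rewrite scaler_sumr; apply: eq_bigr => t _; rewrite scalerA; congr (_ *: _).
    by rewrite mulNr mulrC mulNr.
  by rewrite -scalemxAl -scalerDr rel scaler0.
Qed.

Definition relation D H x I lam v mu := [/\ forall t, 0 <= lam t, \sum_t lam t = 1,
  forall t, t \notin I -> lam t = 0, forall t, D t x (v t) &
  \sum_t lam t *: v t + mu *m H x = 0].

(** Minimality ranges over all selections of subgradients at [x], not over one fixed family. This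
    makes it usable after a subgradient has been perturbed, and for limits of relations at nearby
    points. *)
Definition minimal_relation D H x I :=
  (exists lam v mu, relation D H x I lam v mu) /\
  forall lam v mu, relation D H x I lam v mu -> forall t, t \in I -> 0 < lam t.

Lemma minimal_relation_exists D H x I lam v mu : relation D H x I lam v mu ->
  exists2 I1 : {set T}, I1 \subset I & minimal_relation D H x I1.
Proof.
have [n] := ubnP #|I|; elim: n I lam v mu => // n IH I lam v mu.
rewrite ltnS => In rel.
have [min|] := pselect (forall lam v mu, relation D H x I lam v mu -> forall t, t \in I -> 0 < lam t).
  by exists I => //; split => //; exists lam, v, mu.
move=> /existsNP[lam1] /existsNP[v1] /existsNP[mu1] /not_implyP[[l0 l1 lI Dv r]].
move=> /existsNP[t /not_implyP[tI lt]].
have lt0 : lam1 t = 0.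
  by apply/eqP; rewrite eq_le l0 andbT leNgt; apply/negP.
have [||I1 I1I min] := IH (I :\ t) lam1 v1 mu1.
- by apply: leq_trans In; rewrite [leqRHS](cardsD1 t) tI.
- split => // t'; rewrite !inE negb_and negbK => /orP[/eqP -> //|]; exact: lI.
exists I1 => //; apply: fintype.subset_trans I1I _; exact: subsetDl.
Qed.

(** Removing from [lam] a multiple of a dependence with a positive entry would empty one index of
    [I]; since the weight at [i0] is untouched, the result can be normalised and contradicts
    minimality. Applied to [c] and to [- c], this shows that relations are unique up to a factor. *)
Lemma minimal_relation_uniq D H x I lam v mu c nu i0 :
  (forall mu, mu *m H x = 0 -> mu = 0) ->
  minimal_relation D H x I -> relation D H x I lam v mu ->
  (forall t, t \notin I -> c t = 0) -> \sum_t c t *: v t + nu *m H x = 0 ->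
  i0 \in I -> c i0 = 0 -> (forall t, c t = 0) /\ nu = 0.
Proof.
move=> ind [_ min] rel0 cI rel i0I ci0.
have [l0 l1 lI Dv relv] := rel0.
have nopos c1 nu1 : (forall t, t \notin I -> c1 t = 0) -> c1 i0 = 0 ->
    \sum_t c1 t *: v t + nu1 *m H x = 0 -> forall t, c1 t <= 0.
  move=> c1I c1i0 rel1 t; rewrite leNgt; apply/negP => c1t.
  have [tau [t0 [tau0 ct0 lt0 lpos]]] := exchange l0 (ex_intro _ t c1t).
  pose S := \sum_t (lam t - tau * c1 t).
  have li0 : 0 < lam i0 by exact: min rel0 _ i0I.
  have S0 : 0 < S.
    rewrite /S (bigD1 i0)//= c1i0 mulr0 subr0 ltr_wpDr//.
    exact: sumr_ge0.
  have t0I : t0 \in I by apply: contraTT ct0 => /c1I ->; rewrite ltxx.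
  suff /min/(_ t0 t0I) : relation D H x I (fun t => (lam t - tau * c1 t) / S) v
      (S^-1 *: (mu - tau *: nu1)) by rewrite lt0 mul0r ltxx.
  split => //.
  - by move=> t'; rewrite divr_ge0// ltW.
  - by rewrite -mulr_suml -/S divff// gt_eqF.
  - by move=> t' t'I; rewrite lI// c1I// mulr0 subrr mul0r.
  - rewrite -scalemxAl mulmxBl -scalemxAl.
    have -> : \sum_t ((lam t - tau * c1 t) / S) *: v t =
        S^-1 *: (\sum_t lam t *: v t - tau *: \sum_t c1 t *: v t).
      rewrite scaler_sumr -sumrB scaler_sumr; apply: eq_bigr => t' _.
      by rewrite scalerA -scalerBl scalerA mulrC.
    have -> : nu1 *m H x = - \sum_t c1 t *: v t.
      by apply/eqP; rewrite -addr_eq0 addrC rel1.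
    rewrite -scalerDr scalerN opprK addrACA addNr addr0 relv scaler0//.
have c0 t : c t = 0.
  apply/eqP; rewrite eq_le (nopos c nu)//=.
  have := nopos (fun t => - c t) (- nu) _ _ _ t; rewrite oppr_le0; apply.
  - by move=> t' /cI ->; rewrite oppr0.
  - by rewrite ci0 oppr0.
  - rewrite mulNmx; under eq_bigr do rewrite scaleNr.
    by rewrite sumrN -opprD rel oppr0.
split => //; apply: ind.
by rewrite -rel big1 ?add0r// => t _; rewrite c0 scale0r.
Qed.

(** Its rows span the subspace of the relation; indices outside [I] get zero rows, which keeps the
    size independent of [I]. *)
Definition span_mx I v (Hx : 'M[R]_(k, d)) : 'M[R]_(#|T| + k, d) :=
  col_mx (\matrix_(a < #|T|) (if enum_val a \in I then v (enum_val a) else 0)) Hx.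

Lemma span_mx_v I v (Hx : 'M[R]_(k, d)) t : t \in I -> (v t <= span_mx I v Hx)%MS.
Proof.
move=> tI; apply: submx_trans (_ : _ <= col_mx _ _)%MS; last exact: submx_refl.
rewrite -addsmxE; apply: submx_trans (addsmxSl _ _).
have -> : v t = row (enum_rank t) (\matrix_(a < #|T|) (if enum_val a \in I then v (enum_val a) else 0)).
  by rewrite rowK enum_rankK tI.
exact: row_sub.
Qed.

Lemma span_mx_H I v (Hx : 'M[R]_(k, d)) mu : (mu *m Hx <= span_mx I v Hx)%MS.
Proof.
apply: submx_trans (submxMl _ _) _; rewrite /span_mx -addsmxE; exact: addsmxSr.
Qed.

Lemma span_mx_comb I v (Hx : 'M[R]_(k, d)) c mu : (forall t, t \notin I -> c t = 0) ->
  ((\sum_t c t *: v t + mu *m Hx)%R <= span_mx I v Hx)%MS.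
Proof.
move=> cI; rewrite addmx_sub ?span_mx_H// summx_sub// => t _.
have [tI|tI] := boolP (t \in I); first by rewrite scalemx_sub// span_mx_v.
by rewrite cI// scale0r sub0mx.
Qed.

(** Replacing [v t] by a point slightly towards [w] spoils the relation by less than [del], so an
    exact one exists for the new family. By minimality its weight at [t] is positive, and it can be
    solved for [w]. *)
Lemma subdiff_sub_span phi D eta H xbar rho del cH M x I lam v mu t w :
  gap_system phi D eta H xbar rho del cH M -> `|x - xbar| < rho -> x <> xbar ->
  minimal_relation D H x I -> relation D H x I lam v mu ->
  t \in I -> D t x w -> (w <= span_mx I v (H x))%MS.
Proof.
move=> gs xr xn [_ min] [l0 l1 lI Dv rel] tI Dw.
pose s : R := Num.min 1 (del / (2 * (`|w - v t| + 1))).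
have K0 : 0 < `|w - v t| + 1 by rewrite ltr_wpDl.
have s0 : 0 < s by rewrite lt_min ltr01 divr_gt0 ?mulr_gt0 ?(gs_del gs).
have s1 : s <= 1 by rewrite ge_min lexx.
have sdel : s * (2 * (`|w - v t| + 1)) <= del.
  by rewrite -ler_pdivlMr ?mulr_gt0// ge_min lexx orbT.
pose vs t' := if t' == t then v t + s *: (w - v t) else v t'.
have vsE (c : T -> R) : \sum_t' c t' *: vs t' = \sum_t' c t' *: v t' + (c t * s) *: (w - v t).
  rewrite (bigD1 t)//= [in RHS](bigD1 t)//= /vs eqxx scalerDr scalerA.
  rewrite addrAC; congr (_ + _ + _); apply: eq_bigr => t' /negbTE t't.
  by rewrite t't.
have Dvs t' : D t' x (vs t').
  rewrite /vs; case: eqP => [->|//].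
  by apply: (subdiff_on_cvx (gs_subdiff gs t)) => //; rewrite s1 ltW.
have [|lam' [nu [h1 h2 h3 h4]]] := exact_relation gs xr xn Dvs l0 l1 (mu := mu).
  rewrite vsE addrAC rel add0r normrZ ger0_norm; last by rewrite mulr_ge0// ltW.
  have lt1 : lam t <= 1 by rewrite -l1 (bigD1 t)//= lerDl sumr_ge0.
  have : lam t * s * `|w - v t| <= 1 * s * `|w - v t|.
    by apply: ler_wpM2r => //; apply: ler_wpM2r => //; exact: ltW.
  have := gs_del gs; have := normr_ge0 (w - v t).
  by move: sdel s0; clear; nra.
have lt' : 0 < lam' t.
  by apply: (min lam' vs nu) => //; split => // t' /lI/h3.
have : (lam' t * s) *: (w - v t) = - (\sum_t' lam' t' *: v t' + nu *m H x).
  by apply/eqP; rewrite -addr_eq0 addrC addrAC -vsE h4.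
move=> /(congr1 (fun u => (lam' t * s)^-1 *: u)).
rewrite scalerA mulVf ?scale1r; last by rewrite gt_eqF// mulr_gt0.
move=> /eqP; rewrite subr_eq => /eqP ->.
rewrite addmx_sub ?span_mx_v// scalemx_sub// eqmx_opp span_mx_comb//.
by move=> t' /lI/h3.
Qed.

End gap.

(** * The penalised function *)

Section penalty.
Context {R : realType} {d k : nat} {T : finType}.
Local Notation E := 'rV[R]_d.
Local Notation signs := {ffun 'I_k -> bool}.
Implicit Types (phi : T -> E -> R) (D : T -> E -> set E) (eta : E -> 'rV[R]_k)
  (H : E -> 'M[R]_(k, d)) (x y z u xbar w : E) (v : T -> E) (lam c : T -> R)
  (mu nu : 'rV[R]_k) (I : {set T}) (rho del cH M Lam a e r t : R) (s : signs)
  (q : T * signs).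

Definition sign_row Lam s : 'rV[R]_k := \row_j (if s j then Lam else - Lam).

Definition piece phi eta Lam q x : R := phi q.1 x + dotv (sign_row Lam q.2) (eta x).

Definition piece_subdiff D H Lam q x : set E :=
  [set w + sign_row Lam q.2 *m H x | w in D q.1 x].

Definition pieces I : {set T * signs} := finset (fun q => q.1 \in I).

(* max_(i in I) phi_i + Lam * sum_j |eta_j|, as a maximum over i and signs. *)
Definition penalized phi eta Lam I q0 x : R :=
  piece phi eta Lam [arg max_(q > q0 in pieces I) piece phi eta Lam q x]%O x.

Definition penalized_subdiff phi D eta H Lam I q0 : E -> set E :=
  max_subdiff (piece phi eta Lam) (piece_subdiff D H Lam) (pieces I)
    (penalized phi eta Lam I q0).

Lemma mem_pieces I q : (q \in pieces I) = (q.1 \in I).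
Proof. by rewrite inE. Qed.

Lemma penalized_ge phi eta Lam I q0 x q : q0.1 \in I -> q.1 \in I ->
  piece phi eta Lam q x <= penalized phi eta Lam I q0 x.
Proof.
move=> q0I qI; rewrite /penalized.
case: arg_maxP => [|p _ pmax]; first by rewrite mem_pieces.
by apply: pmax; rewrite mem_pieces.
Qed.

Lemma penalized_at phi eta Lam I q0 x : q0.1 \in I ->
  exists2 q, q.1 \in I & penalized phi eta Lam I q0 x = piece phi eta Lam q x.
Proof.
move=> q0I; rewrite /penalized; case: arg_maxP => [|p pI _]; first by rewrite mem_pieces.
by exists p; rewrite -?mem_pieces.
Qed.

Lemma subdiff_on_penalized phi D eta H xbar rho del cH M Lam I q0 :
  gap_system phi D eta H xbar rho del cH M -> q0.1 \in I ->
  subdiff_on xbar rho (penalized phi eta Lam I q0) (penalized_subdiff phi D eta H Lam I q0).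
Proof.
move=> gs q0I; apply: subdiff_on_max => [q|x q|x].
- exact: subdiff_on_add_c1 (gs_subdiff gs _) (gs_c1 gs _).
- by rewrite mem_pieces; exact: penalized_ge.
- by have [q qI ->] := penalized_at phi eta Lam x q0I; exists q; rewrite ?mem_pieces.
Qed.

Lemma norm_sign_row Lam s : 0 <= Lam -> `|sign_row Lam s| <= Lam.
Proof.
by move=> L0; apply: normrV_le => // i; rewrite mxE; case: ifP; rewrite ?normrN ger0_norm.
Qed.

Lemma dotv_sign_row Lam mu : 0 <= Lam -> exists s,
  dotv (sign_row Lam s) mu = Lam * \sum_j `|mu 0 j|.
Proof.
move=> L0; exists [ffun j => 0 <= mu 0 j].
rewrite mulr_sumr; apply: eq_bigr => j _; rewrite mxE ffunE.
by case: (lerP 0 (mu 0 j)) => h; rewrite ?(ger0_norm h)// (ltr0_norm h) mulrN mulNr.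
Qed.

(** The signs are summed out: convexity of each [D i x] merges the pieces [(i, s)] into one
    subgradient, and the sign rows average to a multiplier [mu]. Where [eta_j] is nonzero only one
    sign is active, so [mu_j] has full size. *)
Lemma penalized_subdiff_flat phi D eta H xbar rho del cH M Lam I q0 x w :
  gap_system phi D eta H xbar rho del cH M -> `|x - xbar| < rho -> 0 < Lam ->
  q0.1 \in I -> penalized_subdiff phi D eta H Lam I q0 x w ->
  exists lam v mu, [/\ [/\ forall i, 0 <= lam i, \sum_i lam i = 1,
    forall i, i \notin I -> lam i = 0 & forall i, D i x (v i)],
    w = \sum_i lam i *: v i + mu *m H x, `|mu| <= Lam,
    forall j, eta x 0 j != 0 -> Lam <= `|mu 0 j| &
    forall i, lam i != 0 -> exists s, piece phi eta Lam (i, s) x = penalized phi eta Lam I q0 x].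
Proof.
move=> gs xr L0 q0I [l [vq [l0 l1 lA Dvq ->]]].
pose s0 : signs := [ffun=> true].
have [u uP] : exists u : T * signs -> E, forall q, D q.1 x (u q) /\
    vq q = u q + sign_row Lam q.2 *m H x.
  have /choice[u uP] : forall q, exists u : E, D q.1 x u /\ vq q = u + sign_row Lam q.2 *m H x.
    by move=> q; have [u Du <-] := Dvq q; exists u.
  by exists u.
pose lam i := \sum_s l (i, s).
have lam0 i : 0 <= lam i by apply: sumr_ge0.
pose v i := if lam i == 0 then u (i, s0) else \sum_s (l (i, s) / lam i) *: u (i, s).
pose mu := \sum_q l q *: sign_row Lam q.2.
have pairE (V : lmodType R) (F : T * signs -> V) : \sum_q F q = \sum_i \sum_s F (i, s).
  by rewrite pair_bigA /=; apply: eq_bigr => -[i s].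
exists lam, v, mu; split; [split|..].
- exact: lam0.
- by rewrite /lam pair_bigA /= -l1; apply: eq_bigr => -[i s].
- move=> i iI; rewrite /lam big1// => s _; apply/eqP; apply: contraNT iI => h.
  by have [] := lA _ h; rewrite mem_pieces.
- move=> i; rewrite /v; have [_|li] := eqVneq (lam i) 0.
    by have [] := uP (i, s0).
  apply: convex_bigsum.
  + by move=> a b t Da Db t01; apply: (subdiff_on_cvx (gs_subdiff gs i)).
  + by move=> s; rewrite divr_ge0.
  + by rewrite -mulr_suml divff.
  + by move=> s; have [] := uP (i, s).
- rewrite mulmx_suml -[RHS]addrC.
  under eq_bigr => q _ do rewrite (proj2 (uP q)) scalerDr.
  rewrite big_split /= addrC; congr (_ + _).
    by apply: eq_bigr => q _; rewrite scalemxAl.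
  rewrite pairE; apply: eq_bigr => i _; rewrite /v.
  have [li|li] := eqVneq (lam i) 0.
    rewrite li scale0r big1// => s _.
    have -> : l (i, s) = 0; last by rewrite scale0r.
    by apply/eqP; rewrite eq_le l0 andbT -li /lam (bigD1 s)//= lerDl sumr_ge0.
  by rewrite scaler_sumr; apply: eq_bigr => s _; rewrite scalerA mulrC divfK.
- apply: le_trans (ler_norm_sum _ _ _) _.
  apply: (@le_trans _ _ (\sum_q l q * Lam)); last by rewrite -mulr_suml l1 mul1r.
  apply: ler_sum => q _; rewrite normrZ ger0_norm// ler_wpM2l// norm_sign_row//.
  exact: ltW.
- move=> j ej; pose b : bool := 0 < eta x 0 j.
  have act q : l q != 0 -> q.2 j = b.
    move=> lq; have [qA qF] := lA q lq; rewrite mem_pieces in qA.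
    (* Flipping the sign at [j] cannot improve an active piece, and as [eta_j] is nonzero this
       determines the sign. *)
    pose s' : signs := [ffun i => if i == j then ~~ q.2 i else q.2 i].
    have := @penalized_ge phi eta Lam I q0 x (q.1, s') q0I qA.
    rewrite -qF /piece /= lerD2l /dotv (bigD1 j)//= [leRHS](bigD1 j)//=.
    have -> : \sum_(i < k | i != j) sign_row Lam s' 0 i * eta x 0 i =
        \sum_(i < k | i != j) sign_row Lam q.2 0 i * eta x 0 i.
      by apply: eq_bigr => i /negbTE ij; rewrite !mxE ffunE ij.
    rewrite lerD2r !mxE ffunE eqxx /b; case: (q.2 j) => /=; rewrite mulNr => h.
      rewrite lt_def ej /=; have : 0 <= Lam * eta x 0 j by lra.
      by rewrite pmulr_rge0// => ->.
    apply/esym/negbTE; rewrite -leNgt -(pmulr_rle0 _ L0); lra.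
  have -> : mu 0 j = if b then Lam else - Lam.
    rewrite /mu summxE -[RHS]mul1r -l1 mulr_suml; apply: eq_bigr => q _.
    have [->|lq] := eqVneq (l q) 0; first by rewrite scale0r mxE mul0r.
    by rewrite !mxE (act _ lq).
  by case: (b); rewrite ?normrN ger0_norm// ltW.
- move=> i li; have [s ls] : exists s, l (i, s) != 0.
    apply: contrapT => nls; move/eqP: li; apply; rewrite /lam big1// => s _.
    by apply/eqP; apply: contrapT => /negP h; apply: nls; exists s.
  by exists s; have [] := lA _ ls.
Qed.

Lemma relation_mu_bound phi D eta H xbar rho del cH M x I lam v mu :
  gap_system phi D eta H xbar rho del cH M -> `|x - xbar| < rho ->
  relation D H x I lam v mu -> cH * `|mu| <= `|M|.
Proof.
move=> gs xr [l0 l1 _ Dv rel]; apply: le_trans (gs_ind gs mu xr) _.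
have -> : mu *m H x = - \sum_i lam i *: v i.
  by apply/eqP; rewrite -addr_eq0 addrC rel.
rewrite normrN; apply: le_trans (ler_norm_sum _ _ _) _.
apply: (@le_trans _ _ (\sum_i lam i * `|M|)); last by rewrite -mulr_suml l1 mul1r.
apply: ler_sum => i _; rewrite normrZ ger0_norm// ler_wpM2l//.
exact: le_trans (gs_bnd gs xr (Dv i)) (ler_norm _).
Qed.

(* All weights are positive and the multipliers of the equations stay below
   [Lam], so 0 is in the relative interior of the subdifferential. *)
Lemma sharp_direction D H z I lam v mu Lam : relation D H z I lam v mu ->
  (forall i, i \in I -> 0 < lam i) -> 0 < Lam -> `|mu| <= Lam / 2 ->
  exists2 c1 : R, 0 < c1 & forall u, exists i s, i \in I /\
    c1 * `|u *m (span_mx I v (H z))^T| <= dotv (v i + sign_row Lam s *m H z) u.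
Proof.
move=> [l0 l1 lI Dv rel] lpos L0 muL.
have [i1 i1I] : exists i, i \in I.
  apply: contrapT => nI; move/eqP: l1; rewrite big1 ?(eq_sym 0) ?oner_eq0// => i _.
  by apply: lI; apply/negP => h; apply: nI; exists i.
have [|m m0 mP] := @finite_pos_lb R T (fun i => if i \in I then lam i else 1).
  by move=> i; case: ifPn => [/lpos|_].
pose K := m^-1 + 2 / Lam.
have K0 : 0 < K by rewrite addr_gt0 ?invr_gt0 ?divr_gt0.
exists K^-1; first by rewrite invr_gt0.
move=> u; have [s sE] := dotv_sign_row (u *m (H z)^T) (ltW L0).
pose p i := dotv (v i) u; pose Qs : R := \sum_j `|(u *m (H z)^T) 0 j|.
have [i0 /= i0I imax] := arg_maxP (P := fun i => i \in I) p i1I.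
exists i0, s; split => //.
rewrite dotvDl dotv_mulmx sE -/Qs -/(p i0).
(* [X] is the largest slope along [u] among the pieces. Since [|mu| <= Lam / 2], half of the penalty
   survives in it and controls [u *m (H z)^T]; the relation, with weights at least [m] on [I],
   controls the [p i]. *)
set X := p i0 + Lam * Qs.
have Qs0 : 0 <= Qs by apply: sumr_ge0.
have relu : \sum_i lam i * p i = - dotv mu (u *m (H z)^T).
  apply/eqP; rewrite -addr_eq0; apply/eqP.
  transitivity (dotv (\sum_i lam i *: v i + mu *m H z) u); last by rewrite rel dotv0l.
  rewrite dotvDl dotv_suml dotv_mulmx; congr (_ + _).
  by apply: eq_bigr => i _; rewrite dotvZl.
have muQ : `|dotv mu (u *m (H z)^T)| <= Lam / 2 * Qs.
  apply: le_trans (ler_norm_sum _ _ _) _; rewrite mulr_sumr; apply: ler_sum => j _.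
  rewrite normrM ler_wpM2r//; exact: le_trans (normrV_coord _ _) muL.
have relp : - (Lam / 2 * Qs) <= \sum_i lam i * p i.
  by rewrite relu lerN2; exact: le_trans (ler_norm _) muQ.
have lp i : lam i * p i <= lam i * p i0.
  have [iI|iI] := boolP (i \in I); last by rewrite lI// !mul0r.
  by apply: ler_wpM2l => //; exact: imax.
have p0 : - (Lam / 2 * Qs) <= p i0.
  apply: le_trans relp _; rewrite -[leRHS]mul1r -l1 mulr_suml; exact: ler_sum.
have LQ0 : 0 <= Lam * Qs by rewrite mulr_ge0// ltW.
have X1 : Lam / 2 * Qs <= X by rewrite /X; lra.
have X2 : p i0 <= X by rewrite /X; lra.
have X0 : 0 <= X.
  by apply: le_trans X1; rewrite mulr_ge0 ?divr_ge0// ltW.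
have pX i : i \in I -> `|p i| <= m^-1 * X.
  move=> iI; have li := lpos i iI; have mi := mP i; rewrite iI in mi.
  have li1 : lam i <= 1 by rewrite -l1 (bigD1 i)//= lerDl sumr_ge0.
  have lpX : - X <= lam i * p i.
    have h1 : lam i * p i + (1 - lam i) * p i0 >= - (Lam / 2 * Qs).
      have -> : 1 - lam i = \sum_(j | j != i) lam j.
        by rewrite -l1 (bigD1 i)//= addrAC subrr add0r.
      apply: le_trans relp _; rewrite (bigD1 i)//= lerD2l mulr_suml.
      exact: ler_sum.
    have [h|h] := leP 0 (p i0).
      have : (1 - lam i) * p i0 <= p i0 by rewrite ler_piMl// lerBlDr lerDl.
      by rewrite /X; lra.
    have : (1 - lam i) * p i0 <= 0 by rewrite mulr_ge0_le0 ?subr_ge0// ltW.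
    by lra.
  have m1 : m <= 1 by exact: le_trans mi li1.
  rewrite mulrC ler_pdivlMr//; suff : `|p i * m| <= X by rewrite normrM (gtr0_norm m0).
  rewrite ler_norml; apply/andP; split; last first.
    have [h|h] := leP 0 (p i).
      apply: le_trans (_ : p i * 1 <= _); first by rewrite ler_wpM2l.
      by rewrite mulr1; exact: le_trans (imax i iI) X2.
    by apply: le_trans X0; rewrite mulr_le0_ge0// ltW.
  have [h|h] := leP 0 (p i).
    by apply: le_trans (_ : 0 <= _); [rewrite oppr_le0|rewrite mulr_ge0// ltW].
  apply: le_trans lpX _; rewrite mulrC ler_wnM2l// ltW//.
have qX j : `|(u *m (H z)^T) 0 j| <= 2 / Lam * X.
  apply: le_trans (_ : Qs <= _); first by rewrite /Qs (bigD1 j)//= lerDl sumr_ge0.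
  by rewrite mulrAC ler_pdivlMr//; lra.
rewrite mulrC ler_pdivrMr// mulrC.
have m1X : m^-1 * X <= K * X.
  by rewrite ler_wpM2r// lerDl divr_ge0// ltW.
have LX : 2 / Lam * X <= K * X.
  by rewrite ler_wpM2r// lerDr invr_ge0 ltW.
apply: normrV_le; first by rewrite mulr_ge0// ltW.
move=> a; rewrite tr_col_mx mul_mx_row; case: (split_ordP a) => b ->.
  rewrite row_mxEl mxE; under eq_bigr do rewrite !mxE.
  have [iI|iI] := boolP (enum_val b \in I).
    by apply: le_trans m1X; have := pX _ iI; rewrite /p dotvC.
  rewrite big1 ?normr0 ?mulr_ge0// ?ltW// => j _.
  by rewrite mxE mulr0.
by rewrite row_mxEr; exact: le_trans (qX b) LX.
Qed.

End penalty.

(** * Points carrying an exact relation are local minimisers *)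

Section critical_points.
Context {R : realType} {d k : nat} {T : finType}.
Local Notation E := 'rV[R]_d.
Local Notation signs := {ffun 'I_k -> bool}.
Implicit Types (phi : T -> E -> R) (D : T -> E -> set E) (eta : E -> 'rV[R]_k)
  (H : E -> 'M[R]_(k, d)) (x y z u xbar w : E) (v : T -> E) (lam c : T -> R)
  (mu nu : 'rV[R]_k) (I : {set T}) (rho del cH M Lam a e r t : R) (s : signs)
  (q : T * signs).

Lemma cvg_mulmx_c1 eta H xbar rho (xs : nat -> E) (ms : nat -> 'rV[R]_k) x mu :
  (forall nu, c1_ball xbar rho (fun x => dotv nu (eta x)) (fun x => nu *m H x)) ->
  `|x - xbar| < rho -> xs @ \oo --> x -> ms @ \oo --> mu -> (fun n => ms n *m H (xs n)) @ \oo --> mu *m H x.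
Proof.
move=> c1 xr xx mm; rewrite mulmx_sum_row.
have -> : (fun n => ms n *m H (xs n)) = fun n => \sum_j ms n 0 j *: row j (H (xs n)).
  by apply/funext => n; rewrite mulmx_sum_row.
apply: cvg_bigsum => j _; apply: cvgZ; first exact: cvg_coord.
have := cvg_comp xs _ xx (c1_cont (c1 (delta_mx 0 j)) xr).
by rewrite rowE; apply: eq_seq_cvg => n; rewrite rowE.
Qed.

Lemma piece_eta0 phi eta Lam q x : eta x = 0 -> piece phi eta Lam q x = phi q.1 x.
Proof. by move=> e0; rewrite /piece e0 dotv0r addr0. Qed.

Lemma penalized_eta0 phi eta Lam I q0 x a : q0.1 \in I -> eta x = 0 ->
  (forall i, i \in I -> phi i x = a) -> penalized phi eta Lam I q0 x = a.
Proof.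
move=> q0I e0 ph; have [q qI ->] := penalized_at phi eta Lam x q0I.
by rewrite piece_eta0// ph.
Qed.

(** All pieces over [I] are active at [z], so the slope given by [sharp_direction] bounds the
    maximum from below. Growth is seen only through the component of [u] in the span of the
    relation. *)
Lemma penalized_sharp phi D eta H xbar rho del cH M Lam I q0 z lam v mu a :
  gap_system phi D eta H xbar rho del cH M -> `|z - xbar| < rho -> q0.1 \in I ->
  eta z = 0 -> (forall i, i \in I -> phi i z = a) ->
  relation D H z I lam v mu -> (forall i, i \in I -> 0 < lam i) -> 0 < Lam ->
  `|mu| <= Lam / 2 ->
  exists2 c1 : R, 0 < c1 & forall e, 0 < e -> exists2 r : R, 0 < r &
    forall u, `|u| < r -> a + c1 * `|u *m (span_mx I v (H z))^T| - e * `|u| <=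
      penalized phi eta Lam I q0 (z + u).
Proof.
move=> gs zr q0I ez pa rel lpos L0 muL.
have [c1 c10 sharp] := sharp_direction rel lpos L0 muL.
exists c1 => // e e0.
have [_ _ _ Dv _] := rel.
have /choice[r rP] : forall q, exists r : R, 0 < r /\ forall y, `|y - z| < r ->
    piece phi eta Lam q z + dotv (v q.1 + sign_row Lam q.2 *m H z) (y - z) - e * `|y - z| <=
      piece phi eta Lam q y.
  move=> q; have gq := subdiff_on_add_c1 (gs_subdiff gs q.1) (gs_c1 gs (sign_row Lam q.2)).
  have [|r r0 rP] := (iffLR (regular_subdiffP _ _ _)) (subdiff_on_lower gq zr
    (v := v q.1 + sign_row Lam q.2 *m H z) _) e e0; first by exists (v q.1).
  by exists r.
have [r1 r10 r1r] := @finite_pos_lb R (T * signs)%type r (fun q => proj1 (rP q)).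
exists r1 => // u ur; have [i [s [iI iu]]] := sharp u.
have := proj2 (rP (i, s)) (z + u); rewrite addrC addKr => /(_ (lt_le_trans ur (r1r _))).
rewrite /= piece_eta0//= pa// => h.
apply: le_trans (penalized_ge phi eta Lam (z + u) q0I (q := (i, s)) iI).
apply: le_trans h; rewrite lerD2r lerD2l; exact: iu.
Qed.

(* If [z] is not a local minimiser, minimise over the slices z + t e + L, with
   L the span of the relation, to find nearby subgradients orthogonal to L. *)
Lemma orthogonal_subgradient phi D eta H xbar rho del cH M Lam I q0 z lam v mu a :
  gap_system phi D eta H xbar rho del cH M -> `|z - xbar| < rho -> q0.1 \in I ->
  eta z = 0 -> (forall i, i \in I -> phi i z = a) ->
  relation D H z I lam v mu -> (forall i, i \in I -> 0 < lam i) -> 0 < Lam ->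
  `|mu| <= Lam / 2 -> ~ local_min (penalized phi eta Lam I q0) z ->
  forall e, 0 < e -> exists x w, [/\ `|x - z| < e, `|x - xbar| < rho,
    penalized_subdiff phi D eta H Lam I q0 x w,
    w *m (span_mx I v (H z))^T = 0 & w != 0].
Proof.
move=> gs zr q0I ez pa rel lpos L0 muL nmin e e0.
set B := span_mx I v (H z); set F := penalized phi eta Lam I q0.
have gF := subdiff_on_penalized Lam gs q0I; rewrite -/F in gF.
have Fz : F z = a by exact: penalized_eta0.
have [c1 c10 sharp] := penalized_sharp gs zr q0I ez pa rel lpos L0 muL.
have [C0 C00 C0P] := submx_norm_le B.
have [K K0 KP] := mulmx_norm_le B^T.
pose c2 := c1 / (C0 + 1).
have C01 : 0 < C0 + 1 by rewrite ltr_wpDl.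
have c20 : 0 < c2 by rewrite divr_gt0.
have Bl (l : E) : (l <= B)%MS -> c2 * `|l| <= c1 * `|l *m B^T|.
  move=> lB; rewrite /c2 mulrAC -mulrA ler_pM2l// ler_pdivrMr// mulrC.
  apply: le_trans (C0P l lB) _; rewrite ler_wpM2r// lerDl//.
have c24 : 0 < c2 / 4 by rewrite divr_gt0.
have [r1 r10 low] := sharp _ c24; rewrite -/B -/F in low.
pose r : R := Num.min (r1 / 4) (Num.min (e / 4) ((rho - `|z - xbar|) / 4)).
have zr0 : 0 < rho - `|z - xbar| by rewrite subr_gt0.
have r0 : 0 < r by rewrite !lt_min !divr_gt0.
have rr1 : r <= r1 / 4 by rewrite ge_min lexx.
have re : r <= e / 4 by rewrite !ge_min lexx orbT.
have rrho : r <= (rho - `|z - xbar|) / 4 by rewrite !ge_min lexx !orbT.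
(* A displacement along [dir] shorter than [eps * r] spoils at most [c2 / 4 * r] of the growth
   [c2 * r] at the boundary of the slice. *)
pose eps : R := Num.min 1 (c2 / (4 * (c1 * K + 1))).
have cK : 0 < c1 * K + 1 by rewrite ltr_wpDl// mulr_ge0// ltW.
have eps0 : 0 < eps by rewrite lt_min ltr01 divr_gt0// mulr_gt0.
have eps1 : eps <= 1 by rewrite ge_min lexx.
have epsK : eps * (4 * (c1 * K + 1)) <= c2.
  by rewrite -ler_pdivlMr ?mulr_gt0// ge_min lexx orbT.
have [y [yz Fy]] : exists y, `|y - z| < eps * r /\ F y < a.
  apply: contrapT => ny; apply: nmin; exists (eps * r); first exact: mulr_gt0.
  move=> y yz; rewrite -/F Fz leNgt; apply/negP => h; apply: ny; by exists y.
pose dir : E := y - z; pose kap : R := (a - F y) / 2.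
have kap0 : 0 < kap by rewrite divr_gt0// subr_gt0.
have dr : `|dir| <= r.
  by apply: le_trans (ltW yz) _; rewrite ler_piMl// ltW.
pose X := (E * R)%type.
pose pos (p : X) : E := z + (p.2 *: dir + p.1).
pose A (p : X) := [/\ (p.1 <= B)%MS, `|p.1| <= r & 0 <= p.2 <= 1].
have posr p : A p -> `|pos p - z| <= 2 * r.
  move=> [_ pr /andP[p0 p1]]; rewrite /pos addrC addKr.
  apply: le_trans (ler_normD _ _) _; rewrite normrZ ger0_norm//.
  have : p.2 * `|dir| <= `|dir| by rewrite ler_piMl.
  by move: dr pr; clear; lra.
have posrho p : A p -> `|pos p - xbar| < rho.
  move=> Ap; have := posr p Ap; have := ler_distD z (pos p) xbar.
  by move: rrho r0 zr0; clear; lra.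
(* The tilt still leaves the value at [(0, 1)] below [a]. Sharp growth therefore keeps the minimiser
   away from [|l| = r] and from [t = 0]: there [l] moves freely in the span and [t] can decrease,
   which is what [subdiff_on_stationary] needs. *)
pose Th (p : X) := F (pos p) + kap * p.2.
have [||[l t] Alt Thmin] := @seq_compact_min R X A Th.
- move=> p pA.
  have [|s1 [l [sk1 pl]]] := @bolzano_weierstrass_rV _ _ (fun n => (p n).1) r.
    by move=> n; have [] := pA n.
  have [|s2 [t [sk2 pt]]] := @bolzano_weierstrass_rV _ 1 (fun n => const_mx (p (s1 n)).2) 1.
    move=> n; apply: normrV_le => // i; rewrite mxE.
    by have [_ _ /andP[h1 h2]] := pA (s1 n); rewrite ger0_norm.
  have {}pt : (fun n => (p (s1 (s2 n))).2) @ \oo --> t 0 0.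
    have := cvg_coord (i := 0) pt; under eq_fun do rewrite /= mxE; exact.
  have {}pl : (fun n => (p (s1 (s2 n))).1) @ \oo --> l by exact: (cvg_subseq sk2 pl).
  have Al : A (l, t 0 0).
    split => /=.
    - by apply: cvg_submx pl _ => n; have [] := pA (s1 (s2 n)).
    - have := @cvg_norm_le R d _ _ 0 r pl; rewrite subr0; apply => n.
      by rewrite subr0; have [] := pA (s1 (s2 n)).
    - apply/andP; split.
        by apply: (seq_cvg_ge pt) => n; have [_ _ /andP[]] := pA (s1 (s2 n)).
      by apply: (seq_cvg_le pt) => n; have [_ _ /andP[]] := pA (s1 (s2 n)).
  exists (s1 \o s2), (l, t 0 0); split => //.
    by move=> n; apply: leq_trans (sk2 n) (sk1 _).
  have posl : (fun n => pos (p (s1 (s2 n)))) @ \oo --> pos (l, t 0 0).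
    apply: cvgD; first exact: cvg_cst.
    by apply: cvgD => //; apply: cvgZr_tmp.
  apply: cvgD; last by apply: cvgM; [exact: cvg_cst|exact: pt].
  exact: (cvg_comp _ F posl (subdiff_on_cont gF (posrho _ Al))).
- exists (0, 0); split; rewrite /= ?sub0mx ?normr0 ?lexx ?ler01//; exact: ltW.
have [lB lr t01] := Alt; rewrite /= in lB lr t01; have /andP[t0 t1] := t01.
pose x := pos (l, t); have xz := posr _ Alt; have xrho := posrho _ Alt.
rewrite -/x in xz xrho.
have Fx : F x + kap * t < a.
  have A1 : A (0, 1) by split; rewrite /= ?sub0mx ?normr0 ?lexx ?ler01// ltW.
  have := Thmin _ A1; rewrite /Th /= -/x /pos /= addr0 scale1r mulr1.
  rewrite /dir [z + _]addrC subrK /kap => h.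
  by move: h Fy; rewrite -/kap /kap; clear; lra.
have Fxa : F x < a by have := mulr_ge0 (ltW kap0) t0; move: Fx; clear; lra.
have lowx : a + c2 * `|l| - c1 * (K * (t * `|dir|)) - c2 / 4 * `|x - z| <= F x.
  have := low (x - z); rewrite [z + _]addrC subrK => h.
  apply: le_trans (h _); last by move: xz rr1 r0; clear; lra.
  rewrite lerD2r -addrA lerD2l lerBlDr.
  have -> : (x - z) *m B^T = l *m B^T + t *: (dir *m B^T).
    by rewrite /x /pos /= addrAC subrr add0r mulmxDl scalemxAl addrC.
  apply: le_trans (Bl l lB) _; rewrite -mulrDr ler_pM2l//.
  have := ler_normD (l *m B^T + t *: (dir *m B^T)) (- (t *: (dir *m B^T))).
  rewrite addrK normrN normrZ (ger0_norm t0).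
  have : t * `|dir *m B^T| <= t * (K * `|dir|) by rewrite ler_wpM2l.
  by clear; lra.
have lr' : `|l| < r.
  rewrite lt_def lr andbT; apply/eqP => lE.
  have h1 : c1 * (K * (t * `|dir|)) <= c2 / 4 * r.
    have h2 : t * `|dir| <= eps * r.
      by apply: le_trans (ltW yz); rewrite ler_piMl.
    have h3 : c1 * K * (t * `|dir|) <= c1 * K * (eps * r).
      by apply: ler_wpM2l => //; rewrite mulr_ge0// ltW.
    have h4 : c1 * K * eps * r <= c2 / 4 * r.
      rewrite ler_pM2r//; move: epsK eps0; clear; lra.
    by move: h3 h4; clear; lra.
  have h2 : c2 / 4 * `|x - z| <= c2 / 4 * (2 * r) by rewrite ler_pM2l.
  have h3 := mulr_gt0 c20 r0.
  by move: lowx Fxa h1 h2 h3; rewrite -lE; clear; lra.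
have tn0 : t != 0.
  apply/eqP => t00.
  have xE : x - z = l by rewrite /x /pos /= t00 scale0r add0r addrC addKr.
  move: lowx; rewrite xE t00 mul0r !mulr0 subr0 => h.
  have h2 := mulr_ge0 (ltW c20) (normr_ge0 l).
  by move: h h2 Fxa; clear; lra.
have {}t0 : 0 < t by rewrite lt_def tn0.
have [|w [Dw wB wd]] := subdiff_on_stationary (B := B) (e := dir) (kap := kap) gF xrho.
  move=> c s s0; pose b := c *m B.
  have b1 : 0 < `|b| + 1 by rewrite ltr_wpDl.
  have s1 : 0 < s + 1 by rewrite ltr_wpDl.
  exists (Num.min ((r - `|l|) / (`|b| + 1)) (t / (s + 1))).
    by rewrite lt_min !divr_gt0// subr_gt0.
  move=> t'; rewrite lt_min => /andP[t'0 /andP[]].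
  rewrite !ltr_pdivlMr// => h1 h2.
  have A2 : A (l + t' *: b, t - t' * s).
    split => /=.
    - by rewrite addmx_sub// scalemx_sub// submxMl.
    - apply: le_trans (ler_normD _ _) _; rewrite normrZ gtr0_norm//.
      by move: h1 t'0; clear; lra.
    - have := mulr_ge0 (ltW t'0) s0; move: h2 t'0 t1; clear.
      by move=> *; apply/andP; split; lra.
  have := Thmin _ A2; rewrite /Th /= -/x.
  have -> : pos (l + t' *: b, t - t' * s) = x + t' *: (b - s *: dir).
    by rewrite /x /pos /=; apply/rowP => i; rewrite !mxE; ring.
  by clear; lra.
exists x, w; split => //.
  by move: xz re r0 e0; clear; lra.
apply/eqP => w0; move: wd; rewrite w0 dotv0l; move: kap0; clear; lra.
Qed.

(* Otherwise there are, at points x_k -> z, subgradients orthogonal to the span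
   and hence, by [exact_relation], exact relations; subtracting a multiple kills
   one weight, and the normalised limit contradicts minimality at z. *)
Lemma critical_local_min phi D eta H xbar rho del cH M Lam I q0 z a :
  gap_system phi D eta H xbar rho del cH M -> `|z - xbar| < rho -> z <> xbar ->
  q0.1 \in I -> eta z = 0 -> (forall i, i \in I -> phi i z = a) ->
  minimal_relation D H z I -> 0 < Lam -> `|M| <= cH * (Lam / 2) ->
  local_min (penalized phi eta Lam I q0) z.
Proof.
move=> gs zr zn q0I ez pa minI L0 ML; apply: contrapT => nmin.
have [[lam0 [v0 [mu0 rel0]]] min] := minI.
have lpos0 := min _ _ _ rel0.
have muL : `|mu0| <= Lam / 2.
  by rewrite -(ler_pM2l (gs_ind_pos gs)); apply: le_trans ML; exact: relation_mu_bound gs zr rel0.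
pose B := span_mx I v0 (H z).
have DB i w : i \in I -> D i z w -> (w <= B)%MS.
  exact: subdiff_sub_span gs zr zn minI rel0.
have /choice[xw xwP] : forall n : nat, exists xw : E * E, [/\ `|xw.1 - z| < n.+1%:R^-1,
    `|xw.1 - xbar| < rho, penalized_subdiff phi D eta H Lam I q0 xw.1 xw.2,
    xw.2 *m B^T = 0 & xw.2 != 0].
  move=> n; have [|x [w h]] := orthogonal_subgradient gs zr q0I ez pa rel0 lpos0 L0 muL nmin
    (e := n.+1%:R^-1); first by rewrite invr_gt0.
  by exists (x, w).
have /choice[lam /choice[v /choice[mu fl]]] : forall n, exists (lam : T -> R) v mu,
  [/\ forall i, 0 <= lam i, \sum_i lam i = 1, forall i, i \notin I -> lam i = 0,
    forall i, D i (xw n).1 (v i) & `|mu| <= Lam /\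
    (xw n).2 = \sum_i lam i *: v i + mu *m H (xw n).1].
  move=> n; have [_ xr Dw _ _] := xwP n.
  have [lam [v [mu [[h1 h2 h3 h4] h5 h6 _ _]]]] := penalized_subdiff_flat gs xr L0 q0I Dw.
  by exists lam, v, mu.
have lam1 (l : T -> R) i : (forall i, 0 <= l i) -> \sum_i l i = 1 -> `|l i| <= 1.
  by move=> l0 l1; rewrite ger0_norm// -l1 (bigD1 i)//= lerDl sumr_ge0.
have [|s1 [lamL [sk1 lamc]]] := @bolzano_weierstrass_family R T lam 1.
  by move=> n i; have [h1 h2 _ _ _] := fl n; exact: lam1.
have [|s2 [vL [sk2 vc]]] := @bolzano_weierstrass_rV_family R d T (v \o s1) M.
  move=> n i; have [_ _ _ h _] := fl (s1 n); have [_ xr _ _ _] := xwP (s1 n).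
  exact: (gs_bnd gs xr (h i)).
have [|s3 [muL' [sk3 muc]]] := @bolzano_weierstrass_rV R k (mu \o s1 \o s2) Lam.
  by move=> n; have [_ _ _ _ []] := fl (s1 (s2 n)).
pose s := s1 \o s2 \o s3.
have sk n : (n <= s n)%N.
  exact: leq_trans (sk3 n) (leq_trans (sk2 _) (sk1 _)).
have xc : (fun n => (xw (s n)).1) @ \oo --> z.
  apply/cvgrPdist_lt => e e0; have [N NP] := invSn_lt e0.
  exists N => // n /= Nn; have [h _ _ _ _] := xwP (s n); rewrite distrC.
  by apply: lt_trans h (NP _ _); exact: leq_trans (sk n).
have {}lamc i : (fun n => lam (s n) i) @ \oo --> lamL i.
  have sk23 n : (n <= (s2 \o s3) n)%N by exact: leq_trans (sk3 n) (sk2 _).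
  exact: (cvg_subseq sk23 (lamc i)).
have {}vc i : (fun n => v (s n) i) @ \oo --> vL i.
  exact: (cvg_subseq sk3 (vc i)).
have {}muc : (fun n => mu (s n)) @ \oo --> muL' by exact: muc.
have DvL i : D i z (vL i).
  apply: (subdiff_on_closed (gs_subdiff gs i) _ zr xc (vc i)) => n; first by have [] := xwP (s n).
  by have [_ _ _ h _] := fl (s n).
have lamLI i : i \notin I -> lamL i = 0.
  move=> iI; apply: (@seq_cvg_unique _ _ (fun n => lam (s n) i)) => //.
  have -> : (fun n => lam (s n) i) = fun=> 0.
    by apply/funext => n; have [_ _ h _ _] := fl (s n); exact: h.
  exact: cvg_cst.
have wE n : (xw n).2 = \sum_i lam n i *: v n i + mu n *m H (xw n).1.
  by have [_ _ _ _ []] := fl n.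
have combB (cc : T -> R) (nu : 'rV_k) : (forall i, i \notin I -> cc i = 0) ->
    ((\sum_i cc i *: vL i + nu *m H z)%R <= B)%MS.
  move=> ccI; rewrite addmx_sub ?span_mx_H// summx_sub// => i _.
  have [iI|iI] := boolP (i \in I); first by rewrite scalemx_sub// (DB i).
  by rewrite ccI// scale0r sub0mx.
have limB (ws : nat -> E) w : ws @ \oo --> w -> (forall n, ws n *m B^T = 0) -> w *m B^T = 0.
  move=> ww wsB; apply: (@seq_cvg_unique _ _ (fun n => ws n *m B^T)); first exact: cvg_mulmxl.
  by rewrite (_ : (fun n => _) = fun=> 0); [exact: cvg_cst|exact/funext].
(* The limit is a combination of subgradients at [z], hence lies in the span, and it is orthogonal
   to the span as well. *)
have wc : (fun n => (xw (s n)).2) @ \oo --> (0 : E).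
  have -> : (0 : E) = \sum_i lamL i *: vL i + muL' *m H z.
    apply/esym/(submx_orth (combB _ _ lamLI)).
    apply: (limB (fun n => (xw (s n)).2)); last by move=> n; have [] := xwP (s n).
    under eq_fun do rewrite wE.
    apply: cvgD; last exact: cvg_mulmx_c1 (gs_c1 gs) zr xc muc.
    by apply: cvg_bigsum => i _; exact: cvgZ.
  under eq_fun do rewrite wE.
  apply: cvgD; last exact: cvg_mulmx_c1 (gs_c1 gs) zr xc muc.
  by apply: cvg_bigsum => i _; exact: cvgZ.
have [N HN] : exists N, forall n, (N <= n)%N -> `|(xw (s n)).2| < del /\ (xw (s n)).1 <> xbar.
  have /cvgrPdist_lt/(_ _ (gs_del gs))[N1 _ H1] := wc.
  have zx0 : 0 < `|z - xbar| by rewrite normr_gt0 subr_eq0; exact/eqP.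
  have /cvgrPdist_lt/(_ _ zx0)[N2 _ H2] := xc.
  exists (maxn N1 N2) => n; rewrite geq_max => /andP[n1 n2]; split.
    by have := H1 n n1; rewrite /= sub0r normrN.
  by move=> xE; have := H2 n n2; rewrite /= xE ltxx.
pose p n := s (N + n)%N.
have pk n : (n <= p n)%N by apply: leq_trans (sk _); exact: leq_addl.
have shift n : (n <= N + n)%N by exact: leq_addl.
have /choice[lam' /choice[mu' ex]] : forall n, exists (lam' : T -> R) nu,
    [/\ forall i, 0 <= lam' i, \sum_i lam' i = 1, forall i, i \notin I -> lam' i = 0 &
    \sum_i lam' i *: v (p n) i + nu *m H (xw (p n)).1 = 0].
  move=> n; have [wdel xn] := HN _ (leq_addr n N).
  have [l0 l1 lI Dv [_ wE']] := fl (p n); have [_ xr _ _ _] := xwP (p n).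
  have [|lam' [nu [h1 h2 h3 h4]]] := exact_relation gs xr xn Dv l0 l1 (mu := mu (p n)).
    by rewrite -wE'.
  by exists lam', nu; split=> // i /lI/h3.
have [|t1 [lamL2 [tk1 lamc2]]] := @bolzano_weierstrass_family R T lam' 1.
  by move=> n i; have [h1 h2 _ _] := ex n; exact: lam1.
have [|t2 [muL2 [tk2 muc2]]] := @bolzano_weierstrass_rV R k (mu' \o t1) (`|M| / cH).
  move=> n; rewrite /= ler_pdivlMr ?(gs_ind_pos gs)// mulrC.
  have [h1 h2 h3 h4] := ex (t1 n); have [_ xr _ _ _] := xwP (p (t1 n)).
  apply: (relation_mu_bound gs xr (I := I) (lam := lam' (t1 n)) (v := v (p (t1 n)))).
  by split => // i; have [_ _ _ h _] := fl (p (t1 n)).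
pose tt := t1 \o t2.
have tk n : (n <= tt n)%N by exact: leq_trans (tk2 n) (tk1 _).
have {}lamc2 i : (fun n => lam' (tt n) i) @ \oo --> lamL2 i.
  exact: (cvg_subseq tk2 (lamc2 i)).
have Ntk n : (n <= N + tt n)%N by exact: leq_trans (tk n) (shift _).
have xc2 : (fun n => (xw (p (tt n))).1) @ \oo --> z by exact: (cvg_subseq Ntk xc).
have vc2 i : (fun n => v (p (tt n)) i) @ \oo --> vL i by exact: (cvg_subseq Ntk (vc i)).
have relL : relation D H z I lamL2 vL muL2.
  split.
  - by move=> i; apply: (seq_cvg_ge (lamc2 i)) => n; have [h _ _ _] := ex (tt n).
  - apply: (@seq_cvg_unique _ _ (fun n => \sum_i lam' (tt n) i)); first exact: cvg_bigsum.
    have -> : (fun n => \sum_i lam' (tt n) i) = fun=> 1.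
      by apply/funext => n; have [] := ex (tt n).
    exact: cvg_cst.
  - move=> i iI; apply: (@seq_cvg_unique _ _ (fun n => lam' (tt n) i)) => //.
    have -> : (fun n => lam' (tt n) i) = fun=> 0.
      by apply/funext => n; have [_ _ h _] := ex (tt n); exact: h.
    exact: cvg_cst.
  - exact: DvL.
  - apply: (@seq_cvg_unique _ _ (fun n => \sum_i lam' (tt n) i *: v (p (tt n)) i +
      mu' (tt n) *m H (xw (p (tt n))).1)).
      apply: cvgD; last exact: cvg_mulmx_c1 (gs_c1 gs) zr xc2 muc2.
      by apply: cvg_bigsum => i _; exact: cvgZ.
    rewrite (_ : (fun n => _) = fun=> 0); first exact: cvg_cst.
    by apply/funext => n; have [] := ex (tt n).
pose i0 := q0.1.
have li0 : 0 < lamL2 i0 by exact: min relL _ q0I.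
have [N2 HN2] : exists N2, forall n, (N2 <= n)%N -> 0 < lam' (tt n) i0.
  have /cvgrPdist_lt/(_ _ li0)[N2 _ HN2] := lamc2 i0.
  exists N2 => n /HN2 /=; have := ler_norm (lamL2 i0 - lam' (tt n) i0); clear; lra.
pose m n := tt (N2 + n)%N.
have mpos n : 0 < lam' (m n) i0 by apply: HN2; exact: leq_addr.
(* Subtracting this multiple of the exact relation removes [i0] without changing the subgradient;
   the remaining coefficients are not all zero because the subgradient is nonzero. *)
pose tau n := lam (p (m n)) i0 / lam' (m n) i0.
pose al n i := lam (p (m n)) i - tau n * lam' (m n) i.
pose be n := mu (p (m n)) - tau n *: mu' (m n).
pose ga n : 'rV[R]_(#|T| + k) := row_mx (\row_a al n (enum_val a)) (be n).
have gaw n : (xw (p (m n))).2 = \sum_i al n i *: v (p (m n)) i + be n *m H (xw (p (m n))).1.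
  have [_ _ _ h4] := ex (m n).
  rewrite wE /al /be mulmxBl -scalemxAl.
  have -> : \sum_i (lam (p (m n)) i - tau n * lam' (m n) i) *: v (p (m n)) i =
     \sum_i lam (p (m n)) i *: v (p (m n)) i - tau n *: \sum_i lam' (m n) i *: v (p (m n)) i.
    by rewrite scaler_sumr -sumrB; apply: eq_bigr => i _; rewrite scalerBl scalerA.
  rewrite addrACA -opprD -scalerDr h4 scaler0 subr0//.
have ga0 n : 0 < `|ga n|.
  rewrite normr_gt0; apply/eqP => g0.
  have [_ _ _ _ /eqP] := xwP (p (m n)); apply; rewrite gaw.
  move: g0; rewrite /ga -row_mx0 => /eq_row_mx[g1 ->]; rewrite mul0mx addr0.
  apply: big1 => i _; have := congr1 (fun M : 'rV_(#|T|) => M 0 (enum_rank i)) g1.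
  by rewrite /= !mxE enum_rankK => ->; rewrite scale0r.
have [|r1 [gL [rk gc]]] := @bolzano_weierstrass_rV R _ (fun n => `|ga n|^-1 *: ga n) 1.
  by move=> n; rewrite normrZ normfV normr_id mulVf// gt_eqF.
have gL1 : `|gL| = 1.
  apply: (@seq_cvg_unique R R (fun n => `| `|ga (r1 n)|^-1 *: ga (r1 n)|)).
    exact: cvg_norm.
  rewrite (_ : (fun n => _) = fun=> 1); first exact: cvg_cst.
  by apply/funext => n; rewrite normrZ normfV normr_id mulVf// gt_eqF.
pose cL i := gL 0 (lshift k (enum_rank i)); pose nL := rsubmx gL.
have cLc i : (fun n => `|ga (r1 n)|^-1 * al (r1 n) i) @ \oo --> cL i.
  apply: eq_seq_cvg (cvg_coord (i := lshift k (enum_rank i)) gc) => n.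
  by rewrite /= mxE row_mxEl mxE enum_rankK.
have nLc : (fun n => `|ga (r1 n)|^-1 *: be (r1 n)) @ \oo --> nL.
  apply: cvg_rVP => j; rewrite mxE.
  apply: eq_seq_cvg (cvg_coord (i := rshift #|T| j) gc) => n.
  by rewrite /= [LHS]mxE [RHS]mxE row_mxEr.
have znk n : (n <= N + m (r1 n))%N.
  apply: leq_trans (rk n) _; apply: leq_trans (leq_addl N2 _) _.
  exact: leq_trans (tk _) (leq_addl _ _).
have xc3 : (fun n => (xw (p (m (r1 n)))).1) @ \oo --> z by exact: (cvg_subseq znk xc).
have vc3 i : (fun n => v (p (m (r1 n))) i) @ \oo --> vL i by exact: (cvg_subseq znk (vc i)).
have cLI i : i \notin I -> cL i = 0.
  move=> iI; apply: (@seq_cvg_unique _ _ (fun n => `|ga (r1 n)|^-1 * al (r1 n) i)) => //.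
  rewrite (_ : (fun n => _) = fun=> 0); first exact: cvg_cst.
  apply/funext => n; have [_ _ h _ _] := fl (p (m (r1 n))); have [_ _ h' _] := ex (m (r1 n)).
  by rewrite /al h// h'// mulr0 subrr mulr0.
have cLi0 : cL i0 = 0.
  apply: (@seq_cvg_unique _ _ (fun n => `|ga (r1 n)|^-1 * al (r1 n) i0)) => //.
  rewrite (_ : (fun n => _) = fun=> 0); first exact: cvg_cst.
  apply/funext => n; rewrite /al /tau divfK ?subrr ?mulr0//.
  by rewrite gt_eqF.
(* The rescaled subgradients need not be small, but they remain orthogonal to the span; their limit
   is in the span, hence zero. *)
have relc : \sum_i cL i *: vL i + nL *m H z = 0.
  apply: (submx_orth (combB _ _ cLI)).
  apply: (limB (fun n => `|ga (r1 n)|^-1 *: (xw (p (m (r1 n)))).2)); last first.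
    by move=> n; rewrite -scalemxAl; have [_ _ _ -> _] := xwP (p (m (r1 n))); rewrite scaler0.
  under eq_fun do rewrite gaw scalerDr scaler_sumr scalemxAl.
  apply: cvgD; last exact: cvg_mulmx_c1 (gs_c1 gs) zr xc3 nLc.
  apply: cvg_bigsum => i _; under eq_fun do rewrite scalerA.
  exact: cvgZ.
have [cL0 nL0] := minimal_relation_uniq (fun mu => gs_ind0 gs zr) minI relL cLI relc q0I cLi0.
move: gL1; rewrite -[gL]hsubmxK.
have -> : lsubmx gL = 0.
  by apply/rowP => b; have := cL0 (enum_val b); rewrite /cL enum_valK !mxE.
rewrite -/nL nL0 row_mx0 normr0 => /eqP; by rewrite eq_sym oner_eq0.
Qed.

End critical_points.

(** * Error bound from the gap property *)

Section gap_error_bound.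
Context {R : realType} {d k : nat} {T : finType}.
Local Notation E := 'rV[R]_d.
Local Notation signs := {ffun 'I_k -> bool}.
Implicit Types (phi : T -> E -> R) (D : T -> E -> set E) (eta : E -> 'rV[R]_k)
  (H : E -> 'M[R]_(k, d)) (x y z xbar w : E) (I : {set T}) (rho del cH M Lam : R).

(** If no subgradient is short there is descent. A short one forces [eta x = 0] and, by the gap, an
    exact relation among active functions; a minimal relation inside it makes [x] a local minimiser
    of a smaller maximum. *)
Lemma gap_slope phi D eta H xbar rho del cH M Lam I q0 x :
  gap_system phi D eta H xbar rho del cH M -> `|x - xbar| < rho -> x <> xbar ->
  q0.1 \in I -> 0 < Lam -> `|M| + 1 <= cH * (Lam / 2) ->
  local_min (penalized phi eta Lam I q0) x \/
  descent_point (penalized phi eta Lam I q0) (Num.min del 1 / 2) x.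
Proof.
move=> gs xr xn q0I L0 ML.
have gF := subdiff_on_penalized Lam gs q0I.
have d0 : 0 < Num.min del 1 by rewrite lt_min ltr01 (gs_del gs).
have [|nflat] := pselect (exists2 w, penalized_subdiff phi D eta H Lam I q0 x w &
  `|w| < Num.min del 1); last first.
  right; apply: subdiff_on_descent gF xr d0 _ => w Dw.
  by rewrite leNgt; apply/negP => h; apply: nflat; exists w.
move=> [w Dw wd]; left.
have [lam [v [mu [[l0 l1 lI Dv] wE muL muj act]]]] :=
  penalized_subdiff_flat gs xr L0 q0I Dw.
have [wdel w1] : `|w| < del /\ `|w| < 1.
  by move: wd; rewrite lt_min => /andP.
have M0 : 0 <= `|M| by [].
(* A nonzero [eta_j] would make the multiplier at least [Lam] in size, contributing at least
   [2 * (|M| + 1)]; subgradients bounded by [M] and a residual of norm below 1 cannot balance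
   this. *)
have e0 : eta x = 0.
  apply/rowP => j; rewrite mxE; apply/eqP; apply: contraT => /muj Lmu.
  have h1 : cH * Lam <= `|mu *m H x|.
    apply: le_trans (gs_ind gs mu xr); rewrite ler_wpM2l ?(ltW (gs_ind_pos gs))//.
    exact: le_trans Lmu (normrV_coord _ _).
  have h2 : `|mu *m H x| <= `|w| + `|\sum_i lam i *: v i|.
    have -> : mu *m H x = w - \sum_i lam i *: v i by rewrite wE addrC addKr.
    exact: ler_normB.
  have h3 : `|\sum_i lam i *: v i| <= `|M|.
    apply: le_trans (ler_norm_sum _ _ _) _.
    rewrite -[leRHS]mul1r -l1 mulr_suml; apply: ler_sum => i _.
    rewrite normrZ ger0_norm// ler_wpM2l//.
    by apply: le_trans (gs_bnd gs xr (Dv i)) _; exact: ler_norm.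
  have h4 : cH * (Lam / 2) = cH * Lam / 2 by rewrite mulrA.
  by move: ML h1 h2 h3 w1 h4 M0; clear; lra.
have [|lam' [nu [h1 h2 h3 h4]]] := exact_relation gs xr xn Dv l0 l1 (mu := mu).
  by rewrite -wE.
pose I0 : {set T} := finset (fun t => lam t != 0).
have [|I1 I1I minI] := @minimal_relation_exists _ _ _ _ D H x I0 lam' v nu.
  by split => // t; rewrite inE negbK => /eqP/h3.
have I0I t : t \in I0 -> t \in I.
  by rewrite inE; apply: contraR => /lI ->.
have I1I' : I1 \subset I by apply/fintype.subsetP => t /(fintype.subsetP I1I)/I0I.
have [i1 i1I] : exists i1, i1 \in I1.
  have [[l [v1 [m1 [r0 r1 rI _ _]]]] _] := minI.
  apply/set0Pn; apply: contra_eq_neq r1 => I10.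
  by rewrite big1 1?eq_sym ?oner_eq0// => t _; rewrite rI// I10 inE.
have pI i : i \in I1 -> phi i x = penalized phi eta Lam I q0 x.
  move=> /(fintype.subsetP I1I); rewrite inE => /act[s <-].
  by rewrite piece_eta0.
pose q1 : T * signs := (i1, [ffun=> true]).
have ML' : `|M| <= cH * (Lam / 2) by apply: le_trans ML; rewrite lerDl.
(* The maximum over [I1] lies below that over [I] and agrees with it at [x], so local minimality is
   inherited. *)
have [r r0 Hr] := critical_local_min gs xr xn (i1I : q1.1 \in I1) e0 pI minI L0 ML'.
exists r => // y /Hr; rewrite (penalized_eta0 _ (i1I : q1.1 \in I1) e0 pI).
move=> /le_trans; apply.
have [q qI ->] := penalized_at phi eta Lam y (i1I : q1.1 \in I1).
by apply: penalized_ge => //; exact: (fintype.subsetP I1I').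
Qed.

(** The zero function at [t0] makes F nonnegative, so that its zeros are the solutions. The second
    estimate keeps [y] close to [xbar], the only region in which the listed constraints describe the
    original system. *)
Lemma gap_error_bound phi D eta H xbar rho del cH M t0 :
  gap_system phi D eta H xbar rho del cH M -> 0 < rho ->
  (forall t, phi t xbar <= 0) -> eta xbar = 0 -> (forall x, phi t0 x = 0) ->
  exists alpha eps : R, [/\ 0 <= alpha, 0 < eps & forall x, `|x - xbar| < eps ->
    exists y, [/\ forall t, phi t y <= 0, eta y = 0,
      `|x - y| <= alpha * (\sum_t Num.max 0 (phi t x) + `|eta x|) &
      `|x - y| <= alpha * `|x - xbar|]].
Proof.
move=> gs rho0 phb eb p0.
have cH0 := gs_ind_pos gs.
pose Lam : R := 2 * (`|M| + 1) / cH.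
have M0 : 0 <= `|M| by [].
have L0 : 0 < Lam by rewrite /Lam divr_gt0 ?mulr_gt0//; lra.
have ML : `|M| + 1 <= cH * (Lam / 2).
  rewrite le_eqVlt; apply/orP; left; apply/eqP; rewrite /Lam; field.
  by rewrite gt_eqF.
pose I : {set T} := finset xpredT.
pose q0 : T * signs := (t0, [ffun=> true]).
have inI t : t \in I by rewrite inE.
pose F := penalized phi eta Lam I q0.
have FgeS t x : phi t x + Lam * (\sum_j `|eta x 0 j|) <= F x.
  have [s <-] := dotv_sign_row (eta x) (ltW L0).
  exact: (@penalized_ge _ _ _ _ phi eta Lam I q0 x (t, s)).
have S0 x : 0 <= \sum_j `|eta x 0 j| by apply: sumr_ge0.
have F0 x : 0 <= F x.
  apply: le_trans (FgeS t0 x); by rewrite p0 add0r mulr_ge0 ?S0 ?(ltW L0).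
have Fb : F xbar = 0.
  apply/eqP; rewrite eq_le F0 andbT /F.
  have [q _ ->] := penalized_at phi eta Lam xbar (inI _ : q0.1 \in I).
  by rewrite piece_eta0.
have FZ y : F y = 0 -> (forall t, phi t y <= 0) /\ eta y = 0.
  move=> Fy.
  have e0 : eta y = 0.
    apply/rowP => j; rewrite mxE; apply/eqP; rewrite -normr_eq0 eq_le normr_ge0 andbT.
    have := FgeS t0 y; rewrite Fy p0 add0r pmulr_rle0// => /(le_trans _); apply.
    by rewrite (bigD1 j)//= lerDl sumr_ge0.
  split=> // t; have := FgeS t y; rewrite Fy; apply: le_trans.
  by rewrite lerDl mulr_ge0 ?S0 ?(ltW L0).
have FU x : F x <= \sum_t Num.max 0 (phi t x) + k%:R * Lam * `|eta x|.
  rewrite /F; have [q _ ->] := penalized_at phi eta Lam x (inI _ : q0.1 \in I).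
  apply: lerD.
    rewrite (bigD1 q.1)//=; apply: (@le_trans _ _ (Num.max 0 (phi q.1 x))).
      by rewrite le_max lexx orbT.
    by rewrite lerDl sumr_ge0// => t _; rewrite le_max lexx.
  apply: le_trans (ler_norm _) _; apply: le_trans (dotv_le _ _) _.
  rewrite -mulrA ler_wpM2l// ler_wpM2r//; exact: norm_sign_row (ltW L0).
have [L LF0 Llip] := subdiff_on_lipschitz (subdiff_on_penalized Lam gs (inI _ : q0.1 \in I)).
pose del' : R := Num.min del 1 / 2.
have d0 : 0 < del' by rewrite divr_gt0// lt_min ltr01 (gs_del gs).
have xnb x : 0 < F x -> x <> xbar by move=> Fx xb; rewrite xb Fb ltxx in Fx.
have slope x : `|x - xbar| < rho -> 0 < F x -> local_min F x \/ descent_point F del' x.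
  by move=> xr Fx; exact: (gap_slope gs xr (xnb _ Fx)).
have [r1 r10 nmin] := no_local_min_of_descent rho0 LF0 d0 Llip Fb slope.
pose r2 := Num.min rho r1.
have r20 : 0 < r2 by rewrite lt_min rho0.
have lt2 x : `|x - xbar| < r2 -> `|x - xbar| < rho /\ `|x - xbar| < r1.
  by rewrite lt_min => /andP.
have Llip2 : lipschitz_ball F xbar r2 L.
  by move=> x y /lt2[h1 _] /lt2[h2 _]; exact: Llip.
have [|r3 r30 EB] := error_bound_of_descent r20 LF0 d0 Llip2 F0 Fb.
  move=> x /lt2[h1 h2] Fx; have [h|//] := slope x h1 Fx.
  by case: (nmin x h2 Fx).
have k0 : 0 <= k%:R * Lam by rewrite mulr_ge0// ltW.
have L0' : 0 <= L by exact: ltW.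
have d2 : 0 <= 2 / del' by apply: divr_ge0 => //; exact: ltW.
pose r4 := Num.min rho r3.
exists (2 / del' * (1 + k%:R * Lam + L)), r4; split.
- by apply: mulr_ge0 => //; apply: addr_ge0 => //; exact: addr_ge0.
- by rewrite lt_min rho0.
move=> x; rewrite lt_min => /andP[xr0 xr]; have [y [Fy xy]] := EB x xr.
have [h1 h2] := FZ _ Fy; exists y; split=> //; apply: le_trans xy _;
  rewrite -[leRHS]mulrA; apply: ler_wpM2l => //.
  apply: le_trans (FU x) _.
  have s0 : 0 <= \sum_t Num.max 0 (phi t x).
    by apply: sumr_ge0 => t _; rewrite le_max lexx.
  rewrite mulrDr; apply: lerD.
    by rewrite ler_peMl// -addrA lerDl addr_ge0.
  by rewrite ler_wpM2r// addrAC lerDr addr_ge0.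
have xb : `|xbar - xbar| < rho by rewrite subrr normr0.
have := Llip _ _ xr0 xb; rewrite -/F Fb subr0 => /(le_trans (ler_norm _))/le_trans; apply.
by rewrite ler_wpM2r// lerDr addr_ge0.
Qed.

End gap_error_bound.

(** * Generators of cones *)

Section families.
Context {R : realType} {V : vectType R} {I : eqType}.
Implicit Types (F : I -> V) (X : seq I) (c : I -> R).

Lemma span_mapP F X v : uniq X ->
  reflect (exists c, v = \sum_(i <- X) c i *: F i) (v \in <<map F X>>%VS).
Proof.
move=> uX; apply: (iffP idP) => [|[c ->]]; last first.
  rewrite big_seq; apply: rpred_sum => i iX; apply/rpredZ/memv_span.
  exact: map_f.
elim: X v uX => [|x X IH] v /=.
  by rewrite span_nil memv0 => _ /eqP ->; exists (fun=> 0); rewrite big_nil.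
move=> /andP[xX uX]; rewrite span_cons => /memv_addP[_ /vlineP[t ->] [w wX ->]].
have [c ->] := IH w uX wX.
exists (fun i => if i == x then t else c i); rewrite big_cons eqxx; congr (_ + _).
by apply: eq_big_seq => i iX; case: eqP => // ix; rewrite -ix iX in xX.
Qed.

Lemma free_mapP F X : uniq X ->
  reflect (forall c, \sum_(i <- X) c i *: F i = 0 -> forall i, i \in X -> c i = 0)
    (free (map F X)).
Proof.
elim: X => [|x X IH] /=; first by move=> _; rewrite nil_free; apply: ReflectT.
move=> /andP[xX uX]; rewrite free_cons; apply: (iffP andP).
  move=> [FxX fX] c; rewrite big_cons => rel.
  have cx : c x = 0.
    apply: contraNeq FxX => cx; apply/span_mapP => //.
    exists (fun i => - (c x)^-1 * c i).
    under eq_bigr do rewrite -scalerA; rewrite -scaler_sumr.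
    move: rel => /eqP; rewrite addrC addr_eq0 => /eqP ->.
    by rewrite scalerN scaleNr opprK scalerA mulVf ?scale1r.
  move=> i; rewrite inE => /orP[/eqP -> //|iX].
  by apply: (IH uX fX) iX; move: rel; rewrite cx scale0r add0r.
move=> H; split.
  apply/negP => /(span_mapP F _ uX)[c Fx].
  have := H (fun i => if i == x then -1 else c i) _ x.
  rewrite big_cons eqxx inE eqxx => /(_ _ isT) => /(_ _)/eqP; rewrite oppr_eq0 oner_eq0 => h.
  apply: notF; apply: h; rewrite scaleN1r Fx addrC; apply/eqP; rewrite subr_eq0; apply/eqP.
  by apply: eq_big_seq => i iX; case: eqP => // ix; rewrite -ix iX in xX.
apply/(IH uX) => c rel i iX.
have := H (fun i => if i == x then 0 else c i) _ i.
rewrite big_cons eqxx scale0r add0r inE iX orbT.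
have -> : \sum_(j <- X) (if j == x then 0 else c j) *: F j = \sum_(j <- X) c j *: F j.
  by apply: eq_big_seq => j jX; case: eqP => // jx; rewrite -jx jX in xX.
by move=> /(_ rel isT); case: eqP => // ix; rewrite -ix iX in xX.
Qed.

Lemma free_subseq F X : exists2 Y, subseq Y X &
  free (map F Y) /\ <<map F Y>>%VS = <<map F X>>%VS.
Proof.
elim: X => [|x X [Y YX [fY YE]]]; first by exists [::]; rewrite //= nil_free.
have [FxY|FxY] := boolP (F x \in <<map F Y>>%VS).
  exists Y; first by apply: subseq_trans YX _; exact: subseq_cons.
  split=> //=; rewrite span_cons -YE; apply/esym/addv_idPr.
  by rewrite -memvE.
exists (x :: Y); first by rewrite /= eqxx.
by split; rewrite /= ?free_cons ?FxY// !span_cons YE.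
Qed.

End families.

Section generated_cones.
Context {R : realType} {p : nat}.
Implicit Types (AI AE : {fset 'rV[R]_p}) (S : set 'rV[R]_p) (a y : 'rV[R]_p).

Lemma gcone0 AI AE : gcone AI AE 0.
Proof.
exists 0; last by exists 0; rewrite ?addr0//= mem0v.
by exists (fun=> 0) => //; rewrite big1// => a _; rewrite scale0r.
Qed.

Lemma gconeD AI AE x y : gcone AI AE x -> gcone AI AE y -> gcone AI AE (x + y).
Proof.
move=> [u1 [c1 c10 ->] [w1 /= w1E <-]] [u2 [c2 c20 ->] [w2 /= w2E <-]].
exists (\sum_(a <- AI) (c1 a + c2 a) *: a); first by exists (fun a => c1 a + c2 a) => // a; exact: addr_ge0.
exists (w1 + w2); first exact: memvD.
by rewrite addrACA; congr (_ + _); rewrite -big_split; apply: eq_bigr => a _; rewrite scalerDl.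
Qed.

Lemma gcone_sum AI AE (J : Type) (r : seq J) (P : pred J) (f : J -> 'rV[R]_p) :
  (forall j, P j -> gcone AI AE (f j)) -> gcone AI AE (\sum_(j <- r | P j) f j).
Proof. by move=> H; elim/big_ind: _ => //; [exact: gcone0|exact: gconeD]. Qed.

Lemma gconeZI AI AE a (t : R) : a \in AI -> 0 <= t -> gcone AI AE (t *: a).
Proof.
move=> aA t0; exists (t *: a); last by exists 0; rewrite ?addr0//= mem0v.
exists (fun b => if b == a then t else 0) => [b|]; first by case: ifP.
rewrite (big_rem a)//= eqxx big_seq big1 ?addr0// => b.
by rewrite mem_rem_uniq ?fset_uniq// inE => /andP[/negbTE -> _]; rewrite scale0r.
Qed.

Lemma gcone_span AI AE y : y \in <<AE>>%VS -> gcone AI AE y.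
Proof.
move=> yE; exists 0; last by exists y; rewrite ?add0r.
by exists (fun=> 0) => //; rewrite big1// => a _; rewrite scale0r.
Qed.

Lemma gconeZE AI AE a (t : R) : a \in AE -> gcone AI AE (t *: a).
Proof. by move=> aE; apply/gcone_span/memvZ/memv_span. Qed.

Lemma sub_gcone AI AE S : S 0 -> (forall x y, S x -> S y -> S (x + y)) ->
  (forall a (t : R), a \in AI -> 0 <= t -> S (t *: a)) ->
  (forall w, w \in <<AE>>%VS -> S w) -> gcone AI AE `<=` S.
Proof.
move=> S0 SD SI SE _ [_ [c c0 ->] [w wE <-]]; apply: (SD); last exact: SE.
rewrite big_seq; apply: big_ind => // a aA; exact: SI.
Qed.

Lemma gcone_subset AI AE AI' AE' : {subset AI' <= AI} -> {subset AE' <= AE} ->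
  gcone AI' AE' `<=` gcone AI AE.
Proof.
move=> sI sE; apply: sub_gcone; [exact: gcone0|exact: gconeD|..].
  by move=> a t /sI aI t0; exact: gconeZI.
move=> w wE; apply: gcone_span; apply: subvP wE; exact: sub_span.
Qed.

(* A nonnegative relation would make the generators involved two-sided, and a
   basis of the enlarged lineality space would give a smaller generator. *)
Lemma generator_no_relation (N : set 'rV[R]_p) AI AE (c : 'rV[R]_p -> R) :
  is_generator N (AI, AE) -> (forall a, a \notin AE -> 0 <= c a) -> c 0 = 0 ->
  \sum_(a <- (AI `|` AE)%fset) c a *: a = 0 ->
  forall a, a \in (AI `|` AE)%fset -> c a = 0.
Proof.
move=> [[/= dIE fE NE] N0 min] c0 c00 rel a aA; apply/eqP; apply: contraT => ca.
(* The trivial cone has the conventional generator {0}, which is itself dependent; the condition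
   [c 0 = 0] disposes of this case. *)
have Nn0 : N <> [set 0].
  by move=> /N0 /= AE0; move: aA ca; rewrite AE0 inE => /eqP ->; rewrite c00 eqxx.
pose P := [fset a in AI | (a \notin AE) && (0 < c a)]%fset.
have cP b : b \in (AI `|` AE)%fset -> c b != 0 -> (b \in P) || (b \in AE).
  move=> bA cb; have [//|bE] := boolP (b \in AE); first by rewrite orbT.
  rewrite orbF !inE bE /= lt_def cb c0// andbT.
  by move: bA; rewrite !inE (negbTE bE) orbF andbT.
have Psub : {subset (P `|` AE)%fset <= (AI `|` AE)%fset}.
  by move=> b; rewrite !inE => /orP[/andP[-> //]|-> ]; rewrite orbT.
have nfree : ~~ free (P `|` AE)%fset.
  apply/negP; have := fset_uniq (P `|` AE)%fset => uPA.
  move=> fPA; have := free_mapP id uPA; rewrite map_id => rfl.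
  have H := elimT rfl fPA c.
  have aPA : a \in (P `|` AE)%fset by rewrite in_fsetU; exact: cP.
  move: ca; rewrite (H _ _ aPA) ?eqxx//.
  rewrite -[RHS]rel; apply: big_fset_incl => //.
    by apply/fsubsetP.
  move=> b bA; apply: contraNeq => h; rewrite in_fsetU; apply: cP => //.
  by apply: contraNneq h => ->; rewrite scale0r.
(* The relation writes [- (c b *: b)] as an element of the cone, so each [b] in [P] spans a line
   inside the cone. *)
have Pneg b : b \in (P `|` AE)%fset -> forall t : R, N (t *: b).
  rewrite inE => /orP[bP t|bE t]; last by rewrite NE; exact: gconeZE.
  have bI : b \in AI by move: bP; rewrite !inE => /andP[].
  have cb : 0 < c b by move: bP; rewrite !inE => /andP[_ /andP[]].
  have [t0|t0] := leP 0 t; first by rewrite NE; exact: gconeZI.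
  have -> : t *: b = (- t / c b) *: (- (c b *: b)).
    by rewrite scalerN -scaleNr scalerA; congr (_ *: _); field; rewrite gt_eqF.
  have -> : - (c b *: b) = \sum_(a <- (AI `|` AE)%fset | a != b) c a *: a.
    apply/eqP; rewrite eq_sym -addr_eq0 addrC.
    by rewrite -[X in _ == X]rel (bigD1_seq b) ?fset_uniq// in_fsetU bI.
  rewrite scaler_sumr NE big_seq_cond; apply: gcone_sum => e /andP[eA _].
  rewrite scalerA; have [eE|eE] := boolP (e \in AE); first exact: gconeZE.
  apply: gconeZI; first by move: eA; rewrite inE (negbTE eE) orbF.
  by rewrite mulr_ge0 ?c0// divr_ge0 ?oppr_ge0// ltW.
have ND x y : N x -> N y -> N (x + y) by rewrite NE; exact: gconeD.
pose Q := (P `|` AE)%fset; pose A := (AI `|` AE)%fset.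
(* As [Q] is dependent, a free part [Y] with the same span is strictly smaller; [Y] as two-sided
   part and the rest of [A] as conic part then beat the minimal generator. *)
have [Y YQ [fY YE]] := free_subseq id (enum_fset Q).
move: fY YE; rewrite !map_id => fY YE.
pose AE' := [fset y in Y]%fset; pose AI' := (A `\` Q)%fset.
have uY : uniq Y by exact: free_uniq.
have AE'Y : perm_eq AE' Y.
  by apply: uniq_perm; rewrite ?fset_uniq// => y; rewrite !inE.
have Ysub b : b \in Y -> b \in Q by exact: (mem_subseq YQ).
have QA : (Q `<=` A)%fset by apply/fsubsetP.
have cardY : (size Y < #|` Q|)%N.
  rewrite ltn_neqAle size_subseq// andbT; apply: contra nfree => h.
  have := size_subseq_leqif YQ; rewrite /leqif => -[_]; rewrite h => /esym/eqP YE'.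
  by rewrite -/Q -YE'.
have := min Nn0 (AI', AE'); rewrite leqNgt => /(_ _)/negP h.
apply: (False_ind _ (h _ _)).
  split => /=.
  - apply/fdisjointP => b; rewrite inE => /andP[bQ _].
    by apply: contra bQ; rewrite (perm_mem AE'Y); exact: Ysub.
  - by rewrite (perm_free AE'Y).
  - have spanE : <<AE'>>%VS = <<Q>>%VS.
      by rewrite -YE; apply: eq_span; exact: perm_mem.
    apply/seteqP; split; last first.
      apply: sub_gcone => //; first by rewrite NE; exact: gcone0.
        move=> b t; rewrite inE => /andP[bQ bA] t0; rewrite NE; apply: gconeZI => //.
        move: bA bQ; rewrite /A /Q !inE => /orP[//|->]; by rewrite orbT.
      move=> w; rewrite spanE; rewrite -{1}(map_id Q).
      move=> /(span_mapP id _ (fset_uniq Q))[e ->].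
      rewrite big_seq; elim/big_ind: _ => [|//|b bQ]; last exact: Pneg.
      by rewrite NE; exact: gcone0.
    rewrite NE; apply: sub_gcone; [exact: gcone0|exact: gconeD|..].
      move=> b t bI t0; have [bQ|bQ] := boolP (b \in Q).
        by apply: gcone_span; rewrite spanE memvZ// memv_span.
      by apply: gconeZI => //; rewrite inE bQ inE bI.
    move=> w wE; apply: gcone_span; rewrite spanE.
    apply: subvP wE; apply: sub_span => b bE; by rewrite inE bE orbT.
apply: leq_ltn_trans (leq_card_fsetU _ _) _.
rewrite (perm_size AE'Y) cardfsDS//.
by rewrite -[X in (_ < X)%N](subnK (fsubset_leq_card QA)) ltn_add2l.
Qed.

End generated_cones.

(** * Normal cones of polyhedra *)

Section polyhedral_cones.
Context {R : realType} {p : nat}.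
Local Notation V := 'rV[R]_p.
Implicit Types (A W : seq V) (a v w y z : V) (C : set V).

Fixpoint in_cone A v : Prop :=
  if A is a :: A' then exists2 t : R, 0 <= t & in_cone A' (v - t *: a) else v = 0.

Lemma in_cone0 A : in_cone A 0.
Proof. by elim: A => // a A IH /=; exists 0; rewrite // scale0r subrr. Qed.

Lemma in_cone_mem A a : a \in A -> in_cone A a.
Proof.
elim: A => // b A IH; rewrite inE => /orP[/eqP <-|/IH aA] /=.
  by exists 1; rewrite // scale1r subrr; exact: in_cone0.
by exists 0; rewrite // scale0r subr0.
Qed.

Lemma in_cone_polar A v w : in_cone A v -> (forall a, a \in A -> dotv a w <= 0) ->
  dotv v w <= 0.
Proof.
elim: A v => [|a A IH] v /=; first by move=> -> _; rewrite dotv0l.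
move=> [t t0 vA] Aw; rewrite -[v](subrK (t *: a)) dotvDl dotvZl.
rewrite -[leRHS](addr0 0); apply: lerD.
  by apply: IH vA _ => b bA; apply: Aw; rewrite inE bA orbT.
by rewrite mulr_ge0_le0// Aw// mem_head.
Qed.

(* Fourier-Motzkin elimination of the coefficient of each generator in turn. *)
Lemma weyl A : exists W, forall v,
  in_cone A v <-> forall w, w \in W -> dotv v w <= 0.
Proof.
elim: A => [|a A [W WP]].
  have dotd v i : dotv v (delta_mx 0 i) = v 0 i.
    rewrite /dotv (bigD1 i)//= mxE !eqxx mulr1 big1 ?addr0// => j /negbTE ji.
    by rewrite mxE ji andbF mulr0.
  exists ([seq delta_mx 0 i | i <- enum 'I_p] ++ [seq - delta_mx 0 i | i <- enum 'I_p]) => v /=.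
  split=> [-> w _|H]; first by rewrite dotv0l.
  apply/rowP => i; rewrite mxE; apply/eqP; rewrite eq_le; apply/andP; split.
    by rewrite -dotd; apply: H; rewrite mem_cat map_f// mem_enum.
  rewrite -oppr_le0 -dotd -dotvNr; apply: H; rewrite mem_cat; apply/orP; right.
  by apply/mapP; exists i; rewrite ?mem_enum.
pose W1 := [seq w <- W | 0 < dotv a w]; pose W2 := [seq w <- W | dotv a w < 0].
exists ([seq w <- W | dotv a w <= 0] ++
  [seq dotv a w1 *: w2 - dotv a w2 *: w1 | w1 <- W1, w2 <- W2]) => v /=.
split=> [[t t0 /WP vW] w|H].
  have vt u : u \in W -> dotv v u <= t * dotv a u.
    by move=> /vW; rewrite dotvBl dotvZl subr_le0.
  rewrite mem_cat => /orP[|/allpairsP[[w1 w2] /= []]].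
    rewrite mem_filter => /andP[aw wW]; apply: le_trans (vt _ wW) _.
    by rewrite mulr_ge0_le0.
  rewrite !mem_filter => /andP[aw1 w1W] /andP[aw2 w2W] ->.
  rewrite dotvBr !dotvZr.
  have := vt _ w1W; have := vt _ w2W; move: aw1 aw2.
  move: (dotv a w1) (dotv a w2) (dotv v w1) (dotv v w2) => x1 x2 u1 u2.
  clear; nra.
pose t : R := \big[Num.max/0]_(w <- W1) (dotv v w / dotv a w).
have t0 : 0 <= t by exact: bigmax_ge_id.
exists t => //; apply/WP => w wW; rewrite dotvBl dotvZl subr_le0.
have [aw|aw] := ltP 0 (dotv a w).
  rewrite -ler_pdivrMr//; apply: (Order.TotalTheory.le_bigmax_seq 0 w xpredT (fun w => dotv v w / dotv a w)) => //.
  by rewrite mem_filter aw.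
have vw : dotv v w <= 0 by apply: H; rewrite mem_cat mem_filter aw wW.
have [aw0|awn] := eqVneq (dotv a w) 0; first by rewrite aw0 mulr0.
have aw2 : dotv a w < 0 by rewrite lt_neqAle awn.
rewrite -ler_ndivlMr//; rewrite /t big_seq; apply: bigmax_le => [|w1].
  by rewrite ler_ndivlMr// mul0r.
rewrite mem_filter => /andP[aw1 w1W].
rewrite ler_pdivrMr// mulrAC ler_ndivlMr// -subr_ge0 -oppr_le0 opprB.
have := H (dotv a w1 *: w - dotv a w *: w1).
rewrite dotvBr !dotvZr mem_cat => h.
have : dotv a w1 * dotv v w - dotv a w * dotv v w1 <= 0.
  apply: h; apply/orP; right; apply/allpairsP; exists (w1, w).
  by rewrite !mem_filter aw1 w1W aw2 wW.
by clear; lra.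
Qed.

(** This is the bipolar of [A]: the polar of the cone of directions [w] with [dotv a w <= 0] for all
    [a] in [A]. For active constraint normals that cone is the tangent cone, so normal cones take
    this form directly. *)
Definition polar A : set V :=
  fun v => forall w, (forall a, a \in A -> dotv a w <= 0) -> dotv v w <= 0.

Lemma polyhedral_cone_polar A : polyhedral_cone (polar A).
Proof.
have [W WP] := weyl A.
have PE v : polar A v <-> forall w, w \in W -> dotv v w <= 0.
  split=> [vA w wW|/WP vA w Aw]; last exact: in_cone_polar vA Aw.
  by apply: vA => a aA; apply: (proj1 (WP a)) => //; exact: in_cone_mem.
split.
- exists (size W), (fun i => nth 0 W i), (fun=> 0).
  apply/seteqP; split=> v /=.
    by move=> /PE H i; rewrite dotvC; apply: H; exact: mem_nth.
  move=> H; apply/PE => w /(nthP 0)[i iW <-].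
  by rewrite dotvC; exact: (H (Ordinal iW)).
- by move=> w _; rewrite dotv0l.
- by move=> t v t0 Av w Aw; rewrite dotvZl mulr_ge0_le0// Av.
Qed.

(** [A] collects the normals of the constraints active at [y]; the inactive ones keep their slack on
    a small ball, so near [y] the polyhedron is a translate of its tangent cone. In [sl], the value
    1 for active constraints is a dummy radius. *)
Lemma polyhedral_local C y : polyhedral C -> C y -> exists A,
  [/\ regular_normal C y = polar A, forall a z, a \in A -> C z -> dotv a (z - y) <= 0 &
   exists2 r : R, 0 < r & forall z, `|z - y| < r ->
     (forall a, a \in A -> dotv a (z - y) <= 0) -> C z].
Proof.
move=> [k [a [b CE]]]; rewrite CE /= => Cy.
pose sl i : R := if dotv (a i) y == b i then 1 else
  (b i - dotv (a i) y) / (p%:R * `|a i| + 1).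
have K0 i : 0 < p%:R * `|a i| + 1 by rewrite ltr_wpDl// mulr_ge0.
have sl0 i : 0 < sl i.
  rewrite /sl; case: eqP => // /eqP h; rewrite divr_gt0// subr_gt0 lt_neqAle h; exact: Cy.
have [r r0 rP] := finite_pos_lb sl0.
pose A := [seq a i | i <- enum 'I_k & dotv (a i) y == b i].
have loc z : `|z - y| < r -> (forall c, c \in A -> dotv c (z - y) <= 0) ->
    forall i, dotv (a i) z <= b i.
  move=> zr Az i; rewrite -[z](subrK y) dotvDr.
  have [ai|ai] := boolP (dotv (a i) y == b i).
    rewrite (eqP ai) gerDr; apply: Az; apply/mapP; exists i => //.
    by rewrite mem_filter ai mem_enum.
  rewrite -lerBrDr; apply: le_trans (ler_norm _) _; apply: le_trans (dotv_le _ _) _.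
  have := rP i; rewrite /sl (negbTE ai) ler_pdivlMr// => h; apply: le_trans h.
  rewrite mulrA [leRHS]mulrC; by apply: ler_pM; rewrite ?mulr_ge0 ?lerDl ?(ltW zr).
exists A; split; last by exists r.
  apply/seteqP; split=> v /=; last first.
    move=> Av; split=> [//|e e0]; near=> z => Cz.
    apply: (@le_trans _ _ 0); last by rewrite mulr_ge0// ltW.
    apply: Av => c /mapP[i]; rewrite mem_filter => /andP[/eqP ai _] ->.
    by rewrite dotvBr ai subr_le0.
  move=> [_ vN] w Aw; apply/ler_addgt0Pl => e e0; rewrite addr0.
  have e1 : 0 < e / (`|w| + 1) by rewrite divr_gt0// ltr_wpDl.
  have [r1 r10 H] := iffLR (near_distP y (fun z => (forall i, dotv (a i) z <= b i) ->
    dotv v (z - y) <= e / (`|w| + 1) * `|z - y|)) (vN _ e1).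
  have w1 : 0 < `|w| + 1 by rewrite ltr_wpDl.
  pose t : R := Num.min r r1 / 2 / (`|w| + 1).
  have m0 : 0 < Num.min r r1 by rewrite lt_min r0.
  have t0 : 0 < t by rewrite divr_gt0// divr_gt0.
  have tw : `|y + t *: w - y| < Num.min r r1.
    rewrite addrC addKr normrZ (gtr0_norm t0).
    apply: (@le_lt_trans _ _ (t * (`|w| + 1))); first by rewrite ler_wpM2l ?lerDl// ltW.
    by rewrite /t divfK ?gt_eqF//; move: m0; clear; lra.
  move: tw; rewrite lt_min => /andP[tw tw1].
  have feas c : c \in A -> dotv c (y + t *: w - y) <= 0.
    by move=> /Aw cw; rewrite addrAC subrr add0r dotvZr mulr_ge0_le0// ltW.
  have := H _ tw1 (loc _ tw feas); rewrite addrAC subrr add0r dotvZr normrZ.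
  rewrite (gtr0_norm t0) mulrCA ler_pM2l// => /le_trans; apply.
  by rewrite mulrAC ler_pdivrMr// ler_wpM2l ?lerDl// ltW.
move=> c z /mapP[i]; rewrite mem_filter => /andP[/eqP ai _] -> Cz.
by rewrite dotvBr ai subr_le0.
Unshelve. all: end_near.
Qed.

Lemma regular_limiting_normal C y : regular_normal C y `<=` limiting_normal C y.
Proof.
move=> v vN; exists (fun=> y), (fun=> v); split; [exact: cvg_cst|by []|exact: cvg_cst].
Qed.

End polyhedral_cones.

(** * Smooth maps as first-order data on a ball *)

Section smooth_maps.
Context {R : realType} {d m : nat}.
Local Notation E := 'rV[R]_d.
Implicit Types (f : E -> 'rV[R]_m) (x y xbar : E) (mu : 'rV[R]_m).

Lemma nabla_diff f x : differentiable f x -> forall e : R, 0 < e ->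
  exists2 r : R, 0 < r & forall y, `|y - x| < r ->
    `|f y - f x - (y - x) *m (nabla f x)^T| <= e * `|y - x|.
Proof.
move=> /diff_locally/eqaddoP H e e0.
have [r r0 Hr] := iffLR (near_distP (0 : E) (fun h => `|(f \o shift x - (cst (f x) + 'd f x)) h| <= e * `|h|)) (H e e0).
exists r => // y yr; have := Hr (y - x); rewrite subr0 => /(_ yr).
rewrite trmxK mul_rV_lin1 -![(_ + _ : _ -> _) _]/(_ + _) -![(- _ : _ -> _) _]/(- _) /=.
by rewrite subrK opprD addrA.
Qed.

Lemma smooth_c1_ball f xbar (rho M : R) mu : smooth f ->
  (forall x, `|x - xbar| < rho -> `|nabla f x| <= M) ->
  c1_ball xbar rho (fun x => dotv mu (f x)) (fun x => mu *m nabla f x).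
Proof.
move=> [df cf] fM; split.
- move=> x _ e e0.
  have K0 : 0 < m%:R * `|mu| + 1 by rewrite ltr_wpDl// mulr_ge0.
  have [r r0 Hr] := nabla_diff (df x) (divr_gt0 e0 K0).
  exists r => // y /Hr h; rewrite dotv_mulmx -!dotvBr.
  apply: le_trans (dotv_le _ _) _; rewrite mulrA.
  apply: (@le_trans _ _ ((m%:R * `|mu| + 1) * (e / (m%:R * `|mu| + 1) * `|y - x|))).
    by apply: ler_pM => //; rewrite ?mulr_ge0// lerDl.
  by rewrite mulrA [X in X * _]mulrC divfK ?gt_eqF.
- move=> x _; apply/(@cvgrPdist_lt _ _ _ (nbhs x)) => e e0.
  have K0 : 0 < m%:R * `|mu| + 1 by rewrite ltr_wpDl// mulr_ge0.
  have /cvgrPdist_lt/(_ _ (divr_gt0 e0 K0)) := cf x.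
  apply: filterS => y h; rewrite -mulmxBr; apply: le_lt_trans (norm_mulmx_le _ _) _.
  rewrite mulrA; apply: (@le_lt_trans _ _ ((m%:R * `|mu| + 1) * `|nabla f x - nabla f y|)).
    by rewrite ler_wpM2r// lerDl.
  by rewrite mulrC -ltr_pdivlMr.
- exists (m%:R * (`|mu| * M)) => x /fM h; apply: le_trans (norm_mulmx_le _ _) _.
  by rewrite !ler_wpM2l.
Qed.

Lemma nabla_bounded f xbar : smooth f -> exists2 rho : R, 0 < rho & exists M : R,
  forall x, `|x - xbar| < rho -> `|nabla f x| <= M.
Proof.
move=> [_ /(_ xbar)/cvgrPdist_lt/(_ 1 ltr01) cf].
have [r r0 H] := iffLR (near_distP xbar (fun x => `|nabla f xbar - nabla f x| < 1)) cf.
exists r => //; exists (`|nabla f xbar| + 1) => x /H h.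
rewrite -[nabla f x](subrK (nabla f xbar)) addrC.
by apply: le_trans (ler_normD _ _) _; rewrite lerD2l distrC ltW.
Qed.

Lemma smooth_continuous f x : smooth f -> {for x, continuous f}.
Proof. by move=> [df _]; apply: differentiable_continuous. Qed.

End smooth_maps.

Section restriction.
Context {R : realType} {d : nat}.
Local Notation E := 'rV[R]_d.
Implicit Types (phi psi : E -> R) (D : E -> set E) (G : E -> E) (c x : E) (rho r : R).

Lemma c1_ball_le c rho r psi G : r <= rho -> c1_ball c rho psi G -> c1_ball c r psi G.
Proof.
move=> rr [h1 h2 [M h3]]; split.
- by move=> x xr; apply: h1; exact: lt_le_trans rr.
- by move=> x xr; apply: h2; exact: lt_le_trans rr.
- by exists M => x xr; apply: h3; exact: lt_le_trans rr.
Qed.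

Lemma subdiff_on_le c rho r phi D : r <= rho -> subdiff_on c rho phi D -> subdiff_on c r phi D.
Proof.
move=> rr [h1 h2 [M h3] h4 h5 h6 h7]; split.
- by move=> x xr; apply: h1; exact: lt_le_trans rr.
- by move=> x xr; apply: h2; exact: lt_le_trans rr.
- by exists M => x v xr; apply: h3; exact: lt_le_trans rr.
- by move=> xs vs x v xsr xr; apply: h4 => [k|]; exact: lt_le_trans rr.
- by move=> x v w t xr; apply: h5; exact: lt_le_trans rr.
- by move=> x v xr; apply: h6; exact: lt_le_trans rr.
- by move=> x w k xr; apply: h7; exact: lt_le_trans rr.
Qed.

Lemma subdiff_on_c1 c rho psi G : c1_ball c rho psi G -> subdiff_on c rho psi (fun x => [set G x]).
Proof.
move=> cG; have good0 : subdiff_on c rho (fun=> 0 : R) (fun=> [set 0]).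
  split.
  - by move=> x _; exact: (@cst_continuous E R 0).
  - by move=> x _; exists 0.
  - by exists 0 => x v _ ->; rewrite normr0.
  - move=> xs vs x v _ _ _ vv H; apply: (@seq_cvg_unique _ _ vs) => //.
    have -> : vs = fun=> 0 by apply/funext => k; exact: H.
    exact: cvg_cst.
  - by move=> x v w t _ -> -> _; rewrite subrr scaler0 addr0.
  - move=> x v _ ->; apply/regular_subdiffP => e e0; exists 1 => // y _.
    by rewrite dotv0l addr0 sub0r oppr_le0 mulr_ge0// ltW.
  - move=> x w k _ H e e0; exists 1 => // t /andP[t0 _].
    have := H 0 erefl; rewrite dotv0l => k0.
    by rewrite add0r mulr_ge0 ?(ltW t0)// addr_ge0// ltW.
have := subdiff_on_add_c1 good0 cG.
rewrite (_ : (fun x => 0 + psi x) = psi); last by apply/funext => x; rewrite add0r.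
rewrite (_ : (fun x => [set v + G x | v in [set 0]]) = fun x => [set G x])//.
by apply/funext => x; rewrite image_set1 add0r.
Qed.

Lemma c1_cst c rho : c1_ball c rho (fun=> 0 : R) (fun=> 0).
Proof.
split.
- move=> x _ e e0; exists 1 => // y _; rewrite dotv0l !subr0 normr0.
  by rewrite mulr_ge0// ltW.
- by move=> x _; exact: (@cst_continuous E E 0).
- by exists 0 => x _; rewrite normr0.
Qed.

Lemma c1_add_cst c rho psi G (b : R) : c1_ball c rho psi G ->
  c1_ball c rho (fun x => psi x + b) G.
Proof.
move=> [h1 h2 h3]; split=> // x xr e e0; have [r r0 H] := h1 x xr e e0.
by exists r => // y /H; rewrite opprD addrACA subrr addr0.
Qed.

End restriction.

Lemma locally_lipschitz_ball (R : realType) d n (g : 'rV[R]_d -> 'rV[R]_n) xbar :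
  locally_lipschitz g -> exists rho L : R, [/\ 0 < rho, 0 < L &
    forall i, lipschitz_ball (coordf g i) xbar rho L].
Proof.
move=> /(_ xbar)[U xU [M [Mr HM]]].
have [rho rho0 Urho] := iffLR (near_distP xbar U) xU.
pose L : R := `|M| + 1.
exists rho, L; split=> [//||i x y xr yr]; first by rewrite ltr_wpDl.
have ML : M < L by apply: le_lt_trans (ler_norm _) _; rewrite ltrDl.
have /= := HM L ML (x, y) (conj (Urho _ xr) (Urho _ yr)).
apply: le_trans; have := normrV_coord (g x - g y) i; by rewrite !mxE.
Qed.

(** * From RCPLD to the gap property *)

Lemma sum_delta2 (R : realType) (Q : finType) (V : lmodType R) (q1 q2 : Q) (f : Q -> V) :
  \sum_q ((q == q1)%:R + (q == q2)%:R : R) *: f q = f q1 + f q2.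
Proof. by under eq_bigr do rewrite scalerDl; rewrite big_split /= !sum_delta. Qed.

Section subsystem.
Context {R : realType} {d n m l p : nat} (g : 'rV[R]_d -> 'rV[R]_n)
  (h : 'rV[R]_d -> 'rV[R]_m) (Phi : 'I_l -> 'rV[R]_d -> 'rV[R]_p)
  (AI AE : 'I_l -> {fset 'rV[R]_p}) (J : {set 'I_m}) (xbar : 'rV[R]_d).
Local Notation E := 'rV[R]_d.
Implicit Types (x y : E) (b : bool) (i : 'I_l).

Definition all_gens : {fset 'rV[R]_p} :=
  [fset a in flatten [seq enum_fset (AI i `|` AE i)%fset | i <- enum 'I_l]]%fset.

Local Notation U := (fset_sub_type all_gens).
(* Indices of the inequalities: the zero function, the components of [g], the
   signed components of [h], the signed generators of the normal cones. *)
Local Notation T := (unit + ('I_n + ('I_m * bool + 'I_l * (U * bool))))%type.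
Local Notation tg i := (inr (inl i) : T).
Local Notation th q := (inr (inr (inl q)) : T).
Local Notation tP i q := (inr (inr (inr (i, q))) : T).

Lemma mem_gens i a : a \in (AI i `|` AE i)%fset -> a \in all_gens.
Proof.
move=> aA; rewrite !inE /=; apply/flattenP; exists (enum_fset (AI i `|` AE i)%fset) => //.
by apply/mapP; exists i; rewrite ?mem_enum.
Qed.

Definition signb b : R := (-1) ^+ b.
(** Generators of the linear part are used with both signs, those of the conic part only with sign
    +1, encoded by [false]. *)
Definition legit i (q : U * bool) :=
  (val q.1 \in AE i) || ((val q.1 \in AI i) && ~~ q.2).

(* The generators with [legit] false and the inactive [g_i] are padding. *)
Definition constraint (t : T) x : R :=
  match t with
  | inl _ => 0
  | inr (inl i) => if g xbar 0 i == 0 then coordf g i x else 0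
  | inr (inr (inl q)) => dotv (signb q.2 *: delta_mx 0 q.1) (h x)
  | inr (inr (inr (i, q))) =>
      if legit i q then dotv (signb q.2 *: val q.1) (Phi i x) -
        dotv (signb q.2 *: val q.1) (Phi i xbar) else 0
  end.

Definition constraint_subdiff (t : T) x : set E :=
  match t with
  | inl _ => [set 0]
  | inr (inl i) => if g xbar 0 i == 0 then regular_subdiff (coordf g i) x else [set 0]
  | inr (inr (inl q)) => [set (signb q.2 *: delta_mx 0 q.1) *m nabla h x]
  | inr (inr (inr (i, q))) =>
      if legit i q then [set (signb q.2 *: val q.1) *m nabla (Phi i) x] else [set 0]
  end.

Definition basis_sel : 'M[R]_(m, #|J|) := \matrix_(j, a) (j == enum_val a)%:R.
Definition basis_eq x := h x *m basis_sel.
Definition basis_grad x := basis_sel^T *m nabla h x.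

Lemma selTE (mu : 'rV[R]_(#|J|)) (j : 'I_m) : j \notin J -> (mu *m basis_sel^T) 0 j = 0.
Proof.
move=> jJ; rewrite mxE big1// => a _; rewrite !mxE; case: eqP => [ja|_]; last by rewrite mulr0.
by rewrite ja enum_valP in jJ.
Qed.

Lemma selK (c : 'rV[R]_m) : (forall j, j \notin J -> c 0 j = 0) -> c *m basis_sel *m basis_sel^T = c.
Proof.
move=> cJ; apply/rowP => j; have [jJ|jJ] := boolP (j \in J); last by rewrite selTE// cJ.
rewrite mxE (bigD1 (enum_rank_in jJ j))//= !mxE enum_rankK_in// eqxx mulr1.
rewrite [X in _ + X]big1 ?addr0 => [|a aj].
  rewrite (bigD1 j)//= mxE enum_rankK_in// eqxx mulr1 big1 ?addr0// => i ij.
  by rewrite mxE enum_rankK_in// (negbTE ij) mulr0.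
rewrite !mxE; case: (eqVneq j (enum_val a)) => [ja|_]; last by rewrite mulr0.
suff /eqP : a = enum_rank_in jJ j by rewrite (negbTE aj).
by apply: enum_val_inj; rewrite enum_rankK_in.
Qed.

Lemma basis_grad_selT (mu : 'rV[R]_(#|J|)) x :
  \sum_(j in J) (mu *m basis_sel^T) 0 j *: grad h j x = mu *m basis_grad x.
Proof.
rewrite /basis_grad mulmxA [RHS]mulmx_sum_row [RHS](bigID (mem J))/=.
by rewrite [X in _ = _ + X]big1 ?addr0// => j jJ; rewrite selTE// scale0r.
Qed.

Lemma basis_grad_row (c : 'rV[R]_m) x : (forall j, j \notin J -> c 0 j = 0) ->
  \sum_(j in J) c 0 j *: grad h j x = (c *m basis_sel) *m basis_grad x.
Proof. by move=> cJ; rewrite -basis_grad_selT selK. Qed.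

(* A sequence violating the gap property, with the limits [vst] and [lam0] of
   its subgradients and weights; no relation along the sequence is supported in
   the support of [lam0]. *)
Section limit_relation.
Context (xs : nat -> E) (vs : nat -> T -> E) (vst : T -> E) (lam0 : T -> R).
Context (subd_vs : forall k t, constraint_subdiff t (xs k) (vs k t))
  (subd_vst : forall t, constraint_subdiff t xbar (vst t))
  (grad_hmx : forall k j, exists nu, grad h j (xs k) = nu *m basis_grad (xs k))
  (indep : forall k c nu, (forall t, lam0 t = 0 -> c t = 0) ->
    \sum_t c t *: vs k t + nu *m basis_grad (xs k) = 0 -> forall t, c t = 0).

(** Independence tested on a single index. It clears the support of [lam0] of padding, of the zero
    function and, by constant rank, of all components of [h]; the same independence forbids both
    signs of one generator. What remains are the data RCPLD speaks about. *)
Lemma support_indep k t nu : lam0 t != 0 -> vs k t + nu *m basis_grad (xs k) <> 0.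
Proof.
move=> lt rel; have : (t == t)%:R = 0 :> R; last by rewrite eqxx => /eqP; rewrite oner_eq0.
apply: (indep (k := k) (c := fun s => (s == t)%:R) (nu := nu)).
  by move=> s ls; case: eqP => // st; rewrite -st ls eqxx in lt.
by rewrite sum_delta.
Qed.

Lemma support_vs k t : lam0 t != 0 -> vs k t != 0.
Proof.
move=> lt; apply/eqP => vt0; apply: (@support_indep k t 0 lt).
by rewrite vt0 mul0mx addr0.
Qed.

Lemma support_g (i : 'I_n) : lam0 (tg i) != 0 -> g xbar 0 i = 0.
Proof.
move=> /(support_vs 0) vt; apply/eqP; apply: contraNT vt => gi.
by have := subd_vs 0 (tg i); rewrite /= (negbTE gi) => ->.
Qed.

Lemma support_legit i q : lam0 (tP i q) != 0 -> legit i q /\ val q.1 != 0.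
Proof.
move=> lt; have vt := support_vs 0 lt; have := subd_vs 0 (tP i q).
rewrite /=; case: ifP => [li ve|_ ve]; last by rewrite ve eqxx in vt.
by split=> //; apply: contraNneq vt => a0; rewrite ve a0 scaler0 mul0mx.
Qed.

Lemma support_tt : lam0 (inl tt) = 0.
Proof.
apply/eqP; apply: contraT => /(support_vs 0).
by have /= -> := subd_vs 0 (inl tt); rewrite eqxx.
Qed.

Lemma support_h q : lam0 (th q) = 0.
Proof.
apply/eqP; apply: contraT => lt.
have [nu gE] := grad_hmx 0 q.1.
have vE : vs 0 (th q) = signb q.2 *: grad h q.1 (xs 0).
  by have := subd_vs 0 (th q); rewrite /= /grad rowE scalemxAl.
case: (@support_indep 0 (th q) (- signb q.2 *: nu) lt).
by rewrite vE gE -scalemxAl scaleNr addrN.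
Qed.

Lemma support_sign i a b : lam0 (tP i (a, b)) != 0 -> lam0 (tP i (a, ~~ b)) = 0.
Proof.
move=> lt1; apply/eqP; apply: contraT => lt2.
have [/= l1 _] := support_legit lt1; have [/= l2 _] := support_legit lt2.
have v1 := subd_vs 0 (tP i (a, b)); have v2 := subd_vs 0 (tP i (a, ~~ b)).
move: v1 v2; rewrite /= l1 l2 => v1 v2.
pose c (s : T) : R := (s == tP i (a, b))%:R + (s == tP i (a, ~~ b))%:R.
have : c (tP i (a, b)) = 0; last first.
  by move/eqP; rewrite /c eqxx gt_eqF// ltr_pwDl// ltr01.
apply: (indep (k := 0) (c := c) (nu := 0)).
  move=> s ls; rewrite /c (negbTE (_ : s != _)); last by apply: contraNneq lt1 => <-; rewrite ls.
  rewrite (negbTE (_ : s != _)) ?addr0//; by apply: contraNneq lt2 => <-; rewrite ls.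
rewrite mul0mx addr0 sum_delta2 v1 v2 -mulmxDl -scalerDl.
have -> : signb b + signb (~~ b) = 0 by rewrite /signb; case: (b); rewrite /= expr0 expr1 ?addNr ?addrN.
by rewrite scale0r mul0mx.
Qed.


Section minimal_support.
Context (N : 'I_l -> set 'rV[R]_p) (I0 : {set T}) (lam : T -> R) (mu : 'rV[R]_(#|J|)).
Context (genN : forall i, is_generator (N i) (AI i, AE i))
  (ind_bar : forall nu : 'rV[R]_(#|J|), nu *m basis_grad xbar = 0 -> nu = 0)
  (minI : minimal_relation (fun (t : T) (_ : E) => [set vst t]) basis_grad xbar I0)
  (rel : relation (fun (t : T) (_ : E) => [set vst t]) basis_grad xbar I0 lam vst mu)
  (I0s : forall t, t \in I0 -> lam0 t != 0).

Lemma I0_pos t : t \in I0 -> 0 < lam t.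
Proof. by case: minI => _; apply; exact: rel. Qed.

Lemma I0_out t : t \notin I0 -> lam t = 0.
Proof. by case: rel => _ _ + _ _; apply. Qed.

Lemma I0_ne : exists t, t \in I0.
Proof.
apply/set0Pn/eqP => I00; case: rel => _ l1 _ _ _; move: l1.
by rewrite big1 => [/eqP|t _]; rewrite ?I0_out ?I00 ?inE// eq_sym oner_eq0.
Qed.

(** Subtracting the multiple of [lam] that matches [c] at one index of [I0] leaves a relation
    vanishing there, hence everywhere. *)
Lemma relation_proportional c nu : (forall t, t \notin I0 -> c t = 0) ->
  \sum_t c t *: vst t + nu *m basis_grad xbar = 0 -> exists kap, forall t, c t = kap * lam t.
Proof.
move=> cI relc; have [t0 t0I] := I0_ne; pose kap := c t0 / lam t0.
have l0 := I0_pos t0I; case: (rel) => _ _ _ _ rel0.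
have [|||c0 _] := @minimal_relation_uniq R d _ _ _ _ _ _ _ _ _ (fun t => c t - kap * lam t)
  (nu - kap *: mu) t0 ind_bar minI rel _ _ t0I.
- by move=> t tI; rewrite cI// I0_out// mulr0 subrr.
- under eq_bigr do rewrite scalerBl -scalerA.
  rewrite sumrB -scaler_sumr mulmxBl -scalemxAl addrACA relc -opprD -scalerDr.
  by rewrite rel0 scaler0 subrr.
- by rewrite /kap divfK ?subrr// gt_eqF.
by exists kap => t; apply/eqP; rewrite -subr_eq0 c0.
Qed.

Definition genset i : {fset 'rV[R]_p} :=
  [fset val q.1 | q in [pred q : U * bool | tP i q \in I0]]%fset.

Lemma genset_inj i q1 q2 : tP i q1 \in I0 -> tP i q2 \in I0 ->
  val q1.1 = val q2.1 -> q1 = q2.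
Proof.
move=> h1 h2 /val_inj; case: q1 h1 => a1 b1 h1; case: q2 h2 => a2 b2 h2 /= e.
subst a2; congr (_, _); apply/eqP; apply: contraTT h2 => b12.
have -> : b2 = ~~ b1 by case: b1 b2 b12 {h1} => -[].
by apply/negP => /I0s; rewrite (support_sign (I0s h1)) eqxx.
Qed.

Lemma gensetP i a : reflect (exists2 q : U * bool, tP i q \in I0 & a = val q.1) (a \in genset i).
Proof. by apply: (iffP (imfsetP _ _ _ _)) => -[q]; exists q. Qed.

Lemma big_genset i (V : lmodType R) (f : 'rV[R]_p -> V) :
  \sum_(a <- genset i) f a = \sum_(q : U * bool | tP i q \in I0) f (val q.1).
Proof.
rewrite /genset big_imfset /=; last first.
  by move=> q1 q2 h1 h2; exact: (@genset_inj i q1 q2 h1 h2).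
by rewrite big_enum.
Qed.

Lemma genset_sub i a : a \in genset i -> a \in (AI i `|` AE i)%fset.
Proof.
move=> /gensetP[q /I0s/support_legit[+ _] ->]; rewrite in_fsetU.
by move=> /orP[->|/andP[-> _]]; rewrite ?orbT.
Qed.

Lemma vst_P i q : tP i q \in I0 -> vst (tP i q) = (signb q.2 *: val q.1) *m nabla (Phi i) xbar.
Proof.
move=> /I0s/support_legit[li _]; have := subd_vst (tP i q); by rewrite /= li.
Qed.

Lemma signb_sqr b : signb b * signb b = 1.
Proof. by rewrite /signb -expr2 sqrr_sign. Qed.

Lemma big_T (V : nmodType) (f : T -> V) : \sum_t f t = f (inl tt) + (\sum_i f (tg i) +
  (\sum_q f (th q) + \sum_i \sum_q f (tP i q))).
Proof.
rewrite !big_sumType /=; congr (_ + (_ + (_ + _))).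
  by rewrite (big_pred1 tt)// => -[].
by rewrite pair_bigA; apply: eq_bigr => -[].
Qed.

(** A dependence among the generators is carried by the Jacobian to a relation on [I0], hence is
    proportional to [lam]. A nonzero factor would give, after division, a dependence of the minimal
    generator of [N i] that is nonnegative off [AE i], which [generator_no_relation] forbids. *)
Lemma genset_free i : free (genset i).
Proof.
rewrite -(map_id (genset i : seq _)); apply/(free_mapP id (fset_uniq _)) => c relc.
pose ct (t : T) : R := if t \in I0 then
  (if t is inr (inr (inr (j, q))) then (if j == i then signb q.2 * c (val q.1) else 0) else 0) else 0.
have ctE q : tP i q \in I0 -> ct (tP i q) = signb q.2 * c (val q.1).
  by move=> qI; rewrite /ct qI eqxx.
have [||kap kapE] := @relation_proportional ct 0.
- by move=> t /negbTE tI; rewrite /ct tI.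
- have ct0 t : (forall q, t <> tP i q) -> ct t = 0.
    rewrite /ct; case: t => [u|[j|[q|[j q]]]] ti; case: ifP => // _.
    by case: (eqVneq j i) => // ji; case: (ti q); rewrite ji.
  rewrite mul0mx addr0 big_T ct0// scale0r add0r.
  rewrite big1 ?add0r => [|j _]; last by rewrite ct0 ?scale0r.
  rewrite big1 ?add0r => [|j _]; last by rewrite ct0 ?scale0r.
  rewrite (bigD1 i)//= [X in _ + X]big1 ?addr0 => [|j ji]; last first.
    by rewrite big1// => q _; rewrite ct0 ?scale0r// => q' [ji']; rewrite ji' eqxx in ji.
  rewrite (bigID (fun q => tP i q \in I0))/= [X in _ + X]big1 ?addr0 => [|q /negbTE qI]; last first.
    by rewrite /ct qI scale0r.
  rewrite -[RHS](mul0mx _ (nabla (Phi i) xbar)) -relc big_genset mulmx_suml.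
  apply: eq_bigr => q qI; rewrite ctE// vst_P// -!scalemxAl scalerA.
  by rewrite mulrAC signb_sqr mul1r.
have [k0|k0] := eqVneq kap 0.
  move=> a /gensetP[q qI ->]; have := ctE q qI; rewrite kapE k0 mul0r.
  by move/eqP; rewrite eq_sym mulf_eq0 signr_eq0 => /eqP.
pose e a := if a \in genset i then c a / kap else 0.
have eE q : tP i q \in I0 -> e (val q.1) = signb q.2 * lam (tP i q).
  move=> qI; rewrite /e (_ : _ \in _); last by apply/gensetP; exists q.
  have cE : c (val q.1) = signb q.2 * (kap * lam (tP i q)).
    by rewrite -kapE (ctE q qI) mulrA signb_sqr mul1r.
  by rewrite cE -mulrA [kap * _]mulrC mulfK.
have e0 := generator_no_relation (genN i) (c := e).
move=> a aG; have /gensetP[q qI aE] := aG.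
have : e a = 0.
  apply: e0; last exact: genset_sub.
  - move=> a1 a1E; have [/gensetP[q1 q1I a1q]|a1G] := boolP (a1 \in genset i); last by rewrite /e (negbTE a1G).
    have [] := support_legit (I0s q1I); rewrite /legit -a1q (negbTE a1E) /= => /andP[_ b1] _.
    by rewrite a1q eE// /signb (negbTE b1) expr0 mul1r ltW// I0_pos.
  - rewrite /e; case: ifP => // /gensetP[q1 q1I q10].
    by have [_] := support_legit (I0s q1I); rewrite -q10 eqxx.
  - rewrite -(big_fset_incl _ (A := genset i)) /=.
    + transitivity (kap^-1 *: \sum_(a <- genset i) c a *: a); last by rewrite relc scaler0.
      rewrite scaler_sumr; apply: eq_big_seq => a1 a1G.
      by rewrite /e a1G scalerA mulrC.
    + by apply/fsubsetP => a1; exact: genset_sub.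
    + by move=> a1 _ /negbTE a1G; rewrite /e a1G scale0r.
rewrite aE eE// => /eqP; rewrite mulf_eq0 signr_eq0 /= => /eqP lq.
by have := I0_pos qI; rewrite lq ltxx.
Qed.


(** The normal vector eta_i of RCPLD, reassembled from the weights of the signed generators. *)
Definition multiplier i : 'rV[R]_p := \sum_q lam (tP i q) *: (signb q.2 *: val q.1).

Lemma multiplierE i (V : lmodType R) (f : U * bool -> V) :
  \sum_q lam (tP i q) *: f q = \sum_(q | tP i q \in I0) lam (tP i q) *: f q.
Proof.
rewrite (bigID (fun q => tP i q \in I0))/= [X in _ + X]big1 ?addr0// => q qI.
by rewrite I0_out// scale0r.
Qed.

Lemma multiplier_gcone i : gcone (AI i `&` genset i)%fset (AE i `&` genset i)%fset (multiplier i).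
Proof.
rewrite /multiplier multiplierE; apply: gcone_sum => q qI; rewrite scalerA.
have qG : val q.1 \in genset i by apply/gensetP; exists q.
have [qE|qE] := boolP (val q.1 \in AE i); first by apply: gconeZE; rewrite in_fsetI qE.
have [] := support_legit (I0s qI); rewrite /legit (negbTE qE) /= => /andP[qAI qb] _.
apply: gconeZI; first by rewrite in_fsetI qAI.
by rewrite /signb (negbTE qb) expr0 mulr1 ltW// I0_pos.
Qed.

Lemma genset_split i : ((AI i `&` genset i) `|` (AE i `&` genset i))%fset = genset i.
Proof.
rewrite -fsetIUl; apply/fsetIidPr/fsubsetP => a; exact: genset_sub.
Qed.

(** Since [genset i] is free, a vanishing combination has zero coefficients, yet weights on [I0] are
    positive. This matches the clause of RCPLD that allots no generators to a zero eta_i. *)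
Lemma multiplier_eq0 i : multiplier i = 0 -> genset i = fset0.
Proof.
move=> m0; apply/fsetP => a; rewrite [RHS]in_fset0; apply/negP => aG.
pose e a : R := \sum_(q : U * bool | (tP i q \in I0) && (val q.1 == a)) lam (tP i q) * signb q.2.
have eE q : tP i q \in I0 -> e (val q.1) = lam (tP i q) * signb q.2.
  move=> qI; rewrite /e (big_pred1 q)// => q'; apply/andP/eqP => [[q'I /eqP qq]|->]; last by rewrite qI eqxx.
  exact: (@genset_inj i q' q q'I qI qq).
have := genset_free i; rewrite -(map_id (genset i : seq _)).
move=> /(free_mapP id (fset_uniq _))/(_ e) H.
have /H/(_ a aG) : \sum_(b <- genset i) e b *: b = 0.
  rewrite big_genset -[RHS]m0 /multiplier multiplierE; apply: eq_bigr => q qI.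
  by rewrite eE// scalerA.
have /gensetP[q qI ->] := aG; rewrite eE// => /eqP; rewrite mulf_eq0 signr_eq0 orbF.
by move=> /eqP lq; have := I0_pos qI; rewrite lq ltxx.
Qed.

Lemma relation_multiplier : 0 = \sum_i lam (tg i) *: vst (tg i) +
  \sum_(j in J) (mu *m basis_sel^T) 0 j *: grad h j xbar + \sum_i multiplier i *m nabla (Phi i) xbar.
Proof.
have [_ _ _ _ rel0] := rel.
have Z t : lam0 t = 0 -> lam t = 0.
  by move=> lt; apply: I0_out; apply/negP => /I0s; rewrite lt eqxx.
have -> : \sum_i multiplier i *m nabla (Phi i) xbar = \sum_i \sum_q lam (tP i q) *: vst (tP i q).
  apply: eq_bigr => i _; rewrite /multiplier mulmx_suml multiplierE.
  rewrite (bigID (fun q => tP i q \in I0)) /=.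
  rewrite [X in _ + X]big1 ?addr0 => [|q qI]; last by rewrite I0_out// scale0r mul0mx.
  by apply: eq_bigr => q qI; rewrite vst_P// scalemxAl.
rewrite basis_grad_selT -[LHS]rel0 big_T Z ?support_tt// scale0r add0r.
rewrite [X in _ + (X + _) + _]big1 => [|q _]; last by rewrite Z ?support_h// scale0r.
by rewrite add0r addrAC.
Qed.


Local Notation Z := (option ('I_n + ('I_m + 'I_l * 'rV[R]_p)))%type.

(** Forgets the sign of a generator; this is injective on [I0], where opposite signs exclude each
    other. [None] collects indices that cannot belong to [I0]. *)
Definition rcpld_index_of (t : T) : Z :=
  match t with
  | inr (inl i) => Some (inl i)
  | inr (inr (inr (i, q))) => Some (inr (inr (i, val q.1)))
  | _ => None
  end.

Definition rcpld_vector k (z : Z) : E :=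
  match z with
  | Some (inl i) => vs k (tg i)
  | Some (inr (inl j)) => grad h j (xs k)
  | Some (inr (inr (i, a))) => a *m nabla (Phi i) (xs k)
  | None => 0
  end.

Definition active_support : {set 'I_n} := finset (fun i : 'I_n => tg i \in I0).

Definition rcpld_index : seq Z := [seq Some (inl r) | r <- enum active_support] ++
  [seq Some (inr (inl j)) | j <- enum J] ++
  [seq Some (inr (inr (i, a))) | i <- enum 'I_l, a <- enum_fset (genset i)].

Lemma rcpld_familyE k : rcpld_family (p := fun=> p) h Phi active_support J
  (fun i => ((AI i `&` genset i) `|` (AE i `&` genset i))%fset) (xs k)
  (fun i : 'I_n => vs k (tg i)) = [seq rcpld_vector k z | z <- rcpld_index].
Proof.
rewrite /rcpld_family /rcpld_index !map_cat -!map_comp; congr (_ ++ (_ ++ _)).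
rewrite map_flatten -map_comp; congr flatten; apply: eq_map => i /=.
by rewrite genset_split -map_comp.
Qed.

Lemma rcpld_index_of_inj : {in I0 &, injective rcpld_index_of}.
Proof.
move=> t1 t2 h1 h2.
case: t1 h1 => [[]|[i1|[q1|[i1 q1]]]] h1; try by case/negP: (I0s h1); rewrite ?support_tt ?support_h.
  by case: t2 h2 => [[]|[i2|[q2|[i2 q2]]]] h2 //= [->].
case: t2 h2 => [[]|[i2|[q2|[i2 q2]]]] h2 //= [ii qq].
by subst i2; rewrite (@genset_inj i1 q1 q2 h1 h2 qq).
Qed.

Lemma rcpld_index_perm : perm_eq rcpld_index ([seq rcpld_index_of t | t <- enum I0] ++ [seq Some (inr (inl j)) | j <- enum J]).
Proof.
apply: uniq_perm.
- rewrite /rcpld_index !cat_uniq; apply/and3P; split.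
  + by rewrite map_inj_uniq ?enum_uniq// => i1 i2 [].
  + apply/hasPn => z; rewrite mem_cat => /orP[/mapP[j _ ->]|/allpairsPdep[i [a [_ _ ->]]]];
      by apply/negP => /mapP[].
  + apply/and3P; split.
    * by rewrite map_inj_uniq ?enum_uniq// => i1 i2 [].
    * by apply/hasPn => z /allpairsPdep[i [a [_ _ ->]]]; apply/negP => /mapP[].
    * apply: allpairs_uniq_dep; [exact: enum_uniq|by move=> i _; exact: fset_uniq|].
      by move=> [i1 a1] [i2 a2] _ _ /= [-> ->].
- rewrite cat_uniq map_inj_in_uniq ?enum_uniq; last first.
    by move=> t1 t2; rewrite !mem_enum; exact: rcpld_index_of_inj.
  rewrite map_inj_uniq ?enum_uniq ?andbT; last by move=> i1 i2 [].
  by apply/hasPn => z /mapP[j _ ->]; apply/negP => /mapP[[[]|[i|[q|[i q]]]]].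
move=> z; rewrite /rcpld_index !mem_cat; apply/or3P/orP => -[].
- move=> /mapP[i]; rewrite mem_enum inE => iI ->; left.
  by apply/mapP; exists (tg i); rewrite ?mem_enum.
- by right.
- move=> /allpairsPdep[i [a [_ /gensetP[q qI ->] ->]]]; left.
  by apply/mapP; exists (tP i q); rewrite ?mem_enum.
- move=> /mapP[[[]|[i|[q|[i q]]]]]; rewrite mem_enum => tI ->.
  + by case/negP: (I0s tI); rewrite support_tt.
  + by apply: Or31; apply/mapP; exists i; rewrite ?mem_enum ?inE.
  + by case/negP: (I0s tI); rewrite support_h.
  + apply: Or33; apply/allpairsPdep; exists i, (val q.1).
    by rewrite mem_enum; split=> //; apply/gensetP; exists q.
- by move=> zJ; apply: Or32.
Qed.


(** Up to signs the family consists of the [vs k t] with [t] in [I0] and the gradients of the basis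
    equations. [indep] kills the coefficients of the former, and independence of the basis gradients
    those of the latter. *)
Lemma rcpld_family_free k : (forall nu : 'rV_(#|J|), nu *m basis_grad (xs k) = 0 -> nu = 0) ->
  free [seq rcpld_vector k z | z <- rcpld_index].
Proof.
move=> indk; have uf : uniq rcpld_index.
  rewrite (perm_uniq rcpld_index_perm) cat_uniq map_inj_in_uniq ?enum_uniq; last first.
    by move=> t1 t2; rewrite !mem_enum; exact: rcpld_index_of_inj.
  rewrite map_inj_uniq ?enum_uniq ?andbT; last by move=> i1 i2 [].
  by apply/hasPn => z /mapP[j _ ->]; apply/negP => /mapP[[[]|[i|[q|[i q]]]]].
apply/(free_mapP _ uf) => c; rewrite (perm_big _ rcpld_index_perm) big_cat !big_map /= => rel0.
pose sgt (t : T) : R := if t is inr (inr (inr (_, q))) then signb q.2 else 1.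
have sgt2 t : sgt t * sgt t = 1.
  by case: t => [u|[i|[q|[i q]]]] /=; rewrite ?mul1r// signb_sqr.
have fvE t : t \in I0 -> rcpld_vector k (rcpld_index_of t) = sgt t *: vs k t.
  move=> /[dup] tI /I0s lt; case: t lt tI => [[]|[i|[q|[i q]]]] /=.
  - by rewrite support_tt eqxx.
  - by rewrite scale1r.
  - by rewrite support_h eqxx.
  - move=> /support_legit[li _] _; have := subd_vs k (tP i q); rewrite /= li => ->.
    by rewrite -scalemxAl scalerA signb_sqr scale1r.
pose ct (t : T) : R := if t \in I0 then c (rcpld_index_of t) * sgt t else 0.
pose cj : 'rV[R]_m := \row_j (if j \in J then c (Some (inr (inl j))) else 0).
have cjJ j : j \notin J -> cj 0 j = 0 by rewrite mxE => /negbTE ->.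
have relE : \sum_t ct t *: vs k t + (cj *m basis_sel) *m basis_grad (xs k) = 0.
  rewrite -basis_grad_row// -[RHS]rel0; congr (_ + _); last first.
    by rewrite big_enum; apply: eq_bigr => j jJ; rewrite mxE jJ.
  rewrite big_enum (bigID (mem I0))/= [X in _ + X]big1 ?addr0 => [|t /negbTE tI]; last first.
    by rewrite /ct tI scale0r.
  by apply: eq_bigr => t tI; rewrite /ct tI fvE// scalerA.
have ct0 t : ct t = 0.
  apply: (indep _ relE) => {}t lt; rewrite /ct; case: ifP => // /I0s.
  by rewrite lt eqxx.
have cj0 : cj = 0.
  rewrite -(selK cjJ) (indk (cj *m basis_sel)) ?mul0mx//.
  by rewrite -[RHS]relE big1 ?add0r// => t _; rewrite ct0 scale0r.
move=> z; rewrite (perm_mem rcpld_index_perm) mem_cat => /orP[/mapP[t]|/mapP[j]]; rewrite mem_enum => zI ->.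
  have := ct0 t; rewrite /ct zI => /(congr1 (fun r : R => r * sgt t)).
  by rewrite mul0r -mulrA sgt2 mulr1.
by have := congr1 (fun M : 'rV_m => M 0 j) cj0; rewrite !mxE zI.
Qed.

Lemma rcpld_contradiction (gen : forall q : nat, set 'rV[R]_q -> {fset 'rV[R]_q} * {fset 'rV[R]_q})
  (C : 'I_l -> set 'rV[R]_p) :
  (forall i, N i = regular_normal (C i) (Phi i xbar)) ->
  (forall i, gen p (N i) = (AI i, AE i)) -> (forall i, C i (Phi i xbar)) ->
  mpdc_rcpld (p := fun=> p) gen g h Phi C xbar -> subdiff_regular g ->
  basis_of <<[seq grad h j xbar | j <- enum 'I_m]>>%VS [seq grad h j xbar | j <- enum J] ->
  xs @ \oo --> xbar -> (forall k, xs k != xbar) ->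
  (forall t, (fun k => vs k t) @ \oo --> vst t) ->
  (forall k (nu : 'rV_(#|J|)), nu *m basis_grad (xs k) = 0 -> nu = 0) -> False.
Proof.
move=> NE genE Cx [_ _ HR] greg HJ xsx xsn vsc indk.
pose lg : 'rV[R]_n := \row_r lam (tg r).
have Ig (i : 'I_n) : i \in active_support -> g xbar 0 i = 0 by rewrite inE => /I0s/support_g.
have lgI (i : 'I_n) : i \notin active_support -> lg 0 i = 0.
  by rewrite inE mxE => tI; rewrite I0_out.
(* The point [Phi i xbar] lies in every ball around itself, so the generators of its own normal cone
   are available for every [delta]. *)
have genx i delta : 0 < delta -> exists2 x, (ball (Phi i xbar) delta `&` C i) x &
    gen p (regular_normal (C i) x) = (AI i, AE i).
  by move=> d0; exists (Phi i xbar); [split=> //; exact: ballxx|rewrite -NE genE].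
have limN i : gcone (AI i) (AE i) `<=` limiting_normal (C i) (Phi i xbar).
  move=> y; have [[_ _ <-] _ _] := genN i; rewrite NE; exact: regular_limiting_normal.
have subA i : gcone (AI i `&` genset i)%fset (AE i `&` genset i)%fset `<=` gcone (AI i) (AE i).
  by apply: gcone_subset => a; rewrite in_fsetI => /andP[].
have /(_ lg) := HR J HJ active_support (mu *m basis_sel^T) _ multiplier (fun i : 'I_n => vst (tg i)) Ig.
have lsub (i : 'I_n) x w : g xbar 0 i = 0 -> constraint_subdiff (tg i) x w -> limiting_subdiff (coordf g i) x w.
  by move=> gi; rewrite /= gi eqxx greg.
move=> H; have {}H : forall (us : nat -> E) (ws : nat -> 'I_n -> E)
        (BI BE : 'I_l -> {fset 'rV[R]_p}),
      us @ \oo --> xbar ->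
      (forall k, us k != xbar) ->
      (forall k r, r \in active_support -> limiting_subdiff (coordf g r) (us k) (ws k r)) ->
      (forall r, r \in active_support -> (fun k => ws k r) @ \oo --> vst (tg r)) ->
      (forall i, [set` BI i] `<=` genI gen (C i) (Phi i xbar)) ->
      (forall i, [set` BE i] `<=` Defs.genE gen (C i) (Phi i xbar)) ->
      (forall i, multiplier i <> 0 ->
        [/\ free (BI i `|` BE i)%fset, gcone (BI i) (BE i) (multiplier i)
          & gcone (BI i) (BE i) `<=` limiting_normal (C i) (Phi i xbar)]) ->
      (forall i, multiplier i = 0 -> (BI i `|` BE i = fset0)%fset) ->
      \forall k \near \oo,
        ~~ free (rcpld_family (p := fun=> p) h Phi active_support J (fun i => (BI i `|` BE i)%fset)
                   (us k) (ws k)).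
  apply: H => //.
  - move=> [_ lg0 m0]; have [t tI] := I0_ne; have := I0_pos tI; have := I0s tI.
    case: t tI => [[]|[i|[q|[i q]]]] tI; rewrite ?support_tt ?support_h ?eqxx// => _.
      by have := congr1 (fun M : 'rV_n => M 0 i) lg0; rewrite !mxE => ->; rewrite ltxx.
    have : val q.1 \in genset i by apply/gensetP; exists q.
    by rewrite (multiplier_eq0 (m0 i)) in_fset0.
  - by move=> i; exact: selTE.
  - by move=> i; rewrite mxE; case: rel.
  - by move=> i iI; apply: lsub (Ig i iI) _; exact: subd_vst.
  - by move=> i; apply: limN; apply: subA; exact: multiplier_gcone.
  - rewrite {1}relation_multiplier; congr (_ + _ + _).
    rewrite [LHS](bigID (mem active_support))/= [X in _ + X]big1 ?addr0 => [|i iI]; last first.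
      by have := lgI i iI; rewrite mxE => ->; rewrite scale0r.
    by apply: eq_bigr => i _; rewrite mxE.
have : \forall k \near \oo, ~~ free [seq rcpld_vector k z | z <- rcpld_index].
  under eq_near do rewrite -rcpld_familyE.
  apply: H => //.
  - by move=> k i iI; apply: lsub (Ig i iI) _; exact: subd_vs.
  - move=> i a /=; rewrite in_fsetI => /andP[aA _].
    near=> delta; have [|x Cx' xE] := genx i delta; last by exists x; rewrite ?xE.
    by near: delta; exact: nbhs_right_gt.
  - move=> i a /=; rewrite in_fsetI => /andP[aA _].
    near=> delta; have [|x Cx' xE] := genx i delta; last by exists x; rewrite ?xE.
    by near: delta; exact: nbhs_right_gt.
  - move=> i _; split; [|exact: multiplier_gcone|].
      by rewrite genset_split; exact: genset_free.
    by move=> y /subA/limN.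
  - by move=> i /multiplier_eq0; rewrite genset_split.
move=> [k _ Hk]; have kk : (k <= k)%N by [].
have /negP := Hk k kk; apply; apply: rcpld_family_free; exact: indk.
Unshelve. all: end_near.
Qed.

End minimal_support.
End limit_relation.
End subsystem.

(** * Reduction of the gap property to limits of sequences *)

Section gap_from_limits.
Context {R : realType} {d k : nat} {T : finType}.
Local Notation E := 'rV[R]_d.
Implicit Types (phi : T -> E -> R) (D : T -> E -> set E) (eta : E -> 'rV[R]_k)
  (H : E -> 'M[R]_(k, d)) (x y z xbar w : E) (lam c : T -> R)
  (mu nu : 'rV[R]_k) (rho del cH M : R).

(** If no radius and threshold work, there are points tending to [xbar] with residual tending to 0
    and independent support. Weights, subgradients and multipliers are bounded, the latter through
    [cH], so they converge along a subsequence to an exact relation at [xbar]. *)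
Lemma gap_system_of_limits phi D eta H xbar rho1 cH M : 0 < rho1 ->
  (forall t, subdiff_on xbar rho1 (phi t) (D t)) ->
  (forall mu, c1_ball xbar rho1 (fun x => dotv mu (eta x)) (fun x => mu *m H x)) ->
  0 < cH -> (forall x mu, `|x - xbar| < rho1 -> cH * `|mu| <= `|mu *m H x|) ->
  (forall t x w, `|x - xbar| < rho1 -> D t x w -> `|w| <= M) ->
  (forall (xs : nat -> E) (vs : nat -> T -> E) (vst : T -> E) (lam0 : T -> R) (mu0 : 'rV[R]_k),
    (forall n, `|xs n - xbar| < rho1) -> (forall n, xs n != xbar) ->
    xs @ \oo --> xbar -> (forall n t, D t (xs n) (vs n t)) ->
    (forall t, (fun n => vs n t) @ \oo --> vst t) -> (forall t, D t xbar (vst t)) ->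
    (forall t, 0 <= lam0 t) -> \sum_t lam0 t = 1 ->
    \sum_t lam0 t *: vst t + mu0 *m H xbar = 0 ->
    (forall n c nu, (forall t, lam0 t = 0 -> c t = 0) ->
      \sum_t c t *: vs n t + nu *m H (xs n) = 0 -> forall t, c t = 0) -> False) ->
  exists rho del, 0 < rho /\ gap_system phi D eta H xbar rho del cH M.
Proof.
move=> rho0 gd c1 cH0 ind bnd nolim; apply: contrapT => ngap.
pose bad (r : R) (q : (E * (T -> E)) * ((T -> R) * 'rV[R]_k)) :=
  [/\ [/\ `|q.1.1 - xbar| < r, q.1.1 != xbar & forall t, D t q.1.1 (q.1.2 t)],
    forall t, 0 <= q.2.1 t, \sum_t q.2.1 t = 1,
    `|\sum_t q.2.1 t *: q.1.2 t + q.2.2 *m H q.1.1| < r &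
    forall c nu, (forall t, q.2.1 t = 0 -> c t = 0) ->
      \sum_t c t *: q.1.2 t + nu *m H q.1.1 = 0 -> forall t, c t = 0].
have badP r : 0 < r -> r <= rho1 -> exists q, bad r q.
  move=> r0 r1; apply: contrapT => nbad; apply: ngap; exists r, r; split; first exact: r0.
  have rlt x : `|x - xbar| < r -> `|x - xbar| < rho1 by move=> /lt_le_trans; apply.
  apply: GapSystem.
  - by move=> t; exact: subdiff_on_le r1 (gd t).
  - by move=> mu; exact: c1_ball_le r1 (c1 mu).
  - exact: cH0.
  - by move=> x mu /rlt; exact: ind.
  - by move=> t x w /rlt; exact: bnd.
  - exact: r0.
  move=> x v lam mu xr /eqP xn Dv l0 l1 sm; apply: contrapT => nd.
  apply: nbad; exists ((x, v), (lam, mu)); split=> //= c nu cl rel t.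
  apply/eqP; apply: contraT => ct; case: nd; exists c, nu; split=> //.
  by exists t.
pose r n : R := Num.min rho1 n.+1%:R^-1.
have r0 n : 0 < r n by rewrite lt_min rho0 invr_gt0 ltr0n.
have rle n : r n <= rho1 by rewrite ge_min lexx.
have [q qP] : exists q, forall n, bad (r n) (q n).
  have /choice[q qP] : forall n, exists q, bad (r n) q by move=> n; exact: badP.
  by exists q.
pose xs n := (q n).1.1; pose vs n := (q n).1.2; pose lam n := (q n).2.1; pose mu n := (q n).2.2.
have xr n : `|xs n - xbar| < r n by have [[]] := qP n.
have xr1 n : `|xs n - xbar| < rho1 by exact: lt_le_trans (xr n) (rle n).
have r_cvg (V : normedModType R) (u : nat -> V) : (forall n, `|u n| < r n) -> u @ \oo --> (0 : V).
  move=> ur; apply/cvgrPdist_lt => e e0; have [N HN] := invSn_lt e0.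
  exists N => // n /= Nn; rewrite sub0r normrN; apply: lt_trans (ur n) _.
  by rewrite gt_min HN ?orbT.
have xsx : xs @ \oo --> xbar.
  apply/cvgrPdist_lt => e e0; have [N HN] := invSn_lt e0.
  exists N => // n /= Nn; rewrite distrC; apply: lt_trans (xr n) _.
  by rewrite gt_min HN ?orbT.
have Dv n t : D t (xs n) (vs n t) by have [[]] := qP n.
have l0 n t : 0 <= lam n t by have [_ h _ _ _] := qP n; exact: h.
have l1 n : \sum_t lam n t = 1 by have [_ _ h _ _] := qP n; exact: h.
have lamb n t : `|lam n t| <= 1.
  by rewrite ger0_norm// -(l1 n) (bigD1 t)//= lerDl sumr_ge0.
have res n : `|\sum_t lam n t *: vs n t + mu n *m H (xs n)| < r n.
  by have [_ _ _ h _] := qP n; exact: h.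
have mub n : `|mu n| <= (rho1 + `|M|) / cH.
  rewrite ler_pdivlMr// mulrC; apply: le_trans (ind _ _ (xr1 n)) _.
  have -> : mu n *m H (xs n) = (\sum_t lam n t *: vs n t + mu n *m H (xs n)) -
      \sum_t lam n t *: vs n t by rewrite addrC addKr.
  apply: le_trans (ler_normB _ _) _; apply: lerD.
    by apply: ltW; apply: lt_le_trans (res n) (rle n).
  apply: le_trans (ler_norm_sum _ _ _) _; rewrite -[leRHS]mul1r -(l1 n) mulr_suml.
  apply: ler_sum => t _; rewrite normrZ ger0_norm// ler_wpM2l//.
  by apply: le_trans (bnd _ _ _ (xr1 n) (Dv n t)) _; exact: ler_norm.
have [s1 [ll [s1n lc]]] := bolzano_weierstrass_family lamb.
have [s2 [vst [s2n vc]]] := @bolzano_weierstrass_rV_family R d T (fun n => vs (s1 n)) M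
  (fun n t => bnd _ _ _ (xr1 _) (Dv _ t)).
have [s3 [mul [s3n mc]]] := @bolzano_weierstrass_rV R k (fun n => mu (s1 (s2 n))) _ (fun n => mub _).
pose s n := s1 (s2 (s3 n)).
have sn n : (n <= s n)%N by apply: leq_trans (s3n n) _; apply: leq_trans (s2n _) (s1n _).
have lcs t : (fun n => lam (s n) t) @ \oo --> ll t.
  apply: (cvg_subseq (s := fun n => s2 (s3 n)) _ (lc t)) => n.
  exact: leq_trans (s3n n) (s2n _).
have vcs t : (fun n => vs (s n) t) @ \oo --> vst t by exact: (cvg_subseq s3n (vc t)).
have xcs : (fun n => xs (s n)) @ \oo --> xbar by exact: (cvg_subseq sn xsx).
have xb : `|xbar - xbar| < rho1 by rewrite subrr normr0.
have Dst t : D t xbar (vst t).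
  by apply: (subdiff_on_closed (gd t) _ xb xcs (vcs t)) => n; [exact: xr1|exact: Dv].
have ll0 t : 0 <= ll t by apply: seq_cvg_ge (lcs t) _ => n; exact: l0.
have ll1 : \sum_t ll t = 1.
  apply: (@seq_cvg_unique _ _ (fun n => \sum_t lam (s n) t)).
    by apply: cvg_bigsum => t _; exact: lcs.
  by under eq_fun do rewrite l1; exact: cvg_cst.
have relst : \sum_t ll t *: vst t + mul *m H xbar = 0.
  apply: (@seq_cvg_unique _ _ (fun n => \sum_t lam (s n) t *: vs (s n) t + mu (s n) *m H (xs (s n)))).
    apply: cvgD; last exact: cvg_mulmx_c1 c1 xb xcs mc.
    by apply: cvg_bigsum => t _; apply: cvgZ.
  have h := r_cvg _ _ res.
  exact: (cvg_subseq sn h).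
(* Indices of positive limit weight have nonzero weight along the tail, so independence over the
   supports along the sequence passes to the possibly smaller support of [ll]. *)
have [N HN] : exists N, forall n, (N <= n)%N -> forall t, ll t != 0 -> lam (s n) t != 0.
  have [N _ HN] : \forall n \near \oo, forall t, ll t != 0 -> lam (s n) t != 0.
    apply: filter_forall => t; have [lt|lt] := eqVneq (ll t) 0; first by apply: nearW => n.
    have lp : 0 < ll t by rewrite lt_def lt ll0.
    have /cvgrPdist_lt/(_ _ lp) := lcs t; apply: filterS => n + _.
    by apply: contraTneq => ->; rewrite subr0 ger0_norm// ltxx.
  by exists N.
have shift (V : normedModType R) (u : nat -> V) (a : V) :
    u @ \oo --> a -> (fun n => u (n + N)%N) @ \oo --> a.
  by move=> ua; apply: (cvg_subseq (s := fun n => (n + N)%N) _ ua) => n; exact: leq_addr.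
apply: (nolim (fun n => xs (s (n + N)%N)) (fun n => vs (s (n + N)%N)) vst ll mul) => //.
- by move=> n; have [[]] := qP (s (n + N)%N).
- exact: (shift _ _ _ xcs).
- by move=> t; exact: (shift _ _ _ (vcs t)).
move=> n c nu cl relc; have [_ _ _ _ nd] := qP (s (n + N)%N).
apply: (nd c nu) => // t lt; apply: cl; apply/eqP; apply: contraT => h.
by have := HN (n + N)%N (leq_addl _ _) t h; rewrite /lam lt eqxx.
Qed.

End gap_from_limits.

Lemma finite_radius (R : realType) (Q : finType) (P : Q -> R -> Prop) :
  (forall q r r', r' <= r -> P q r -> P q r') ->
  (forall q, exists2 r : R, 0 < r & P q r) -> exists2 r : R, 0 < r & forall q, P q r.
Proof.
move=> Pmono Pex; have /choice[r rP] : forall q, exists r : R, 0 < r /\ P q r.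
  by move=> q; have [r r0 Pr] := Pex q; exists r.
have r0 q := proj1 (rP q); have Pr q := proj2 (rP q).
by have [m m0 mr] := finite_pos_lb r0; exists m => // q; exact: Pmono (mr q) (Pr q).
Qed.

(** * Basis equations and constant rank *)

Section equality_rows.
Context {R : realType} {d m : nat} (h : 'rV[R]_d -> 'rV[R]_m) (J : {set 'I_m})
  (xbar : 'rV[R]_d).
Implicit Types (x : 'rV[R]_d) (nu : 'rV[R]_(#|J|)).

Lemma selTK nu : nu *m (basis_sel J)^T *m basis_sel J = nu.
Proof.
apply/rowP => a; rewrite mxE (bigD1 (enum_val a))//= [basis_sel J _ _]mxE eqxx mulr1.
rewrite [X in _ + X]big1 ?addr0 => [|j ja]; last by rewrite [basis_sel J _ _]mxE (negbTE ja) mulr0.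
rewrite mxE (bigD1 a)//= !mxE eqxx mulr1 big1 ?addr0// => b ba.
by rewrite !mxE (inj_eq enum_val_inj) eq_sym (negbTE ba) mulr0.
Qed.

Context (HJ : basis_of <<[seq grad h i xbar | i <- enum 'I_m]>>%VS
  [seq grad h i xbar | i <- enum J]).

Lemma basis_grad_free nu : nu *m basis_grad h J xbar = 0 -> nu = 0.
Proof.
move=> nu0; have fJ := basis_free HJ.
rewrite -[nu]selTK (_ : nu *m _ = 0) ?mul0mx//.
apply/rowP => j; rewrite [RHS]mxE; have [jJ|jJ] := boolP (j \in J); last by rewrite selTE.
have := elimT (free_mapP _ (enum_uniq _)) fJ (fun j => (nu *m (basis_sel J)^T) 0 j).
by apply; rewrite ?mem_enum// big_enum basis_grad_selT.
Qed.

Lemma basis_grad_span j : exists nu, grad h j xbar = nu *m basis_grad h J xbar.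
Proof.
have : grad h j xbar \in <<[seq grad h i xbar | i <- enum 'I_m]>>%VS.
  by apply/memv_span/map_f; rewrite mem_enum.
rewrite -(span_basis HJ) => /(span_mapP _ _ (enum_uniq _))[c ->].
exists ((\row_j (if j \in J then c j else 0)) *m basis_sel J).
rewrite -basis_grad_row => [|i iJ]; last by rewrite mxE (negbTE iJ).
by rewrite big_enum; apply: eq_bigr => i iJ; rewrite mxE iJ.
Qed.

(** Independence of the basis gradients is stable under small perturbations, with a uniform lower
    bound. They still span all gradients nearby because the rank of the Jacobian does not grow. *)
Lemma basis_grad_local : smooth h ->
  (\forall x \near xbar, \rank (nabla h x) = \rank (nabla h xbar)) ->
  exists rho cH : R, [/\ 0 < rho, 0 < cH,
    forall x nu, `|x - xbar| < rho -> cH * `|nu| <= `|nu *m basis_grad h J x| &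
    forall x j, `|x - xbar| < rho -> exists nu, grad h j x = nu *m basis_grad h J x].
Proof.
move=> [_ ch] rk.
have aux (c a b b' e s : R) : 2 * c * a <= b -> s <= c * a -> b <= b' + e -> e <= s ->
    c * a <= b' by lra.
have rfree (A : 'M[R]_(#|J|, d)) : (forall nu, nu *m A = 0 -> nu = 0) -> row_free A.
  move=> A0; rewrite -kermx_eq0; apply/eqP/row_matrixP => i; rewrite row0.
  by apply: A0; apply/sub_kermxP; exact: row_sub.
have f0 := rfree _ basis_grad_free.
have [K K0 KP] := mulmx_norm_le (pinvmx (basis_grad h J xbar)).
have indb nu : `|nu| <= K * `|nu *m basis_grad h J xbar|.
  by rewrite -{1}[nu](mulmxKp f0); exact: KP.
pose S : R := m%:R * (#|J|%:R * `|(basis_sel J)^T|).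
have S0 : 0 <= S by rewrite /S !mulr_ge0.
(* Then the perturbation, at most [S * e * |nu|], is below [cH * |nu|], half of the lower bound
   valid at [xbar]. *)
pose e : R := (2 * (K + 1) * (S + 1))^-1.
have e0 : 0 < e by rewrite invr_gt0 !mulr_gt0// ltr_wpDl.
have /cvgrPdist_lt/(_ _ e0) che := ch xbar.
have [r1 r10 H1] := iffLR (near_distP xbar (fun x => `|nabla h xbar - nabla h x| < e))
  che.
have [r2 r20 H2] := iffLR (near_distP xbar (fun x => \rank (nabla h x) = \rank (nabla h xbar))) rk.
pose cH : R := (2 * (K + 1))^-1.
have cH0 : 0 < cH by rewrite invr_gt0 mulr_gt0// ltr_wpDl.
have ind x nu : `|x - xbar| < r1 -> cH * `|nu| <= `|nu *m basis_grad h J x|.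
  move=> /H1 xe.
  have diff : `|nu *m basis_grad h J xbar - nu *m basis_grad h J x| <= S * e * `|nu|.
    have -> : nu *m basis_grad h J xbar - nu *m basis_grad h J x =
        (nu *m (basis_sel J)^T) *m (nabla h xbar - nabla h x).
      by rewrite [RHS]mulmxBr; congr (_ - _); exact: mulmxA.
    apply: le_trans (norm_mulmx_le _ _) _.
    have -> : S * e * `|nu| = m%:R * (#|J|%:R * (`|nu| * `|(basis_sel J)^T|) * e).
      by rewrite /S -!mulrA; congr (_ * (_ * _)); rewrite [RHS]mulrC mulrA.
    apply: ler_wpM2l => //; apply: ler_pM => //; first exact: norm_mulmx_le.
    exact: ltW.
  have Se : S * e <= cH.
    rewrite /e /cH invfM mulrA mulrAC ler_piMl ?invr_ge0 ?mulr_ge0 ?addr_ge0//.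
    by rewrite ler_pdivrMr ?ltr_wpDl// mul1r lerDl.
  have tri : `|nu *m basis_grad h J xbar| <= `|nu *m basis_grad h J x| + `|nu *m basis_grad h J xbar - nu *m basis_grad h J x|.
    by rewrite addrC -lerBlDr; apply: le_trans (lerB_dist _ _).
  have h3 : 2 * cH * `|nu| <= `|nu *m basis_grad h J xbar|.
    rewrite /cH invfM mulrA divff// mul1r mulrC ler_pdivrMr ?ltr_wpDl//.
    by apply: le_trans (indb nu) _; rewrite mulrC ler_wpM2l// lerDl.
  have h4 : S * e * `|nu| <= cH * `|nu| by rewrite ler_wpM2r.
  exact: aux h3 h4 tri diff.
exists (Num.min r1 r2), cH; split=> //; first by rewrite lt_min r10.
  by move=> x nu; rewrite lt_min => /andP[h1 _]; exact: ind.
move=> x j; rewrite lt_min => /andP[h1 h2].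
have fx : row_free (basis_grad h J x).
  apply: rfree => nu nu0; have := ind x nu h1; rewrite nu0 normr0 pmulr_rle0//.
  by rewrite normr_le0 => /eqP.
have sx : (basis_grad h J x <= nabla h x)%MS by exact: submxMl.
have sb : (nabla h xbar <= basis_grad h J xbar)%MS.
  apply/row_subP => i; have [nu gE] := basis_grad_span i.
  by rewrite -/(grad h i xbar) gE submxMl.
have rkx : (\rank (nabla h x) <= \rank (basis_grad h J x))%N.
  rewrite H2// (eqP fx) -(eqP f0); exact: mxrankS sb.
have [_ h3] := mxrank_leqif_sup sx.
have /row_subP/(_ j)/submxP[nu gE] : (nabla h x <= basis_grad h J x)%MS.
  by rewrite -h3 eqn_leq mxrankS.
by exists nu.
Qed.

End equality_rows.

Lemma grad_basis (R : realType) d m (h : 'rV[R]_d -> 'rV[R]_m) (xbar : 'rV[R]_d) :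
  exists J : {set 'I_m}, basis_of <<[seq grad h i xbar | i <- enum 'I_m]>>%VS
               [seq grad h i xbar | i <- enum J].
Proof.
have [Y YX [fY YE]] := free_subseq (fun i => grad h i xbar) (enum 'I_m).
have uY := subseq_uniq YX (enum_uniq _).
pose J : {set 'I_m} := finset (fun i => i \in Y).
have JY : perm_eq (enum J) Y.
  by apply: uniq_perm; rewrite ?enum_uniq// => i; rewrite mem_enum inE.
have p := perm_map (fun i => grad h i xbar) JY.
exists J; rewrite /basis_of (perm_free p) fY andbT -YE.
by apply/eqP/eq_span/perm_mem.
Qed.

Section rcpld_gap.
Context {R : realType} {d n m l p : nat} (g : 'rV[R]_d -> 'rV[R]_n)
  (h : 'rV[R]_d -> 'rV[R]_m) (Phi : 'I_l -> 'rV[R]_d -> 'rV[R]_p)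
  (AI AE : 'I_l -> {fset 'rV[R]_p}) (J : {set 'I_m}) (xbar : 'rV[R]_d).
Context (glip : locally_lipschitz g) (greg : subdiff_regular g) (hsm : smooth h)
  (Psm : forall i, smooth (Phi i)).
Local Notation E := 'rV[R]_d.
Local Notation U := (fset_sub_type (all_gens AI AE)).
Local Notation T := (unit + ('I_n + ('I_m * bool + 'I_l * (U * bool))))%type.
Local Notation constraint := (constraint g h Phi (AI := AI) (AE := AE) xbar).
Local Notation constraint_subdiff := (constraint_subdiff g h Phi (AI := AI) (AE := AE) xbar).

Lemma constraint_subdiff_on : exists2 rho : R, 0 < rho & (forall t, subdiff_on xbar rho (constraint t) (constraint_subdiff t)) /\
  forall mu, c1_ball xbar rho (fun x => dotv mu (basis_eq h J x)) (fun x => mu *m basis_grad h J x).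
Proof.
have [r1 [L [r10 L0 Lg]]] := locally_lipschitz_ball xbar glip.
have [r2 r20 [Mh hM]] := nabla_bounded xbar hsm.
have [r3 r30 PM] : exists2 r : R, 0 < r & forall i, exists M : R,
    forall x, `|x - xbar| < r -> `|nabla (Phi i) x| <= M.
  apply: finite_radius => [i r r' rr [M HM]|i].
    by exists M => x xr; apply: HM; exact: lt_le_trans rr.
  by have [r r0 [M HM]] := nabla_bounded xbar (Psm i); exists r => //; exists M.
pose r := Num.min r1 (Num.min r2 r3).
have rr1 : r <= r1 by rewrite /r ge_min lexx.
have rr2 : r <= r2 by rewrite /r !ge_min lexx orbT.
have rr3 : r <= r3 by rewrite /r !ge_min lexx !orbT.
exists r; first by rewrite /r !lt_min r10 r20.
have zero : subdiff_on xbar r (fun=> 0 : R) (fun=> [set 0]) by exact: subdiff_on_c1 (@c1_cst _ _ xbar r).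
have hc1 c := c1_ball_le rr2 (smooth_c1_ball c hsm hM).
split; last first.
  move=> mu; have := hc1 (mu *m (basis_sel J)^T).
  rewrite (_ : (fun x => dotv _ (h x)) = fun x => dotv mu (basis_eq h J x)); last first.
    by apply/funext => x; rewrite dotv_mulmx trmxK.
  rewrite (_ : (fun x => _ *m nabla h x) = fun x => mu *m basis_grad h J x)//.
  by apply/funext => x; rewrite /basis_grad mulmxA.
case=> [u|[i|[q|[i q]]]].
- exact: zero.
- rewrite (_ : constraint _ = if g xbar 0 i == 0 then coordf g i else fun=> 0); last first.
    by apply/funext => x /=; case: ifP.
  rewrite (_ : constraint_subdiff _ = if g xbar 0 i == 0 then regular_subdiff (coordf g i) else fun=> [set 0]); last first.
    by apply/funext => x /=; case: ifP.
  case: ifP => _; last exact: zero.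
  apply: subdiff_on_le rr1 _; apply: (subdiff_on_regular L0 (Lg i)); exact: greg.
- exact: subdiff_on_c1 (hc1 _).
- have [M HM] := PM i.
  have Pc1 c := c1_ball_le rr3 (smooth_c1_ball c (Psm i) HM).
  rewrite (_ : constraint _ = if legit i q then fun x => dotv (signb q.2 *: val q.1) (Phi i x) -
        dotv (signb q.2 *: val q.1) (Phi i xbar) else fun=> 0); last first.
    by apply/funext => x /=; case: ifP.
  rewrite (_ : constraint_subdiff _ = if legit i q then fun x => [set (signb q.2 *: val q.1) *m nabla (Phi i) x]
    else fun=> [set 0]); last first.
    by apply/funext => x /=; case: ifP.
  case: ifP => _; last exact: zero.
  apply: subdiff_on_c1; apply: c1_add_cst; exact: Pc1.
Qed.

Lemma rcpld_gap_system (gen : forall q : nat, set 'rV[R]_q -> {fset 'rV[R]_q} * {fset 'rV[R]_q})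
  (C : 'I_l -> set 'rV[R]_p) :
  (forall i, is_generator (regular_normal (C i) (Phi i xbar)) (AI i, AE i)) ->
  (forall i, gen p (regular_normal (C i) (Phi i xbar)) = (AI i, AE i)) ->
  (forall i, C i (Phi i xbar)) ->
  mpdc_rcpld (p := fun=> p) gen g h Phi C xbar ->
  basis_of <<[seq grad h j xbar | j <- enum 'I_m]>>%VS [seq grad h j xbar | j <- enum J] ->
  exists rho cH del M : R, 0 < rho /\
    gap_system constraint constraint_subdiff (basis_eq h J) (basis_grad h J) xbar rho del cH M.
Proof.
move=> genN genE Cx HR HJ; have [_ rk _] := HR.
have [r1 r10 [gd c1]] := constraint_subdiff_on.
have [r2 [cH [r20 cH0 ind span]]] := basis_grad_local HJ hsm rk.
pose r := Num.min r1 r2.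
have r0 : 0 < r by rewrite /r lt_min r10.
have rr1 : r <= r1 by rewrite /r ge_min lexx.
have rr2 x : `|x - xbar| < r -> `|x - xbar| < r2.
  by move=> /lt_le_trans; apply; rewrite /r ge_min lexx orbT.
have [Mt MP] : exists Mt : T -> R, forall t x w, `|x - xbar| < r1 -> constraint_subdiff t x w -> `|w| <= Mt t.
  have /choice[Mt MP] : forall t, exists M : R, forall x w, `|x - xbar| < r1 -> constraint_subdiff t x w -> `|w| <= M.
    by move=> t; exact: subdiff_on_bnd (gd t).
  by exists Mt.
pose M : R := \sum_t `|Mt t|.
have bnd t x w : `|x - xbar| < r -> constraint_subdiff t x w -> `|w| <= M.
  move=> xr Dw; apply: le_trans (MP t x w (lt_le_trans xr rr1) Dw) _.
  apply: le_trans (ler_norm _) _; rewrite /M (bigD1 t)//= lerDl; exact: sumr_ge0.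
have ind_bar (nu : 'rV_(#|J|)) : nu *m basis_grad h J xbar = 0 -> nu = 0.
  exact (@basis_grad_free R d m h J xbar HJ nu).
have indr x (nu : 'rV_(#|J|)) : `|x - xbar| < r -> cH * `|nu| <= `|nu *m basis_grad h J x|.
  by move=> /rr2; exact: ind.
have [|rho [del [rho0 gs]]] := gap_system_of_limits r0 (fun t => subdiff_on_le rr1 (gd t))
  (fun mu => c1_ball_le rr1 (c1 mu)) cH0 indr bnd; last by exists rho, cH, del, M.
move=> xs vs vst lam0 mu0 xr xn xsx Dv vc Dst l0 l1 rel nodep.
pose S : {set T} := finset (fun t => lam0 t != 0).
(* The subdifferential is replaced by the singletons of the limits [vst t]: RCPLD is applied to
   these subgradients, so minimality is taken within this one family. *)
have rel0 : relation (fun (t : T) (_ : E) => [set vst t]) (basis_grad h J) xbar S lam0 vst mu0.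
  by split=> // t; rewrite inE negbK => /eqP.
have [I0 I0S minI] := minimal_relation_exists rel0.
have [[lam [v [mu relv]]] _] := minI.
have vE : v = vst by apply/funext => t; case: relv => _ _ _ h4 _; exact: h4.
rewrite vE in relv.
have I0l t : t \in I0 -> lam0 t != 0.
  by move=> /(fintype.subsetP I0S); rewrite inE.
have indk k (nu : 'rV_(#|J|)) : nu *m basis_grad h J (xs k) = 0 -> nu = 0.
  move=> nu0; have := indr (xs k) nu (xr k); rewrite nu0 normr0 pmulr_rle0//.
  by rewrite normr_le0 => /eqP.
have gradk k j : exists nu, grad h j (xs k) = nu *m basis_grad h J (xs k).
  by apply: span; exact: rr2.
exact: (rcpld_contradiction Dv Dst gradk nodep genN ind_bar minI relv I0l
  (fun i => erefl) genE Cx HR greg HJ xsx xn vc indk).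
Qed.

End rcpld_gap.

(** * Error bounds *)

Section subsystem_error_bound.
Context {R : realType} {d n m l p : nat} (g : 'rV[R]_d -> 'rV[R]_n)
  (h : 'rV[R]_d -> 'rV[R]_m) (Phi : 'I_l -> 'rV[R]_d -> 'rV[R]_p)
  (AI AE : 'I_l -> {fset 'rV[R]_p}) (C : 'I_l -> set 'rV[R]_p) (xbar : 'rV[R]_d).
Local Notation E := 'rV[R]_d.
Local Notation U := (fset_sub_type (all_gens AI AE)).
Local Notation T := (unit + ('I_n + ('I_m * bool + 'I_l * (U * bool))))%type.
Local Notation constraint := (constraint g h Phi (AI := AI) (AE := AE) xbar).
Context (N : 'I_l -> set 'rV[R]_p) (NE : forall i, N i = gcone (AI i) (AE i))
  (N_le : forall i v z, N i v -> C i z -> dotv v (z - Phi i xbar) <= 0).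

(** Distances to the pieces are represented by arbitrary points [gam i] of them; estimates uniform
    in [gam] can later be applied to nearly closest points. *)
Definition residual (gam : 'I_l -> 'rV[R]_p) (x : E) : R :=
  `|posp (g x)| + `|h x| + \sum_i `|Phi i x - gam i|.

Lemma residual_ge0 gam x : 0 <= residual gam x.
Proof. by rewrite /residual !addr_ge0// sumr_ge0. Qed.

Lemma legit_normal i (q : U * bool) : legit i q -> N i (signb q.2 *: val q.1).
Proof.
rewrite NE => /orP[qE|/andP[qI qb]]; first exact: gconeZE.
by apply: gconeZI => //; rewrite /signb (negbTE qb) expr0.
Qed.

Lemma dotv_signb_delta b (k : 'I_m) (y : 'rV[R]_m) : dotv (signb b *: delta_mx 0 k) y = signb b * y 0 k.
Proof.
rewrite dotvZl /dotv (bigD1 k)//= mxE !eqxx mul1r big1 ?addr0// => j jk.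
by rewrite mxE (negbTE jk) andbF mul0r.
Qed.

(** A generator [a] is normal to [C i] at [Phi i xbar], so [dotv a (gam i - Phi i xbar) <= 0] and
    the constraint is at most [dotv a (Phi i x - gam i)]. *)
Lemma constraint_residual (t : T) : exists2 K : R, 0 <= K & forall gam x,
  (forall i, C i (gam i)) -> Num.max 0 (constraint t x) <= K * residual gam x.
Proof.
have posK (K a b : R) : 0 <= K -> 0 <= b -> a <= K * b -> Num.max 0 a <= K * b.
  by move=> K0 b0 ab; rewrite ge_max ab mulr_ge0.
have s0 gam x : 0 <= \sum_i `|Phi i x - gam i| by apply: sumr_ge0.
case: t => [u|[i|[q|[i q]]]].
- by exists 0 => // gam x _; apply: posK => //; [exact: residual_ge0|rewrite mul0r].
- exists 1 => // gam x _; apply: posK => //; first exact: residual_ge0.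
  rewrite /= mul1r; case: ifP => _; last exact: residual_ge0.
  apply: (@le_trans _ _ `|posp (g x)|); last by rewrite /residual -addrA lerDl addr_ge0.
  apply: le_trans (normrV_coord _ i); rewrite mxE; apply: le_trans (ler_norm _).
  by rewrite le_max lexx orbT.
- exists 1 => // gam x _; apply: posK => //; first exact: residual_ge0.
  rewrite /= mul1r dotv_signb_delta; apply: (@le_trans _ _ `|h x|); last first.
    by rewrite /residual addrAC lerDr addr_ge0.
  apply: le_trans (ler_norm _) _; rewrite normrM /signb normr_sign mul1r.
  exact: normrV_coord.
- have K0 : 0 <= p%:R * `|signb q.2 *: val q.1 : 'rV[R]_p| by rewrite mulr_ge0.
  exists (p%:R * `|signb q.2 *: val q.1 : 'rV[R]_p|) => // gam x Cg.
  apply: posK => //; first exact: residual_ge0.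
  rewrite /=; case: ifP => li; last by rewrite mulr_ge0// residual_ge0.
  have := N_le (legit_normal li) (Cg i); rewrite dotvBr => le0.
  apply: (@le_trans _ _ (dotv (signb q.2 *: val q.1) (Phi i x - gam i))).
    rewrite dotvBr lerD2l lerN2; by rewrite -subr_le0.
  apply: le_trans (ler_norm _) _; apply: le_trans (dotv_le _ _) _.
  rewrite mulrA ler_wpM2l//; apply: (@le_trans _ _ (\sum_i `|Phi i x - gam i|)).
    by rewrite (bigD1 i)//= lerDl sumr_ge0.
  by rewrite /residual lerDr addr_ge0.
Qed.

Lemma gap_residual (J : {set 'I_m}) : exists2 K : R, 0 <= K & forall gam x,
  (forall i, C i (gam i)) ->
  \sum_(t : T) Num.max 0 (constraint t x) + `|basis_eq h J x| <= K * residual gam x.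
Proof.
have [K KP] : exists K : T -> R, forall t, 0 <= K t /\ forall gam x,
    (forall i, C i (gam i)) -> Num.max 0 (constraint t x) <= K t * residual gam x.
  have /choice[K KP] : forall t : T, exists K : R, 0 <= K /\ forall gam x,
    (forall i, C i (gam i)) -> Num.max 0 (constraint t x) <= K * residual gam x.
    by move=> t; have [K K0 KP] := constraint_residual t; exists K.
  by exists K.
exists (\sum_t K t + m%:R * `|basis_sel J : 'M[R]_(m, _)|).
  by rewrite addr_ge0 ?mulr_ge0// sumr_ge0// => t _; have [] := KP t.
move=> gam x Cg; rewrite mulrDl; apply: lerD.
  by rewrite mulr_suml; apply: ler_sum => t _; have [_] := KP t; exact.
apply: le_trans (norm_mulmx_le _ _) _; rewrite -mulrA ler_wpM2l// mulrC ler_wpM2l//.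
rewrite /residual addrAC lerDr addr_ge0//; exact: sumr_ge0.
Qed.

(** Signed generators give inequalities on the conic part and equalities on the linear part; these
    extend to the whole cone [N i], and the signed components of [h] give all equations, also those
    outside the basis. *)
Lemma constraint_solution (y : E) : (forall t : T, constraint t y <= 0) ->
  [/\ forall i, g xbar 0 i = 0 -> g y 0 i <= 0, h y = 0 &
    forall i v, N i v -> dotv v (Phi i y - Phi i xbar) <= 0].
Proof.
move=> cy; split.
- by move=> i gi; have := cy (inr (inl i)); rewrite /= gi eqxx.
- apply/rowP => k; rewrite mxE; apply/eqP; rewrite eq_le; apply/andP; split.
    by have := cy (inr (inr (inl (k, false)))); rewrite /= dotv_signb_delta /signb expr0 mul1r.
  by have := cy (inr (inr (inl (k, true)))); rewrite /= dotv_signb_delta /signb expr1 mulN1r oppr_le0.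
move=> i v; rewrite NE; set z := Phi i y - Phi i xbar.
have cz a (aA : a \in (AI i `|` AE i)%fset) (b : bool) :
    (a \in AE i) || ((a \in AI i) && ~~ b) -> signb b * dotv a z <= 0.
  move=> li; pose a' : U := FSetSub (mem_gens aA).
  have := cy (inr (inr (inr (i, (a', b))))); rewrite /= /legit /= li.
  by rewrite -dotvBr dotvZl.
apply: (@sub_gcone _ _ _ _ (fun v => dotv v z <= 0)).
- by rewrite dotv0l.
- by move=> v1 v2 h1 h2; rewrite dotvDl -[leRHS](addr0 0) lerD.
- move=> a t aI t0; rewrite dotvZl mulr_ge0_le0//.
  have := cz a _ false; rewrite /signb expr0 mul1r; apply; last by rewrite aI orbT.
  by rewrite in_fsetU aI.
have z0 a : a \in AE i -> dotv a z = 0.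
  move=> aE; have aA : a \in (AI i `|` AE i)%fset by rewrite in_fsetU aE orbT.
  apply/eqP; rewrite eq_le; apply/andP; split.
    by have := cz a aA false; rewrite /signb expr0 mul1r aE; exact.
  by have := cz a aA true; rewrite /signb expr1 mulN1r oppr_le0 aE; exact.
move=> w; rewrite -[X in <<X>>%VS](map_id (AE i : seq _)).
move=> /(span_mapP id _ (fset_uniq _))[c ->].
rewrite dotv_suml big_seq big1// => a aE.
by rewrite dotvZl z0// mulr0.
Qed.

End subsystem_error_bound.

Lemma subsystem_error_bound (R : realType) (d n m l p : nat)
  (gen : forall q : nat, set 'rV[R]_q -> {fset 'rV[R]_q} * {fset 'rV[R]_q})
  (g : 'rV[R]_d -> 'rV[R]_n) (h : 'rV[R]_d -> 'rV[R]_m)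
  (Phi : 'I_l -> 'rV[R]_d -> 'rV[R]_p) (C : 'I_l -> set 'rV[R]_p) (xbar : 'rV[R]_d) :
  generator_choice gen -> (forall i, polyhedral (C i)) -> locally_lipschitz g ->
  subdiff_regular g -> smooth h -> (forall i, smooth (Phi i)) ->
  mpdc_rcpld (p := fun=> p) gen g h Phi C xbar ->
  exists alpha eps : R, [/\ 0 <= alpha, 0 < eps & forall x gam, `|x - xbar| < eps ->
    (forall i, C i (gam i)) -> exists2 y, solution_set (p := fun=> p) g h Phi C y &
      `|x - y| <= alpha * residual g h Phi gam x].
Proof.
move=> Hgen HC glip greg hsm Psm HR.
have [[gx hx Cx] _ _] := HR.
pose N i := regular_normal (C i) (Phi i xbar).
have [A AP] : exists A : 'I_l -> seq 'rV[R]_p, forall i, [/\ N i = polar (A i),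
    forall a z, a \in A i -> C i z -> dotv a (z - Phi i xbar) <= 0 &
    exists2 r : R, 0 < r & forall z, `|z - Phi i xbar| < r ->
     (forall a, a \in A i -> dotv a (z - Phi i xbar) <= 0) -> C i z].
  have /choice[A AP] := fun i => polyhedral_local (HC i) (Cx i).
  by exists A.
pose AI i := (gen p (N i)).1; pose AE i := (gen p (N i)).2.
have genE i : gen p (N i) = (AI i, AE i) by rewrite /AI /AE; case: (gen p (N i)).
have genN i : is_generator (N i) (AI i, AE i).
  rewrite -genE; apply: Hgen; have [-> _ _] := AP i; exact: polyhedral_cone_polar.
have NE i : N i = gcone (AI i) (AE i) by have [[]] := genN i.
have N_le i v z : N i v -> C i z -> dotv v (z - Phi i xbar) <= 0.
  have [-> Az _] := AP i => vN Cz; apply: vN => a aA; exact: Az.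
have [J HJ] := grad_basis h xbar.
have [rho [cH [del [M [rho0 gs]]]]] :=
  rcpld_gap_system glip greg hsm Psm genN genE Cx HR HJ.
have cb t : constraint g h Phi (AI := AI) (AE := AE) xbar t xbar <= 0.
  case: t => [u|[i|[q|[i q]]]] //=.
  - by case: ifP => // _; exact: gx.
  - by rewrite hx dotv0r.
  - by case: ifP => // _; rewrite subrr.
have hb : basis_eq h J xbar = 0 by rewrite /basis_eq hx mul0mx.
have [al0 [ep0 [al00 ep00 EB]]] := gap_error_bound (t0 := inl tt) gs rho0 cb hb (fun=> erefl).
have [K K0 KP] := gap_residual g h NE N_le J.
(* Inactive components of [g] are absent from the gap system; near [xbar] they stay negative by
   continuity. *)
have [r1 r10 gy] : exists2 r : R, 0 < r & forall i, g xbar 0 i != 0 ->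
    forall y, `|y - xbar| < r -> g y 0 i <= 0.
  apply: finite_radius => [i r r' rr H gi y yr|i].
    by apply: H => //; exact: lt_le_trans rr.
  have [gi|gi] := eqVneq (g xbar 0 i) 0; first by exists 1.
  have [r1 [L [r10 L0 Lg]]] := locally_lipschitz_ball xbar glip.
  have gn : 0 < - g xbar 0 i by rewrite oppr_gt0 lt_neqAle gi gx.
  exists (Num.min r1 (- g xbar 0 i / L)); first by rewrite lt_min r10 divr_gt0.
  move=> _ y; rewrite lt_min => /andP[yr1]; rewrite ltr_pdivlMr// mulrC => yr.
  have xb : `|xbar - xbar| < r1 by rewrite subrr normr0.
  have := Lg i y xbar yr1 xb; rewrite /coordf => h1.
  have := le_trans (ler_norm _) h1; move: yr gn; clear; lra.
have [r2 r20 Py] : exists2 r : R, 0 < r & forall i, forall y, `|y - xbar| < r ->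
    (forall a, a \in A i -> dotv a (Phi i y - Phi i xbar) <= 0) -> C i (Phi i y).
  apply: finite_radius => [i r r' rr H y yr|i].
    by apply: H; exact: lt_le_trans rr.
  have [_ _ [r r0 H]] := AP i.
  have /cvgrPdist_lt/(_ _ r0) cP := @smooth_continuous _ _ _ _ xbar (Psm i).
  have [r' r'0 H'] := iffLR (near_distP xbar (fun y => `|Phi i xbar - Phi i y| < r)) cP.
  by exists r' => // y /H' yr; apply: H; rewrite distrC.
pose ra := Num.min r1 r2; have ra0 : 0 < ra by rewrite lt_min r10.
have a1 : 0 < al0 + 1 by rewrite ltr_wpDl.
(* As [|x - y| <= al0 * |x - xbar|], the factor [al0 + 1] keeps [y] within [ra] of [xbar], where the
   local descriptions of [g] and of the pieces are valid. *)
exists (al0 * K), (Num.min ep0 (ra / (al0 + 1))); split.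
- exact: mulr_ge0.
- by rewrite lt_min ep00 divr_gt0.
move=> x gam; rewrite lt_min => /andP[xe]; rewrite ltr_pdivlMr// => xr Cg.
have [y [cy _ xy1 xy2]] := EB x xe.
have yr : `|y - xbar| < ra.
  apply: le_lt_trans xr; rewrite mulrC mulrDl mul1r -[y](subrK x) -addrA.
  by apply: le_trans (ler_normD _ _) _; rewrite lerD2r distrC.
move: yr; rewrite lt_min => /andP[yr1 yr2].
have [ya yh yN] := @constraint_solution R d n m l p g h Phi AI AE xbar N NE y cy.
exists y; last first.
  by apply: le_trans xy1 _; rewrite -mulrA ler_wpM2l// KP.
split=> // i.
  have [gi|gi] := eqVneq (g xbar 0 i) 0; first exact: ya.
  exact: gy.
apply: Py => // a aA; apply: yN; have [-> _ _] := AP i.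
by move=> w Aw; exact: Aw.
Qed.

(** * Equivalence of norms and distances *)

Section norms.
Context {R : realType} {d : nat} (N : 'rV[R]_d -> R) (HN : is_norm N).
Implicit Types (x y : 'rV[R]_d) (S : set 'rV[R]_d).

Lemma is_norm0 : N 0 = 0.
Proof. by have [_ NZ _] := HN; rewrite -(scale0r 0) NZ normr0 mul0r. Qed.

Lemma is_normN x : N (- x) = N x.
Proof. by have [_ NZ _] := HN; rewrite -scaleN1r NZ normrN1 mul1r. Qed.

Lemma is_norm_ge0 x : 0 <= N x.
Proof.
have [ND _ _] := HN; have := ND x (- x).
by rewrite subrr is_norm0 is_normN; lra.
Qed.

Lemma is_norm_le : exists2 c : R, 0 < c & forall x, N x <= c * `|x|.
Proof.
have [ND NZ _] := HN.
have S0 : 0 <= \sum_i N (delta_mx 0 i) by apply: sumr_ge0 => i _; exact: is_norm_ge0.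
exists (\sum_i N (delta_mx 0 i) + 1); first by rewrite ltr_wpDl.
move=> x; rewrite {1}[x]row_sum_delta.
apply: (@le_trans _ _ (\sum_i N (x 0 i *: delta_mx 0 i))).
  elim/big_rec2: _ => [|i u v _ uv]; first by rewrite is_norm0.
  by apply: le_trans (ND _ _) _; rewrite lerD2l.
rewrite mulrDl mul1r -[leLHS]addr0; apply: lerD => //; rewrite mulr_suml.
apply: ler_sum => i _; rewrite NZ mulrC ler_wpM2l ?is_norm_ge0//.
exact: normrV_coord.
Qed.

(** Otherwise max-norm unit vectors with [N] tending to 0 accumulate at a unit vector where [N]
    vanishes; the upper comparison supplies the continuity of [N]. *)
Lemma is_norm_ge : exists2 c : R, 0 < c & forall x, `|x| <= c * N x.
Proof.
have [ND NZ N0] := HN; have [c1 c10 Nc1] := is_norm_le.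
apply: contrapT => nc.
have ex k : exists x, `|x| = 1 /\ N x < k.+1%:R^-1.
  apply: contrapT => nx; apply: nc; exists k.+1%:R => [|x]; first by rewrite ltr0n.
  have [->|x0] := eqVneq x 0; first by rewrite normr0 mulr_ge0// is_norm_ge0.
  have xn : 0 < `|x| by rewrite normr_gt0.
  rewrite leNgt; apply/negP => h; apply: nx; exists (`|x|^-1 *: x).
  have xi : 0 < `|x|^-1 by rewrite invr_gt0.
  rewrite normrZ (gtr0_norm xi) mulVf ?gt_eqF//; split=> //.
  rewrite NZ (gtr0_norm xi) -(ltr_pM2l (ltr0Sn R k)) divff ?pnatr_eq0//.
  by rewrite mulrCA ltr_pdivrMl// mulr1.
have /choice[u uP] := ex.
have ub k : `|u k| <= 1 by have [-> _] := uP k.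
have [s [x [sk ux]]] := bolzano_weierstrass_rV ub.
have Nx : N x <= 0.
  apply/ler_addgt0Pl => e e0; rewrite addr0.
  have e1 : 0 < e / 2 / c1 by rewrite !divr_gt0.
  have e2 : 0 < e / 2 by rewrite divr_gt0.
  have [M HM] := invSn_lt e2.
  have /cvgrPdist_lt/(_ _ e1) [M' _ HM'] := ux.
  pose k := maxn M M'; have h1 : `|x - u (s k)| < e / 2 / c1 by apply: HM' => /=; exact: leq_maxr.
  have h2 : N (u (s k)) < e / 2.
    have [_ h] := uP (s k); apply: lt_trans h (HM _ _).
    by apply: leq_trans (leq_maxl M M') (sk _).
  have h3 : N x <= N (x - u (s k)) + N (u (s k)) by rewrite -{1}[x](subrK (u (s k))).
  have h4 : N (x - u (s k)) <= e / 2.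
    by apply: le_trans (Nc1 _) _; rewrite mulrC -ler_pdivlMr// ltW.
  by move: h2 h3 h4; clear; lra.
have x0 : x = 0 by apply: N0; apply/eqP; rewrite eq_le Nx is_norm_ge0.
have /cvgrPdist_lt/(_ 1 ltr01)[M _ /(_ M (leqnn M))] := ux.
by rewrite x0 sub0r normrN /=; have [-> _] := uP (s M); rewrite ltxx.
Qed.

Lemma dist_le S x y : S y -> dist N S x <= N (x - y).
Proof.
move=> Sy; apply: ge_inf; last by exists y.
by exists 0 => _ [z _ <-]; exact: is_norm_ge0.
Qed.

Lemma dist_adherent S x (e : R) : S !=set0 -> 0 < e -> exists2 y, S y & N (x - y) < dist N S x + e.
Proof.
move=> [y0 Sy0] e0.
have hi : has_inf [set N (x - y) | y in S].
  split; first by exists (N (x - y0)), y0.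
  by exists 0 => _ [z _ <-]; exact: is_norm_ge0.
by have [_ [y Sy <-] h] := inf_adherent e0 hi; exists y.
Qed.

Lemma dist_ge0 S x : S !=set0 -> 0 <= dist N S x.
Proof.
move=> [y0 Sy0]; apply: lb_le_inf; first by exists (N (x - y0)), y0.
by move=> _ [z _ <-]; exact: is_norm_ge0.
Qed.

End norms.

Lemma polyhedral_separated (R : realType) p (C : set 'rV[R]_p) y : polyhedral C -> ~ C y ->
  exists2 r : R, 0 < r & forall z, `|z - y| < r -> ~ C z.
Proof.
move=> [k [a [b ->]]] /existsNP[i /negP]; rewrite -ltNge => ai.
have K0 : 0 < p%:R * `|a i| + 1 by rewrite ltr_wpDl// mulr_ge0.
exists ((dotv (a i) y - b i) / (p%:R * `|a i| + 1)).
  by rewrite divr_gt0// subr_gt0.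
move=> z; rewrite ltr_pdivlMr// => zy /(_ i).
apply/negP; rewrite -ltNge -[z](subrK y) dotvDr.
have h1 : - dotv (a i) (z - y) <= p%:R * (`|a i| * `|z - y|).
  by rewrite -dotvNr; apply: le_trans (ler_norm _) _; rewrite dotvNr normrN dotv_le.
have h2 : 0 <= `|z - y| by [].
have h3 : `|z - y| * (p%:R * `|a i| + 1) = p%:R * (`|a i| * `|z - y|) + `|z - y|.
  by rewrite mulrDr mulr1 mulrC mulrA.
rewrite h3 in zy.
have aux (u v w t c : R) : w + t < u - c -> - v <= w -> 0 <= t -> c < v + u by lra.
exact: aux zy h1 h2.
Qed.

Theorem theorem4p2 (R : realType) (d n m l p K : nat)
  (Nd : 'rV[R]_d -> R) (Nn : 'rV[R]_n -> R) (Nm : 'rV[R]_m -> R)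
  (Np : 'rV[R]_p -> R)
  (gen : forall q : nat, set 'rV[R]_q -> {fset 'rV[R]_q} * {fset 'rV[R]_q})
  (g : 'rV[R]_d -> 'rV[R]_n) (h : 'rV[R]_d -> 'rV[R]_m)
  (Phi : 'I_l -> 'rV[R]_d -> 'rV[R]_p)
  (C : 'I_K -> set 'rV[R]_p) (Gamma : set 'rV[R]_p) (xbar : 'rV[R]_d)
  (HNd : is_norm Nd) (HNn : is_norm Nn) (HNm : is_norm Nm) (HNp : is_norm Np)
  (Hgen : generator_choice gen)
  (HC : forall r, polyhedral (C r))
  (HGamma : Gamma = \bigcup_r C r)
  (Hglip : locally_lipschitz g)
  (Hgreg : subdiff_regular g)
  (Hh : smooth h)
  (HPhi : forall i, smooth (Phi i))
  (Hxbar : solution_set (p := fun=> p) g h Phi (fun=> Gamma) xbar)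
  (HRCPLD : mpdc_prcpld gen g h Phi C xbar) :
  error_bound Nd Nn Nm Np g h Phi Gamma xbar.
Proof.
have [gx hx Gx] := Hxbar.
have [cd cd0 Ncd] := is_norm_le HNd; have [ed ed0 Ned] := is_norm_ge HNd.
have [en en0 Nen] := is_norm_ge HNn; have [em em0 Nem] := is_norm_ge HNm.
have [cp cp0 Ncp] := is_norm_le HNp; have [ep ep0 Nep] := is_norm_ge HNp.
have [ND _ _] := HNp.
(* These are the choices of pieces to which the hypothesis applies. There are finitely many, so one
   constant and one radius serve them all. *)
pose ok (s : {ffun 'I_l -> 'I_K}) := forall i, C (s i) (Phi i xbar).
have [al alP] : exists al : {ffun 'I_l -> 'I_K} -> R, forall s, 0 <= al s /\
    exists2 eps : R, 0 < eps & ok s -> forall x gam, `|x - xbar| < eps ->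
    (forall i, C (s i) (gam i)) ->
    exists2 y, solution_set (p := fun=> p) g h Phi (fun i => C (s i)) y &
      `|x - y| <= al s * residual g h Phi gam x.
  suff /choice[al alP] : forall s : {ffun 'I_l -> 'I_K}, exists al : R, 0 <= al /\
    exists2 eps : R, 0 < eps & ok s -> forall x gam, `|x - xbar| < eps ->
    (forall i, C (s i) (gam i)) ->
    exists2 y, solution_set (p := fun=> p) g h Phi (fun i => C (s i)) y &
      `|x - y| <= al * residual g h Phi gam x by exists al.
  move=> s; have [oks|nok] := pselect (ok s); last by exists 0; split=> //; exists 1.
  have HR : mpdc_rcpld (p := fun=> p) gen g h Phi (fun i => C (s i)) xbar.
    by apply: HRCPLD; split.
  have [al [eps [al0 eps0 H]]] :=
    subsystem_error_bound Hgen (fun i => HC (s i)) Hglip Hgreg Hh HPhi HR.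
  by exists al; split=> //; exists eps.
have [e1 e10 e1P] : exists2 eps : R, 0 < eps & forall s, ok s ->
    forall x gam, `|x - xbar| < eps -> (forall i, C (s i) (gam i)) ->
    exists2 y, solution_set (p := fun=> p) g h Phi (fun i => C (s i)) y &
      `|x - y| <= al s * residual g h Phi gam x.
  apply: finite_radius => [s r r' rr H oks x gam xr|s].
    by apply: H => //; exact: lt_le_trans rr.
  by have [_ [eps eps0 H]] := alP s; exists eps.
(* A piece missing [Phi_i(xbar)] keeps a positive distance from it, so a piece met within [r0]
   contains that point. *)
have [r0 r00 r0P] : exists2 r : R, 0 < r & forall q : 'I_l * 'I_K,
    forall z, `|z - Phi q.1 xbar| < r -> C q.2 z -> C q.2 (Phi q.1 xbar).
  apply: finite_radius => [q r r' rr H z zr|q].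
    by apply: H; exact: lt_le_trans rr.
  have [Cq|nCq] := pselect (C q.2 (Phi q.1 xbar)); first by exists 1.
  have [r r0 H] := polyhedral_separated (HC q.2) nCq.
  by exists r => // z zr Cz; case: (H z zr).
(* In the norm [Np], the point [gam i] is within [3 * q] of [Phi_i(xbar)]: one [q] for the
   displacement of [Phi_i], one for the distance to [Gamma], one for the slack [e]. *)
pose q := r0 / ep / 4.
have q0 : 0 < q by rewrite !divr_gt0.
have [e2 e20 e2P] : exists2 eps : R, 0 < eps & forall i x, `|x - xbar| < eps ->
    Np (Phi i x - Phi i xbar) < q.
  apply: finite_radius => [i r r' rr H x xr|i].
    by apply: H; exact: lt_le_trans rr.
  have qc : 0 < q / cp by rewrite divr_gt0.
  have /cvgrPdist_lt/(_ _ qc) cP := @smooth_continuous _ _ _ _ xbar (HPhi i).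
  have [r r0' H] := iffLR (near_distP xbar (fun x => `|Phi i xbar - Phi i x| < q / cp)) cP.
  exists r => // x /H xr; apply: le_lt_trans (Ncp _) _.
  by rewrite mulrC -ltr_pdivlMr// distrC.
have GC z : Gamma z <-> exists r, C r z.
  by rewrite HGamma; split=> [[r _ Cz]|[r Cz]]; exists r.
pose A := \sum_s al s; pose B := en + em + ep.
have al0 s : 0 <= al s by have [] := alP s.
have A0 : 0 <= A by apply: sumr_ge0.
have B0 : 0 <= B by rewrite !addr_ge0// ltW.
pose res x := Nn (posp (g x)) + Nm (h x) + \sum_i dist Np Gamma (Phi i x).
have G0 (i : 'I_l) : Gamma !=set0 by exists (Phi i xbar); exact: Gx.
(* The slack [e] stands for using points that nearly attain the infimum in [dist]; it is sent to 0
   at the end. *)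
have step x (e : R) : `|x - xbar| < Num.min e1 e2 -> 0 < e -> e < q ->
    dist Nd (solution_set (p := fun=> p) g h Phi (fun=> Gamma)) x <=
    cd * A * B * (res x + l%:R * e).
  rewrite lt_min => /andP[x1 x2] e0 eq.
  have [gam gamP] : exists gam : 'I_l -> 'rV[R]_p, forall i, Gamma (gam i) /\
      Np (Phi i x - gam i) < dist Np Gamma (Phi i x) + e.
    have /choice[gam gamP] : forall i, exists z, Gamma z /\
        Np (Phi i x - z) < dist Np Gamma (Phi i x) + e.
      by move=> i; have [z Gz zP] := dist_adherent HNp (Phi i x) (G0 i) e0; exists z.
    by exists gam.
  have [s sP] : exists s : {ffun 'I_l -> 'I_K}, forall i, C (s i) (gam i).
    have /choice[s sP] : forall i, exists r, C r (gam i).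
      by move=> i; apply/GC; have [] := gamP i.
    by exists [ffun i => s i] => i; rewrite ffunE.
  have oks : ok s.
    move=> i; apply: (r0P (i, s i) (gam i)) => //=.
    apply: le_lt_trans (Nep _) _.
    have -> : r0 = ep * (4 * q) by rewrite /q; field; rewrite gt_eqF.
    rewrite ltr_pM2l//.
    have h1 : Np (gam i - Phi i xbar) <= Np (gam i - Phi i x) + Np (Phi i x - Phi i xbar).
      by rewrite -{1}[gam i](subrK (Phi i x)) -addrA.
    have h2 : Np (gam i - Phi i x) = Np (Phi i x - gam i).
      by rewrite -opprB is_normN.
    have h3 := e2P i x x2; have [_ h4] := gamP i.
    have h5 := dist_le HNp (Phi i x) (Gx i).
    move: h1 h3 h4 h5 eq q0; rewrite h2; clear; lra.
  have [y [gy hy Cy] xy] := e1P s oks x gam x1 sP.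
  have Fy : solution_set (p := fun=> p) g h Phi (fun=> Gamma) y.
    by split=> // i; apply/GC; exists (s i).
  apply: le_trans (dist_le HNd x Fy) _; apply: le_trans (Ncd _) _.
  rewrite -!mulrA; apply: ler_wpM2l; first exact: ltW.
  apply: le_trans xy _; apply: ler_pM => //.
  - exact: residual_ge0.
  - by rewrite /A (bigD1 s)//= lerDl sumr_ge0.
  have n0 := is_norm_ge0 HNn (posp (g x)); have m0 := is_norm_ge0 HNm (h x).
  have s0 : 0 <= \sum_i dist Np Gamma (Phi i x) + l%:R * e.
    rewrite addr_ge0 ?mulr_ge0 ?(ltW e0)// sumr_ge0// => i _.
    exact: (dist_ge0 HNp (Phi i x) (G0 i)).
  have hs : \sum_i `|Phi i x - gam i| <= ep * (\sum_i dist Np Gamma (Phi i x) + l%:R * e).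
    have -> : \sum_i dist Np Gamma (Phi i x) + l%:R * e =
        \sum_i (dist Np Gamma (Phi i x) + e).
      by rewrite big_split /= sumr_const card_ord mulr_natl.
    rewrite mulr_sumr; apply: ler_sum => i _; apply: le_trans (Nep _) _.
    by rewrite ler_wpM2l ?(ltW ep0)// ltW//; have [] := gamP i.
  have pn := Nen (posp (g x)); have pm := Nem (h x).
  rewrite /residual /res /B.
  have -> : Nn (posp (g x)) + Nm (h x) + \sum_i dist Np Gamma (Phi i x) + l%:R * e =
    Nn (posp (g x)) + Nm (h x) + (\sum_i dist Np Gamma (Phi i x) + l%:R * e) by rewrite addrA.
  move: n0 m0 s0 hs pn pm en0 em0 ep0.
  move: (Nn _) (Nm _) (\sum_i dist _ _ _ + _) (\sum_i `|_|) `|posp _| `|h x|.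
  by clear => a1 a2 a3 b3 b1 b2 *; nra.
(* [ed] converts the radius to the norm [Nd], and the 2 passes from the closed ball of the
   conclusion to the open one of [step]. *)
pose ef : R := Num.min e1 e2 / (2 * ed).
have mn : 0 < Num.min e1 e2 by rewrite lt_min e10.
have cAB : 0 <= cd * A * B by rewrite !mulr_ge0// ltW.
exists (cd * A * B), ef; split=> //; first by rewrite divr_gt0// mulr_gt0.
move=> x xe; have xr : `|x - xbar| < Num.min e1 e2.
  apply: le_lt_trans (Ned _) _; apply: (@le_lt_trans _ _ (ed * ef)).
    by rewrite ler_wpM2l// ltW.
  have -> : ed * ef = Num.min e1 e2 / 2 by rewrite /ef; field; rewrite gt_eqF.
  by move: mn; clear; lra.
apply/ler_addgt0Pl => e e0; rewrite addrC.
pose k := cd * A * B * l%:R + 1.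
have k0 : 0 < k by rewrite ltr_wpDl// mulr_ge0.
pose e' := Num.min (q / 2) (e / k).
have e'0 : 0 < e' by rewrite lt_min !divr_gt0.
have e'q : e' < q by apply: le_lt_trans (_ : q / 2 < q); [rewrite ge_min lexx|move: q0; clear; lra].
apply: le_trans (step x e' xr e'0 e'q) _.
rewrite mulrDr lerD2l mulrA; apply: (@le_trans _ _ (k * e')).
  by rewrite ler_wpM2r ?(ltW e'0)// lerDl.
by rewrite mulrC -ler_pdivlMr// ge_min lexx orbT.
Qed.
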